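(* Assume (A1)–(A5). Then the blow-up time function $x\mapsto T(x)$ is of class $\mathcal{C}^1$ in $B_{R^*}$.
   Context: Let $p>1$ and $\mu>0$ with $p<1+2/\mu$, and let $R^*,T^*>0$. Write $B_R=\{x\in\mathbb{R}:|x|<R\}$ and $D_\pm=\partial_t\pm\partial_x$. Consider the system $D_-\phi=2^{-p}|\phi+\psi|^p-\frac{\mu}{1+t}\frac{\phi+\psi}{2}$, $D_+\psi=2^{-p}|\phi+\psi|^p-\frac{\mu}{1+t}\frac{\phi+\psi}{2}$, $\phi(x,0)=f(x)$, $\psi(x,0)=g(x)$. Fix $\gamma_1,\gamma_2>0$ with $\gamma_1+\gamma_2>\max\big(1,(\mu p 2^p)^{1/(p-1)}\big)$ and let $T_1=\frac{1}{(p-1)\mu}\ln\Big(\frac{2^{1-p}/\mu}{2^{1-p}/\mu-(\gamma_1+\gamma_2)^{1-p}}\Big)$. Assumptions: (A1) $T_1<T^*$. (A2) $f\ge\gamma_1$, $g\ge\gamma_2$ on $B_{R^*+T^*}$. (A3) $f,g\in\mathcal{C}^4(\overline{B_{R^*+T^*}})$. (A4) There is $\varepsilon_0>0$ with $2^{-p}(\gamma_1+\gamma_2)^p-\frac{\mu}{2}(\gamma_1+\gamma_2)\ge(2+\varepsilon_0)\max_{x\in B_{R^*+T^*}}(|f'(x)|+|g'(x)|)$. (A5) There is $\varepsilon_1\neq-1$ with $2^{-p}(2p-1)\big(1+\frac{\varepsilon_1}{2(1+\varepsilon_1)}\big)\big(1-\frac{1}{2p}\big)-2^{-p+1}p-\mu>0$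 such that $2^{-p}(\gamma_1+\gamma_2)^p-\frac{\mu}{2}(\gamma_1+\gamma_2)\ge(2+\varepsilon_1)\max_{x\in B_{R^*+T^*}}(|f'(x)|+|g'(x)|)$. Let $K_{R^*,T^*}=\{(x,t):t>0,\ |x-x_0|<T^*-t\ \text{for some } x_0\in B_{R^*}\}$. Define iterates $\phi_0\equiv\gamma_1$, $\psi_0\equiv\gamma_2$ and, with $\mathcal{N}_n(x,s)=2^{-p}|\phi_n+\psi_n|^p(x,s)-\frac{\mu}{1+s}\frac{(\phi_n+\psi_n)(x,s)}{2}$, $\phi_{n+1}(x,t)=f(x+t)+\int_0^t\mathcal{N}_n(x+t-s,s)\,ds$, $\psi_{n+1}(x,t)=g(x-t)+\int_0^t\mathcal{N}_n(x-t+s,s)\,ds$. Set $\phi=\sup_n\phi_n$, $\psi=\sup_n\psi_n$ and $T(x)=\sup\{t\in(0,T^* ):(\phi+\psi)(x,t)<\infty\}$ for $x\in B_{R^*}$. *)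

(* Defs.v *)
From Stdlib Require Import Reals.
From Coquelicot Require Import Coquelicot.
Open Scope R_scope.

Definition abs_pow (y p : R) : R :=
  if Req_EM_T y 0 then 0 else Rpower (Rabs y) p.

Definition nonlin (p mu u s : R) : R :=
  Rpower 2 (- p) * abs_pow u p - mu / (1 + s) * (u / 2).

Fixpoint iterates (p mu : R) (f g : R -> R) (gamma1 gamma2 : R) (n : nat)
  : (R -> R -> R) * (R -> R -> R) :=
  match n with
  | O => (fun _ _ => gamma1, fun _ _ => gamma2)
  | S m =>
      let (ph, ps) := iterates p mu f g gamma1 gamma2 m in
      let N := fun x s => nonlin p mu (ph x s + ps x s) s in
      (fun x t => f (x + t) + RInt (fun s => N (x + t - s) s) 0 t,
       fun x t => g (x - t) + RInt (fun s => N (x - t + s) s) 0 t)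
  end.

Definition phi_n p mu f g gamma1 gamma2 n := fst (iterates p mu f g gamma1 gamma2 n).
Definition psi_n p mu f g gamma1 gamma2 n := snd (iterates p mu f g gamma1 gamma2 n).

Definition phi_sup p mu f g gamma1 gamma2 (x t : R) : Rbar :=
  Sup_seq (fun n => phi_n p mu f g gamma1 gamma2 n x t).
Definition psi_sup p mu f g gamma1 gamma2 (x t : R) : Rbar :=
  Sup_seq (fun n => psi_n p mu f g gamma1 gamma2 n x t).

Definition blowup_time p mu f g gamma1 gamma2 (Tstar x : R) : Rbar :=
  Lub_Rbar (fun t => 0 < t < Tstar /\
    Rbar_lt (Rbar_plus (phi_sup p mu f g gamma1 gamma2 x t)
                       (psi_sup p mu f g gamma1 gamma2 x t)) p_infty).

(* f in C^k( closure of B_r ):  f is C^k in the open ball B_r and all its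
   derivatives of order <= k extend continuously to the closed ball. *)
Definition Ck_closed_ball (k : nat) (r : R) (f : R -> R) : Prop :=
  (forall j, (j <= k)%nat -> forall x, Rabs x < r ->
      ex_derive_n f j x /\ continuous (Derive_n f j) x) /\
  (forall j, (j <= k)%nat -> forall y, Rabs y <= r ->
      exists l : R, filterlim (Derive_n f j)
                      (within (fun x => Rabs x < r) (locally y)) (locally l)).

Definition max_deriv (r : R) (f g : R -> R) : R :=
  real (Lub_Rbar (fun y => exists x, Rabs x < r /\
                    y = Rabs (Derive f x) + Rabs (Derive g x))).

Definition T1 (p mu gamma1 gamma2 : R) : R :=
  / ((p - 1) * mu) *
  ln ((Rpower 2 (1 - p) / mu) /
      (Rpower 2 (1 - p) / mu - Rpower (gamma1 + gamma2) (1 - p))).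

Definition C1_on_ball (r : R) (h : R -> R) : Prop :=
  forall x, Rabs x < r -> ex_derive h x /\ continuous (Derive h) x.

(* Main.v *)
Require Import Defs.
From Stdlib Require Import Reals Lra Psatz Ranalysis5 FunctionalExtensionality.
From Coquelicot Require Import Coquelicot.
Open Scope R_scope.

(** Write [u = phi + psi] and [N] for the right-hand side. By monotonicity of the
iterates, [phi] and [psi] increase along every direction [(v, 1)] with
[|v| <= 1 + eps0]; hence [|phi_x| <= lam phi_t] and [|psi_x| <= lam psi_t] with
[lam = 1 / (1 + eps0) < 1], the blow-up curve is [lam]-Lipschitz, and [u ^ (1 - p)]
is comparable with the time left to blow-up.

Both [(phi_x, psi_x)] and [(phi_t, psi_t)] solve, up to the explicit time dependence
of the damping, the linearised system, whose coefficient is positive. So the ratios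
[r1 = phi_x / phi_t] and [r2 = psi_x / psi_t] satisfy
  [D_- r1 = k1 (r2 - r1) + O(1)],  [D_+ r2 = k2 (r1 - r2) + O(1)],
with [k1], [k2] of the order of 1 / (time left). At scale [s] below a point of the
curve every value is therefore, up to [O(s)], an average of the values at scale
[4 s] in which [r2] over a fixed interval of length comparable with [s] has a
definite weight; this contracts the oscillation by a fixed factor. Hence [r1], [r2]
converge uniformly at the curve to a common limit [rho], and since the level lines
of [u] have slope between [- r1] and [- r2], the curve is [C^1] with slope [- rho]. *)

(** * Integration along characteristics *)

(** The exact solution is infinite above the curve and the power is not globally Lipschitz, so no
    estimate is made on the exact solution itself. For each level [M] the power is continued
    affinely outside [[gam, M]], which yields a solution [sol M] differentiable on the whole plane.
    Below a point where [u <= M] the truncation is never felt, because u increases along directions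
    wider than the light cone. Every statement about the exact solution is one about a large enough
    [M], and the constants used near the curve must not depend on [M]. Positivity of the linearised
    coefficient comes from the lower bound on gamma1 + gamma2, which keeps the damping below half of
    the power term. The excess eps0 over the factor 2 in the smallness of the derivatives is what
    makes lam < 1, hence both time derivatives comparable with the source. The ratios are
    differentiated only along their own characteristics, where first derivatives of the solution
    suffice. Their coupling is singular like 1 / (time left), so it integrates to a comparable
    amount between time left 4 s and s for every s; this is why the contraction factor is the same
    at all scales. *)

Ltac Rring := match goal with |- @eq _ ?a ?b => change (@eq R a b); ring end.

Definition cont2 (h : R -> R -> R) : Prop :=
  forall z : R * R, continuous (fun z => h (fst z) (snd z)) z.

Lemma cont2_path (h : R -> R -> R) (u v : R -> R) (x : R) :
  cont2 h -> continuous u x -> continuous v x ->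
  continuous (fun s => h (u s) (v s)) x.
Proof.
  intros Hh Hu Hv.
  exact (continuous_comp_2 u v h x Hu Hv (Hh (u x, v x))).
Qed.

Lemma cont2_comp (h u v : R -> R -> R) :
  cont2 h -> cont2 u -> cont2 v -> cont2 (fun x y => h (u x y) (v x y)).
Proof.
  intros Hh Hu Hv z.
  exact (continuous_comp_2 (fun z => u (fst z) (snd z)) (fun z => v (fst z) (snd z))
           h z (Hu z) (Hv z) (Hh _)).
Qed.

Lemma cont2_pt (h : R -> R -> R) (x y : R) : cont2 h -> continuity_2d_pt h x y.
Proof. intros Hh. apply continuity_2d_pt_filterlim, (Hh (x, y)). Qed.

Lemma cont2_of_pt (h : R -> R -> R) :
  (forall x y, continuity_2d_pt h x y) -> cont2 h.
Proof. intros Hh [x y]. apply continuity_2d_pt_filterlim, Hh. Qed.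

Lemma continuous_affine (a b x : R) : continuous (fun s => a + b * s) x.
Proof.
  apply (continuous_plus (fun _ => a) (fun s => b * s)).
  apply continuous_const.
  apply (continuous_mult (fun _ => b) (fun s => s)).
  apply continuous_const. apply continuous_id.
Qed.

Lemma cont2_line (h : R -> R -> R) (a b c d x : R) :
  cont2 h -> continuous (fun s => h (a + b * s) (c + d * s)) x.
Proof. intros Hh. apply cont2_path; auto; apply continuous_affine. Qed.

Lemma continuous_ext_fun (f g : R -> R) (x : R) :
  (forall y, f y = g y) -> continuous f x -> continuous g x.
Proof. intros E H. apply (continuous_ext f g x E H). Qed.

Lemma cont2_char (h : R -> R -> R) (x e t s : R) :
  cont2 h -> continuous (fun s => h (x + e * (t - s)) s) s.
Proof.
  intros Hh.
  apply (continuous_ext_fun (fun s => h ((x + e * t) + (- e) * s) (0 + 1 * s))).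
  intros y; f_equal; ring.
  now apply cont2_line.
Qed.

Lemma ex_RInt_cont (f : R -> R) (a b : R) :
  (forall x, continuous f x) -> ex_RInt f a b.
Proof. intros H. apply (@ex_RInt_continuous R_CompleteNormedModule); auto. Qed.

Lemma RInt_minus_cont (f g : R -> R) (a b : R) :
  (forall x, continuous f x) -> (forall x, continuous g x) ->
  RInt (fun s => f s - g s) a b = RInt f a b - RInt g a b.
Proof.
  intros Hf Hg. apply (RInt_minus f g); now apply ex_RInt_cont.
Qed.

Lemma RInt_scal_R (f : R -> R) (k a b : R) :
  (forall x, continuous f x) -> RInt (fun y => k * f y) a b = k * RInt f a b.
Proof. intros Hf. apply (RInt_scal f). now apply ex_RInt_cont. Qed.

Lemma RInt_swap_R (f : R -> R) (a b : R) :
  (forall x, continuous f x) -> RInt f a b = - RInt f b a.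
Proof.
  intros Hf. rewrite <- (opp_RInt_swap f b a) by now apply ex_RInt_cont. reflexivity.
Qed.

Lemma RInt_affine (f : R -> R) (u v a b : R) :
  (forall x, continuous f x) -> u * RInt (fun y => f (u * y + v)) a b = RInt f (u * a + v) (u * b + v).
Proof.
  intros Hf. rewrite <- (RInt_comp_lin f u v a b) by now apply ex_RInt_cont.
  symmetry. apply (RInt_scal_R (fun y => f (u * y + v))).
  intros x. apply (continuous_comp (fun y => u * y + v) f); auto.
  apply (continuous_ext_fun (fun y => v + u * y)). intros y; ring. apply continuous_affine.
Qed.

Lemma is_derive_cst (c x : R) : is_derive (fun _ : R => c) x 0.
Proof. auto_derive; auto. Qed.

Lemma is_derive_prim (f : R -> R) (a b : R) :
  (forall x, continuous f x) -> is_derive (fun b => RInt f a b) b (f b).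
Proof.
  intros Hf. apply (is_derive_RInt f (fun b => RInt f a b) a b); auto.
  apply filter_forall. intros c. apply (@RInt_correct R_CompleteNormedModule), ex_RInt_cont, Hf.
Qed.

(* The solution operator of (d_t - e d_x) A = h, A(.,0) = f. *)
Definition charop (e : R) (f : R -> R) (h : R -> R -> R) (x t : R) : R :=
  f (x + e * t) + RInt (fun s => h (x + e * (t - s)) s) 0 t.

Lemma charop_zero e f h x : charop e f h x 0 = f x.
Proof. unfold charop. rewrite RInt_point. unfold zero; simpl. rewrite Rmult_0_r, !Rplus_0_r. reflexivity. Qed.

Lemma continuous_reflect (g : R -> R) (x : R) :
  (forall s, continuous g s) -> continuous (fun s => g (- s)) x.
Proof.
  intros Hg. apply (continuous_comp (fun s => - s) g); auto.
  apply (continuous_ext_fun (fun s => 0 + (-1) * s)). intros y; ring.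
  apply continuous_affine.
Qed.

Lemma abs_RInt_le_gen (f : R -> R) (a b M : R) :
  (forall s, continuous f s) ->
  (forall s, Rmin a b <= s <= Rmax a b -> Rabs (f s) <= M) ->
  Rabs (RInt f a b) <= Rabs (b - a) * M.
Proof.
  intros Hf HM.
  destruct (Rle_dec a b) as [H|H].
  - rewrite (Rabs_pos_eq (b - a)) by lra. apply abs_RInt_le_const; auto.
    apply ex_RInt_cont; auto. intros s Hs. apply HM. rewrite Rmin_left, Rmax_right; lra.
  - rewrite <- (opp_RInt_swap f) by (apply ex_RInt_cont; auto).
    unfold opp; simpl. rewrite Rabs_Ropp, Rabs_minus_sym, (Rabs_pos_eq (a - b)) by lra.
    apply abs_RInt_le_const; auto. lra. apply ex_RInt_cont; auto.
    intros s Hs. apply HM. rewrite Rmin_right, Rmax_left; lra.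
Qed.

(** Integration gains a factor 1 / L on functions of size exp (L |s|): in this weighted norm
    Picard's map contracts globally in time once L is large. *)
Lemma RInt_exp_bound (L C : R) (g : R -> R) (t : R) :
  0 < L -> 0 <= C -> (forall s, continuous g s) ->
  (forall s, Rabs (g s) <= C * exp (L * Rabs s)) ->
  Rabs (RInt g 0 t) <= C / L * exp (L * Rabs t).
Proof.
  intros HL HC Hg Hb.
  assert (P : forall (g : R -> R) t, 0 <= t -> (forall s, continuous g s) ->
    (forall s, Rabs (g s) <= C * exp (L * Rabs s)) ->
    Rabs (RInt g 0 t) <= C / L * exp (L * Rabs t)).
  { clear g t Hg Hb. intros g t Ht Hg Hb.
    assert (HI : is_RInt (fun s => C * exp (L * s)) 0 t
                   (minus (C / L * exp (L * t)) (C / L * exp (L * 0)))).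
    { apply (is_RInt_derive (fun s => C / L * exp (L * s))).
      - intros x _. auto_derive; auto. field. lra.
      - intros x _. apply (ex_derive_continuous (fun s => C * exp (L * s))). auto_derive; auto. }
    apply Rle_trans with (RInt (fun s => C * exp (L * s)) 0 t).
    - apply Rle_trans with (RInt (fun s => Rabs (g s)) 0 t).
      + apply abs_RInt_le; auto. apply ex_RInt_cont; auto.
      + apply RInt_le; auto.
        * apply ex_RInt_cont. intros x. apply (continuous_comp g Rabs); auto.
          apply continuous_Rabs.
        * eexists; apply HI.
        * intros x Hx. specialize (Hb x). rewrite (Rabs_pos_eq x) in Hb; lra.
    - rewrite (is_RInt_unique _ _ _ _ HI). unfold minus, plus, opp; simpl.
      rewrite Rmult_0_r, exp_0, (Rabs_pos_eq t) by auto.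
      assert (0 <= C / L). { apply Rmult_le_pos; auto. apply Rlt_le, Rinv_0_lt_compat; auto. }
      lra. }
  destruct (Rle_dec 0 t) as [Ht|Ht].
  - now apply P.
  - assert (E : RInt g 0 t = - RInt (fun y => g (- y)) 0 (- t)).
    { assert (H0 := RInt_comp_lin g (-1) 0 0 (- t)).
      rewrite !Rmult_0_r, !Rplus_0_r in H0.
      replace (-1 * - t) with t in H0 by ring.
      rewrite <- H0 by (apply ex_RInt_cont; auto).
      rewrite <- (RInt_opp (fun y => g (- y))).
      - apply RInt_ext. intros y _. unfold scal, opp; simpl. unfold mult; simpl.
        replace (-1 * y + 0) with (- y) by ring. ring.
      - apply ex_RInt_cont. intros y. apply continuous_reflect; auto. }
    rewrite E, Rabs_Ropp, <- (Rabs_Ropp t). apply P. lra.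
    + intros s. apply continuous_reflect; auto.
    + intros s. rewrite <- (Rabs_Ropp s). apply Hb.
Qed.

Lemma charop_diff_bound (e L C : R) f h k x t :
  0 < L -> 0 <= C -> cont2 h -> cont2 k ->
  (forall y s, Rabs (h y s - k y s) <= C * exp (L * Rabs s)) ->
  Rabs (charop e f h x t - charop e f k x t) <= C / L * exp (L * Rabs t).
Proof.
  intros HL HC Hh Hk Hb. unfold charop.
  assert (Ch1 := fun s => cont2_char h x e t s Hh).
  assert (Ck1 := fun s => cont2_char k x e t s Hk).
  assert (E := RInt_minus_cont _ _ 0 t Ch1 Ck1). simpl in E.
  match goal with |- Rabs ?a <= _ => match type of E with ?b = _ => replace a with b by (rewrite E; Rring) end end.
  apply RInt_exp_bound; auto.
  intros s. apply (continuous_minus (fun s => h (x + e * (t - s)) s) (fun s => k (x + e * (t - s)) s)); auto.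
Qed.

Lemma charop_bound (e L C B : R) f h x t :
  0 < L -> 0 <= C -> cont2 h -> (forall y, Rabs (f y) <= B) ->
  (forall y s, Rabs (h y s) <= C * exp (L * Rabs s)) ->
  Rabs (charop e f h x t) <= B + C / L * exp (L * Rabs t).
Proof.
  intros HL HC Hh Hf Hb. unfold charop.
  apply Rle_trans with (1 := Rabs_triang _ _).
  apply Rplus_le_compat; auto.
  apply RInt_exp_bound; auto. intros s. now apply cont2_char.
Qed.

Lemma cont2_charop (e : R) f h :
  (forall x, continuous f x) -> cont2 h -> cont2 (charop e f h).
Proof.
  intros Hf Hh z. unfold charop.
  apply (continuous_plus (fun z : R * R => f (fst z + e * snd z))
    (fun z : R * R => RInt (fun s => h (fst z + e * (snd z - s)) s) 0 (snd z))).
  { apply (continuous_comp (fun z : R * R => fst z + e * snd z) f); auto.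
    apply (continuous_plus (fun z : R * R => fst z)); [apply continuous_fst|].
    apply (continuous_mult (fun _ => e) (fun z : R * R => snd z)).
    apply continuous_const. apply continuous_snd. }
  revert z. apply (cont2_of_pt (fun x t => RInt (fun s => h (x + e * (t - s)) s) 0 t)).
  intros x t eps.
  (* The box [-X, X] x [-T, T] contains every characteristic leading to a point within distance 1 of
     (x, t), so uniform continuity of [h] applies to all the integrands compared below. *)
  set (T := Rabs t + 1). set (X := Rabs x + 1 + 2 * Rabs e * T).
  assert (HT : 1 <= T) by (unfold T; generalize (Rabs_pos t); lra).
  assert (He := Rabs_pos e).
  destruct (uniform_continuity_2d h (-X) X (-T) T (fun a b _ _ => cont2_pt h a b Hh)
     (mkposreal (eps / (4 * T)) ltac:(apply Rdiv_lt_0_compat; [apply cond_pos | lra]))) as [d Hd].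
  simpl in Hd.
  assert (E0 := cond_pos eps).
  assert (Cx := fun s => cont2_char h x e t s Hh).
  destruct (ex_derive_continuous (fun b => RInt (fun s => h (x + e * (t - s)) s) 0 b) t
     (ex_intro _ _ (is_derive_prim (fun s => h (x + e * (t - s)) s) 0 t Cx))
     (ball (RInt (fun s => h (x + e * (t - s)) s) 0 t) (eps / 4))
     ltac:(exists (mkposreal (eps / 4) ltac:(lra)); auto)) as [d' Hd'].
  assert (Hdel : 0 < Rmin 1 (Rmin (d / (2 * (1 + Rabs e))) d')).
  { repeat apply Rmin_pos. lra. apply Rdiv_lt_0_compat. apply cond_pos. lra. apply cond_pos. }
  exists (mkposreal _ Hdel). simpl. intros u v Hu Hv.
  assert (M1 := Rmin_l 1 (Rmin (d / (2 * (1 + Rabs e))) d')).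
  assert (M2 := Rmin_r 1 (Rmin (d / (2 * (1 + Rabs e))) d')).
  assert (M3 := Rmin_l (d / (2 * (1 + Rabs e))) d').
  assert (M4 := Rmin_r (d / (2 * (1 + Rabs e))) d').
  assert (Hv1 : Rabs v <= T).
  { unfold T. replace v with (t + (v - t)) by ring. apply Rle_trans with (1 := Rabs_triang _ _). lra. }
  assert (Hu1 : Rabs u <= Rabs x + 1).
  { replace u with (x + (u - x)) by ring. apply Rle_trans with (1 := Rabs_triang _ _). lra. }
  assert (Ht1 : Rabs t <= T) by (unfold T; lra).
  assert (Cu := fun s => cont2_char h u e v s Hh).
  specialize (Hd' v ltac:(unfold ball; simpl; unfold AbsRing_ball, abs, minus, plus, opp; simpl; fold (v - t); lra)).
  unfold ball in Hd'; simpl in Hd'; unfold AbsRing_ball, abs, minus, plus, opp in Hd'; simpl in Hd'.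
  assert (B : forall a b s, Rabs a <= Rabs x + 1 -> Rabs b <= T -> Rabs s <= T -> Rabs (a + e * (b - s)) <= X).
  { intros a b s Ha Hb Hs. unfold X. apply Rle_trans with (1 := Rabs_triang _ _).
    rewrite Rabs_mult. assert (Rabs (b - s) <= 2 * T).
    { unfold Rminus. apply Rle_trans with (1 := Rabs_triang _ _). rewrite Rabs_Ropp. lra. }
    nra. }
  assert (I2 : Rabs (RInt (fun s => h (u + e * (v - s)) s - h (x + e * (t - s)) s) 0 v) <= Rabs (v - 0) * (eps / (4 * T))).
  { apply abs_RInt_le_gen.
    { intros s. apply (continuous_minus (fun s => h (u + e * (v - s)) s) (fun s => h (x + e * (t - s)) s)); auto. }
    intros s Hs0.
    assert (Hs : Rabs s <= T).
    { apply Rabs_le_between in Hv1. apply Rabs_le_between.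
      revert Hs0. unfold Rmin, Rmax. destruct (Rle_dec 0 v); lra. }
    apply Rlt_le. apply Hd.
    - apply Rabs_le_between. apply B; auto. lra.
    - now apply Rabs_le_between.
    - apply Rabs_le_between. apply B; auto.
    - now apply Rabs_le_between.
    - replace (u + e * (v - s) - (x + e * (t - s))) with ((u - x) + e * (v - t)) by ring.
      apply Rle_lt_trans with (1 := Rabs_triang _ _). rewrite Rabs_mult.
      apply Rle_lt_trans with ((d / (2 * (1 + Rabs e))) * (1 + Rabs e)).
      + assert (Rabs (u - x) < d / (2 * (1 + Rabs e))) by lra.
        assert (Rabs (v - t) < d / (2 * (1 + Rabs e))) by lra.
        nra.
      + generalize (cond_pos d). intros. replace (d / (2 * (1 + Rabs e)) * (1 + Rabs e)) with (d / 2) by (field; lra). lra.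
    - rewrite Rminus_diag. rewrite Rabs_R0. apply cond_pos. }
  rewrite RInt_minus_cont in I2 by auto.
  rewrite Rminus_0_r in I2.
  match goal with |- Rabs (?a - ?b) < _ =>
    match type of I2 with Rabs (_ - ?c) <= _ => replace (a - b) with ((a - c) + (c - b)) by ring end end.
  apply Rle_lt_trans with (1 := Rabs_triang _ _).
  assert (Rabs v * (eps / (4 * T)) <= eps / 4).
  { apply Rle_trans with (T * (eps / (4 * T))). apply Rmult_le_compat_r; auto.
    apply Rlt_le, Rdiv_lt_0_compat; lra. right. field. lra. }
  apply Rlt_trans with (eps / 4 + eps / 4); [|lra].
  apply Rplus_le_lt_compat; [apply Rle_trans with (1 := I2); auto | exact Hd'].
Qed.

Lemma is_derive_charop (e : R) (f df : R -> R) (h hx : R -> R -> R) (x t : R) :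
  (forall x, is_derive f x (df x)) -> cont2 h -> cont2 hx ->
  (forall x t, is_derive (fun x => h x t) x (hx x t)) ->
  is_derive (fun x => charop e f h x t) x (charop e df hx x t).
Proof.
  intros Hf Hh Hhx Hd. unfold charop.
  apply (is_derive_plus (fun x => f (x + e * t)) (fun x => RInt (fun s => h (x + e * (t - s)) s) 0 t)).
  { replace (df (x + e * t)) with (scal 1 (df (x + e * t))) by (unfold scal; simpl; unfold mult; simpl; ring).
    apply (is_derive_comp f (fun x => x + e * t)); auto. auto_derive; auto. }
  assert (D : forall y s, is_derive (fun x => h (x + e * (t - s)) s) y (hx (y + e * (t - s)) s)).
  { intros y s.
    replace (hx (y + e * (t - s)) s) with (scal 1 (hx (y + e * (t - s)) s)) by (unfold scal; simpl; unfold mult; simpl; ring).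
    apply (is_derive_comp (fun x => h x s) (fun x => x + e * (t - s))); auto. auto_derive; auto. }
  rewrite (RInt_ext _ (fun s => Derive (fun x => h (x + e * (t - s)) s) x)).
  2:{ intros s _. symmetry. apply is_derive_unique, D. }
  apply (is_derive_RInt_param (fun x s => h (x + e * (t - s)) s)).
  - apply filter_forall. intros y s _. eexists; apply D.
  - intros s _. apply continuity_2d_pt_ext with (fun u v => hx (u + e * (t - v)) v).
    { intros u v. symmetry. apply is_derive_unique, D. }
    apply cont2_pt. apply (cont2_comp hx (fun u v => u + e * (t - v)) (fun _ v => v)); auto.
    + intros z. apply (continuous_plus (fun z : R * R => fst z) (fun z : R * R => e * (t - snd z))).
      apply continuous_fst.
      apply (continuous_mult (fun _ : R * R => e) (fun z : R * R => t - snd z)). apply continuous_const.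
      apply (continuous_minus (fun _ : R * R => t) (fun z : R * R => snd z)). apply continuous_const. apply continuous_snd.
    + intros z. apply continuous_snd.
  - apply filter_forall. intros y. apply ex_RInt_cont. intros s. now apply cont2_char.
Qed.

(** Along its own characteristic the foot is fixed and only the upper limit of the integral moves,
    so [f] and [h] need no derivative. Applied to the x-derivative of the solution, this avoids
    second derivatives. *)
Lemma is_derive_charop_char (e : R) f h (z s : R) :
  cont2 h ->
  is_derive (fun s => charop e f h (z - e * s) s) s (h (z - e * s) s).
Proof.
  intros Hh. unfold charop.
  apply (is_derive_ext (fun s => f z + RInt (fun r => h (z - e * r) r) 0 s)).
  { intros u. simpl. apply f_equal2. f_equal; ring.
    apply RInt_ext. intros r _. f_equal. ring. }
  replace (h (z - e * s) s) with (0 + h (z - e * s) s) by ring.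
  apply (is_derive_plus (fun _ => f z) (fun s => RInt (fun r => h (z - e * r) r) 0 s)).
  apply is_derive_cst.
  apply (is_derive_prim (fun r => h (z - e * r) r)).
  intros r. apply (continuous_ext_fun (fun r => h (z + (-e) * r) (0 + 1 * r))).
  intros y. f_equal; ring. now apply cont2_line.
Qed.

(** Joint differentiability, needed for slanted lines: the mean value theorem handles the increment
    in z at a fixed upper limit, the fundamental theorem of calculus the one in t at fixed z. *)
Lemma differentiable_prim (k kz : R -> R -> R) (z t : R) :
  cont2 k -> cont2 kz -> (forall z s, is_derive (fun z => k z s) z (kz z s)) ->
  differentiable_pt_lim (fun z t => RInt (k z) 0 t) z t (RInt (kz z) 0 t) (k z t).
Proof.
  intros Hk Hkz D.
  assert (C1 : forall h z s, cont2 h -> continuous (h z) s).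
  { intros h y s Hh. apply (continuous_ext_fun (fun s => h (y + 0 * s) (0 + 1 * s))).
    intros u. f_equal; ring. now apply cont2_line. }
  assert (CC := cont2_charop 0 (fun _ => 0) kz (fun x => continuous_const 0 x) Hkz).
  assert (E : forall y u, charop 0 (fun _ => 0) kz y u = RInt (kz y) 0 u).
  { intros y u. unfold charop. rewrite Rplus_0_l. apply RInt_ext. intros s _. f_equal. ring. }
  assert (DD : forall y u, is_derive (fun z => RInt (k z) 0 u) y (RInt (kz y) 0 u)).
  { intros y u. rewrite <- E.
    apply (is_derive_ext (fun y => charop 0 (fun _ => 0) k y u)).
    - intros x. unfold charop. rewrite Rplus_0_l. apply RInt_ext. intros s _. f_equal. ring.
    - apply is_derive_charop; auto. intros x. apply is_derive_cst. }
  intros eps.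
  assert (E0 := cond_pos eps).
  destruct (cont2_pt _ z t CC (mkposreal (eps / 2) ltac:(lra))) as [d1 Hd1].
  assert (Dt := is_derive_prim (k z) 0 t (fun s => C1 k z s Hk)).
  apply is_derive_Reals in Dt.
  destruct (Dt (eps / 2) ltac:(lra)) as [d2 Hd2].
  exists (mkposreal (Rmin d1 d2) (Rmin_pos _ _ (cond_pos d1) (cond_pos d2))).
  simpl. intros u v Hu Hv.
  assert (m1 := Rmin_l d1 d2). assert (m2 := Rmin_r d1 d2).
  destruct (MVT_gen (fun y => RInt (k y) 0 v) z u (fun y => RInt (kz y) 0 v)) as [c [Hc Ec]].
  { intros y _. apply DD. }
  { intros y _. apply derivable_continuous_pt. eexists. apply is_derive_Reals, DD. }
  assert (Hcz : Rabs (c - z) <= Rabs (u - z)).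
  { revert Hc. unfold Rmin, Rmax. destruct (Rle_dec z u); intros Hc.
    rewrite !Rabs_pos_eq; lra. rewrite !Rabs_left1; lra. }
  assert (B1 : Rabs (RInt (k u) 0 v - RInt (k z) 0 v - RInt (kz z) 0 t * (u - z)) <= eps / 2 * Rabs (u - z)).
  { rewrite Ec. replace (_ - _) with ((RInt (kz c) 0 v - RInt (kz z) 0 t) * (u - z)) by Rring.
    rewrite Rabs_mult. apply Rmult_le_compat_r. apply Rabs_pos.
    apply Rlt_le. rewrite <- !E. apply Hd1; lra. }
  assert (B2 : Rabs (RInt (k z) 0 v - RInt (k z) 0 t - k z t * (v - t)) <= eps / 2 * Rabs (v - t)).
  { destruct (Req_dec v t) as [->|Hne].
    - replace (_ - _) with 0 by Rring. rewrite Rminus_diag, Rabs_R0. lra.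
    - assert (H0 : v - t <> 0) by lra.
      specialize (Hd2 (v - t) H0 ltac:(lra)).
      replace (t + (v - t)) with v in Hd2 by ring.
      replace (_ - _) with (((RInt (k z) 0 v - RInt (k z) 0 t) / (v - t) - k z t) * (v - t)).
      2:{ match goal with |- @eq _ ?a ?b => change (@eq R a b) end. field; auto. }
      rewrite Rabs_mult. apply Rmult_le_compat_r. apply Rabs_pos. lra. }
  assert (m3 := Rmax_l (Rabs (u - z)) (Rabs (v - t))).
  assert (m4 := Rmax_r (Rabs (u - z)) (Rabs (v - t))).
  replace (_ - _) with ((RInt (k u) 0 v - RInt (k z) 0 v - RInt (kz z) 0 t * (u - z)) + (RInt (k z) 0 v - RInt (k z) 0 t - k z t * (v - t))) by Rring.
  apply Rle_trans with (1 := Rabs_triang _ _). nra.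
Qed.

Lemma is_derive_charop_line (e : R) (f df : R -> R) (h hx : R -> R -> R) (x t d1 d2 s : R) :
  (forall x, is_derive f x (df x)) -> cont2 h -> cont2 hx ->
  (forall x t, is_derive (fun x => h x t) x (hx x t)) ->
  is_derive (fun s => charop e f h (x + d1 * s) (t + d2 * s)) s
    ((d1 + e * d2) * charop e df hx (x + d1 * s) (t + d2 * s) + d2 * h (x + d1 * s) (t + d2 * s)).
Proof.
  intros Hf Hh Hhx Hd.
  (* In the coordinates (x + e t, t) the characteristics are vertical and the operator becomes a
     primitive in t, to which [differentiable_prim] applies. *)
  set (k := fun z r => h (z - e * r) r). set (kz := fun z r => hx (z - e * r) r).
  assert (Cl : cont2 (fun z r => z - e * r)).
  { intros z. apply (continuous_minus (fun z : R * R => fst z) (fun z : R * R => e * snd z)).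
    apply continuous_fst. apply (continuous_mult (fun _ : R * R => e) (fun z : R * R => snd z)).
    apply continuous_const. apply continuous_snd. }
  assert (Cs : cont2 (fun z r => r)) by (intros z; apply continuous_snd).
  assert (Dk := differentiable_prim k kz (x + e * t + (d1 + e * d2) * s) (t + d2 * s)
     (cont2_comp h _ _ Hh Cl Cs) (cont2_comp hx _ _ Hhx Cl Cs)).
  assert (A1 : forall a b r, derivable_pt_lim (fun r => a + b * r) r b).
  { intros a b r. apply is_derive_Reals. auto_derive; auto. ring. }
  assert (D1 := derivable_pt_lim_comp_2d (fun z t => RInt (k z) 0 t) (fun s => x + e * t + (d1 + e * d2) * s) (fun s => t + d2 * s) s
     _ _ _ _ (Dk ltac:(intros z r; unfold k, kz;
        replace (hx (z - e * r) r) with (scal 1 (hx (z - e * r) r)) by (unfold scal; simpl; unfold mult; simpl; ring);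
        apply (is_derive_comp (fun x => h x r) (fun x => x - e * r)); auto; auto_derive; auto)) (A1 _ _ _) (A1 _ _ _)).
  apply is_derive_Reals in D1.
  assert (D2 : is_derive (fun s => f (x + e * t + (d1 + e * d2) * s)) s ((d1 + e * d2) * df (x + e * t + (d1 + e * d2) * s))).
  { apply (is_derive_comp f (fun s => x + e * t + (d1 + e * d2) * s)); auto. apply is_derive_Reals, A1. }
  assert (D3 := is_derive_plus _ _ _ _ _ D2 D1).
  assert (Eq : forall (ff : R -> R) (hh : R -> R -> R) r, charop e ff hh (x + d1 * r) (t + d2 * r) =
     ff (x + e * t + (d1 + e * d2) * r) + RInt (fun q => hh (x + e * t + (d1 + e * d2) * r - e * q) q) 0 (t + d2 * r)).
  { intros ff hh r. unfold charop. apply f_equal2. f_equal; ring. apply RInt_ext. intros q _. f_equal. ring. }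
  apply (is_derive_ext (fun s => f (x + e * t + (d1 + e * d2) * s) + RInt (k (x + e * t + (d1 + e * d2) * s)) 0 (t + d2 * s))).
  { intros r. symmetry. apply Eq. }
  rewrite Eq.
  replace (h (x + d1 * s) (t + d2 * s)) with (k (x + e * t + (d1 + e * d2) * s) (t + d2 * s)) by (unfold k; f_equal; ring).
  refine (eq_rect _ (fun l => is_derive _ s l) D3 _ _).
  unfold plus, kz; simpl. Rring.
Qed.

(** * Picard iteration *)

Lemma half_pow_pos (n : nat) : 0 < (/ 2) ^ n.
Proof. apply pow_lt; lra. Qed.

Lemma half_pow_small (C eps : R) : 0 < eps -> exists n0, forall n, (n0 <= n)%nat -> C * (/ 2) ^ n < eps.
Proof.
  intros He.
  destruct (pow_lt_1_zero (/ 2) ltac:(rewrite Rabs_pos_eq; lra) (eps / (Rabs C + 1))) as [n0 Hn].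
  { apply Rdiv_lt_0_compat; auto. generalize (Rabs_pos C); lra. }
  exists n0. intros n H. specialize (Hn n H). rewrite Rabs_pos_eq in Hn by (apply Rlt_le, half_pow_pos).
  assert (0 <= Rabs C) by apply Rabs_pos. assert (C <= Rabs C) by apply RRle_abs.
  assert (E : (Rabs C + 1) * (eps / (Rabs C + 1)) = eps) by (field; lra).
  generalize (half_pow_pos n). intros. nra.
Qed.

Lemma geom_cauchy_lim (u : nat -> R) (C : R) :
  (forall n, Rabs (u (S n) - u n) <= C * (/ 2) ^ n) ->
  exists l : R, is_lim_seq u l /\ forall n, Rabs (l - u n) <= 2 * C * (/ 2) ^ n.
Proof.
  intros H.
  assert (HC : 0 <= C) by (generalize (H 0%nat) (Rabs_pos (u 1%nat - u 0%nat)); simpl; lra).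
  assert (T : forall k n, Rabs (u (n + k)%nat - u n) <= 2 * C * (/ 2) ^ n * (1 - (/ 2) ^ k)).
  { induction k as [|k IH]; intros n.
    - rewrite Nat.add_0_r, Rminus_diag, Rabs_R0. simpl. lra.
    - rewrite Nat.add_succ_r.
      replace (u (S (n + k)) - u n) with ((u (S (n + k)) - u (n + k)%nat) + (u (n + k)%nat - u n)) by ring.
      apply Rle_trans with (1 := Rabs_triang _ _). specialize (IH n). specialize (H (n + k)%nat).
      rewrite pow_add in H. simpl. lra. }
  assert (Cv : ex_finite_lim_seq u).
  { apply ex_lim_seq_cauchy_corr. intros eps.
    destruct (half_pow_small (4 * C) eps (cond_pos eps)) as [n0 Hn0].
    exists n0. intros n m Hn Hm.
    assert (Q : forall n, (n0 <= n)%nat -> Rabs (u n - u n0) <= 2 * C * (/ 2) ^ n0).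
    { intros k Hk. replace k with (n0 + (k - n0))%nat by lia.
      apply Rle_trans with (1 := T _ _).
      generalize (half_pow_pos n0) (half_pow_pos (k - n0)). intros.
      rewrite <- (Rmult_1_r (2 * C * (/ 2) ^ n0)) at 2. apply Rmult_le_compat_l; [|lra].
      apply Rmult_le_pos; lra. }
    replace (u n - u m) with ((u n - u n0) + - (u m - u n0)) by ring.
    apply Rle_lt_trans with (1 := Rabs_triang _ _). rewrite Rabs_Ropp.
    generalize (Q n Hn) (Q m Hm) (Hn0 n0 (le_n _)). lra. }
  destruct Cv as [l Hl]. exists l. split; auto.
  intros n.
  assert (L1 : is_lim_seq (fun k => Rabs (u (k + n)%nat - u n)) (Rabs (l - u n))).
  { apply (is_lim_seq_abs (fun k => u (k + n)%nat - u n) (l - u n)).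
    apply is_lim_seq_minus'. apply is_lim_seq_incr_n; auto. apply is_lim_seq_const. }
  refine (is_lim_seq_le _ (fun _ => 2 * C * (/ 2) ^ n) (Rabs (l - u n)) (2 * C * (/ 2) ^ n) _ L1 (is_lim_seq_const _)).
  intros k. apply Rle_trans with (2 * C * (/ 2) ^ n * (1 - (/ 2) ^ k)). rewrite Nat.add_comm. apply T.
  generalize (half_pow_pos n) (half_pow_pos k). intros.
  rewrite <- (Rmult_1_r (2 * C * (/ 2) ^ n)) at 2. apply Rmult_le_compat_l; [|lra].
  apply Rmult_le_pos; lra.
Qed.

Lemma cont2_limit (h : nat -> R -> R -> R) (H : R -> R -> R) (C L : R) :
  0 <= L ->
  (forall n, cont2 (h n)) ->
  (forall n x t, Rabs (H x t - h n x t) <= C * exp (L * Rabs t) * (/ 2) ^ n) -> cont2 H.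
Proof.
  intros HL Hh HH. apply cont2_of_pt. intros x t eps.
  assert (E0 := cond_pos eps).
  destruct (half_pow_small (C * exp (L * (Rabs t + 1))) (eps / 3) ltac:(lra)) as [n Hn].
  specialize (Hn n (le_n _)).
  destruct (cont2_pt _ x t (Hh n) (mkposreal (eps / 3) ltac:(lra))) as [d Hd].
  exists (mkposreal (Rmin 1 d) (Rmin_pos _ _ Rlt_0_1 (cond_pos d))). simpl. intros u v Hu Hv.
  assert (m1 := Rmin_l 1 d). assert (m2 := Rmin_r 1 d).
  assert (HC : 0 <= C).
  { generalize (HH n 0 0) (Rabs_pos (H 0 0 - h n 0 0)) (half_pow_pos n) (exp_pos (L * Rabs 0)). intros.
    assert (0 < exp (L * Rabs 0) * (/ 2) ^ n) by (apply Rmult_lt_0_compat; auto). nra. }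
  assert (Q : forall y s, Rabs s <= Rabs t + 1 -> Rabs (H y s - h n y s) < eps / 3).
  { intros y s Hs. apply Rle_lt_trans with (1 := HH n y s). apply Rle_lt_trans with (2 := Hn).
    apply Rmult_le_compat_r. apply Rlt_le, half_pow_pos. apply Rmult_le_compat_l; auto.
    destruct (Req_dec (L * Rabs s) (L * (Rabs t + 1))) as [->|]; [lra|].
    apply Rlt_le, exp_increasing. assert (L * Rabs s <= L * (Rabs t + 1)) by (apply Rmult_le_compat_l; auto). lra. }
  assert (Q1 := Q u v ltac:(replace v with (t + (v - t)) by ring; apply Rle_trans with (1 := Rabs_triang _ _); lra)).
  assert (Q2 := Q x t ltac:(lra)).
  specialize (Hd u v ltac:(simpl; lra) ltac:(simpl; lra)). simpl in Hd.
  rewrite Rabs_minus_sym in Q2.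
  replace (H u v - H x t) with ((H u v - h n u v) + ((h n u v - h n x t) + (h n x t - H x t))) by ring.
  apply Rle_lt_trans with (1 := Rabs_triang _ _).
  generalize (Rabs_triang (h n u v - h n x t) (h n x t - H x t)). lra.
Qed.

Lemma exp_mult_ge1 (L t : R) : 0 <= L -> 1 <= exp (L * Rabs t).
Proof.
  intros HL. generalize (exp_ineq1_le (L * Rabs t)) (Rmult_le_pos _ _ HL (Rabs_pos t)). lra.
Qed.

Lemma cont2_plus (h k : R -> R -> R) : cont2 h -> cont2 k -> cont2 (fun x t => h x t + k x t).
Proof.
  intros Hh Hk z. apply (continuous_plus (fun z : R * R => h (fst z) (snd z)) (fun z => k (fst z) (snd z))); auto.
Qed.
Lemma cont2_mult (h k : R -> R -> R) : cont2 h -> cont2 k -> cont2 (fun x t => h x t * k x t).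
Proof.
  intros Hh Hk z. apply (continuous_mult (fun z : R * R => h (fst z) (snd z)) (fun z => k (fst z) (snd z))); auto.
Qed.
Lemma cont2_snd : cont2 (fun _ t => t).
Proof. intros z. apply continuous_snd. Qed.
Lemma cont2_const (c : R) : cont2 (fun _ _ => c).
Proof. intros z. apply continuous_const. Qed.

Section Picard.

(* The boolean index is [true] for [phi] and [false] for [psi]. *)
Variables (N dN : R -> R -> R) (K K2 N0 : R) (f df : bool -> R -> R) (c : bool -> R) (Bd : R).
Hypothesis HK : 0 < K.
Hypothesis HK2 : 0 <= K2.
Hypothesis HBd : 0 <= Bd.
Hypothesis HN : cont2 N.
Hypothesis HdN : cont2 dN.
Hypothesis dN_ok : forall u s, is_derive (fun u => N u s) u (dN u s).
Hypothesis dN_bound : forall u s, Rabs (dN u s) <= K.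
Hypothesis dN_lip : forall u v s, Rabs (dN u s - dN v s) <= K2 * Rabs (u - v).
Hypothesis N_start : forall s, Rabs (N (c true + c false) s) <= N0.
Hypothesis f_ok : forall b x, is_derive (f b) x (df b x).
Hypothesis df_cont : forall b x, continuous (df b) x.
Hypothesis f_bound : forall b x, Rabs (f b x) <= Bd.
Hypothesis df_bound : forall b x, Rabs (df b x) <= Bd.

Definition sgn (b : bool) : R := if b then 1 else -1.

Definition src (A B : R -> R -> R) : R -> R -> R := fun x t => N (A x t + B x t) t.
Definition dsrc (A B P Q : R -> R -> R) : R -> R -> R :=
  fun x t => dN (A x t + B x t) t * (P x t + Q x t).

Fixpoint pic (n : nat) : bool -> R -> R -> R :=
  match n with
  | O => fun b _ _ => c b
  | S m => fun b => charop (sgn b) (f b) (src (pic m true) (pic m false))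
  end.

Fixpoint picd (n : nat) : bool -> R -> R -> R :=
  match n with
  | O => fun _ _ _ => 0
  | S m => fun b => charop (sgn b) (df b) (dsrc (pic m true) (pic m false) (picd m true) (picd m false))
  end.

Lemma f_cont b x : continuous (f b) x.
Proof. apply (ex_derive_continuous (f b)). eexists; apply f_ok. Qed.

Lemma cont2_src A B : cont2 A -> cont2 B -> cont2 (src A B).
Proof. intros HA HB. apply (cont2_comp N (fun x t => A x t + B x t) (fun _ t => t)); auto using cont2_plus, cont2_snd. Qed.
Lemma cont2_dsrc A B P Q : cont2 A -> cont2 B -> cont2 P -> cont2 Q -> cont2 (dsrc A B P Q).
Proof.
  intros HA HB HP HQ. apply cont2_mult; auto using cont2_plus.
  apply (cont2_comp dN (fun x t => A x t + B x t) (fun _ t => t)); auto using cont2_plus, cont2_snd.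
Qed.

Lemma src_derive A B P Q :
  (forall x t, is_derive (fun x => A x t) x (P x t)) ->
  (forall x t, is_derive (fun x => B x t) x (Q x t)) ->
  forall x t, is_derive (fun x => src A B x t) x (dsrc A B P Q x t).
Proof.
  intros HA HB x t. unfold src, dsrc. rewrite Rmult_comm.
  apply (is_derive_comp (fun u => N u t) (fun x => A x t + B x t)); auto.
  apply (is_derive_plus (fun x => A x t) (fun x => B x t)); auto.
Qed.

Lemma N_lip u v s : Rabs (N u s - N v s) <= K * Rabs (u - v).
Proof.
  destruct (MVT_gen (fun u => N u s) v u (fun u => dN u s)) as [r [_ E]].
  - intros; auto.
  - intros x _. apply derivable_continuous_pt. eexists. apply is_derive_Reals, dN_ok.
  - rewrite E, Rabs_mult. apply Rmult_le_compat_r; auto. apply Rabs_pos.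
Qed.

Lemma src_diff A B A' B' y s a :
  Rabs (A' y s - A y s) <= a -> Rabs (B' y s - B y s) <= a ->
  Rabs (src A' B' y s - src A B y s) <= 2 * K * a.
Proof.
  intros H1 H2. unfold src. apply Rle_trans with (1 := N_lip _ _ _).
  replace (_ + _ - _) with ((A' y s - A y s) + (B' y s - B y s)) by ring.
  replace (2 * K * a) with (K * (a + a)) by ring. apply Rmult_le_compat_l; [lra|].
  apply Rle_trans with (1 := Rabs_triang _ _). lra.
Qed.

Lemma dsrc_diff A B P Q A' B' P' Q' y s a e m :
  Rabs (A' y s - A y s) <= a -> Rabs (B' y s - B y s) <= a ->
  Rabs (P' y s - P y s) <= e -> Rabs (Q' y s - Q y s) <= e ->
  Rabs (P' y s) <= m -> Rabs (Q' y s) <= m ->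
  Rabs (dsrc A' B' P' Q' y s - dsrc A B P Q y s) <= 2 * K * e + 4 * K2 * a * m.
Proof.
  intros H1 H2 H3 H4 H5 H6. unfold dsrc.
  replace (_ - _) with (dN (A y s + B y s) s * ((P' y s - P y s) + (Q' y s - Q y s))
     + (dN (A' y s + B' y s) s - dN (A y s + B y s) s) * (P' y s + Q' y s)) by ring.
  apply Rle_trans with (1 := Rabs_triang _ _). rewrite !Rabs_mult.
  apply Rplus_le_compat.
  - replace (2 * K * e) with (K * (e + e)) by ring. apply Rmult_le_compat; auto using Rabs_pos.
    apply Rle_trans with (1 := Rabs_triang _ _). lra.
  - replace (4 * K2 * a * m) with ((K2 * (a + a)) * (m + m)) by ring. apply Rmult_le_compat; auto using Rabs_pos.
    + apply Rle_trans with (1 := dN_lip _ _ _). apply Rmult_le_compat_l; auto.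
      replace (_ + _ - _) with ((A' y s - A y s) + (B' y s - B y s)) by ring.
      apply Rle_trans with (1 := Rabs_triang _ _). lra.
    + apply Rle_trans with (1 := Rabs_triang _ _). lra.
Qed.

Lemma pic_cont n b : cont2 (pic n b).
Proof.
  revert b; induction n as [|n IH]; intros b; simpl. apply cont2_const.
  apply cont2_charop; auto using f_cont, cont2_src.
Qed.

Lemma picd_cont n b : cont2 (picd n b).
Proof.
  revert b; induction n as [|n IH]; intros b; simpl. apply cont2_const.
  apply cont2_charop; auto. apply cont2_dsrc; auto; apply pic_cont.
Qed.

Lemma src_pic_cont n : cont2 (src (pic n true) (pic n false)).
Proof. apply cont2_src; apply pic_cont. Qed.

Lemma dsrc_pic_cont n : cont2 (dsrc (pic n true) (pic n false) (picd n true) (picd n false)).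
Proof. apply cont2_dsrc; [apply pic_cont | apply pic_cont | apply picd_cont | apply picd_cont]. Qed.

Lemma pic_derive n : forall b x t, is_derive (fun x => pic n b x t) x (picd n b x t).
Proof.
  induction n as [|n IH]; intros b x t; simpl. apply is_derive_cst.
  apply is_derive_charop; [auto | apply src_pic_cont | apply dsrc_pic_cont |].
  apply src_derive; apply IH.
Qed.

(** Constants that close the inductions. A source difference carries 2 K, and division by L = 4 K
    leaves 1/2. [C] bounds the first step; [D] solves D = Bd + D / 2; [E] exceeds both Bd and 8 K2 C
    D / L, so that E / 4 + 2 K2 C D / L <= E / 2. *)
Let L := 4 * K.
Let C := Bd + Rabs (c true) + Rabs (c false) + N0 / L.
Let D := 2 * Bd.
Let E := Bd + 8 * K2 * C * D / L.

Lemma picard_constants : 0 < L /\ 0 <= N0 /\ 0 <= C /\ 0 <= D /\ Bd <= E /\ 0 <= E.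
Proof.
  assert (HL : 0 < L) by (unfold L; lra).
  assert (H0 : 0 <= N0) by (generalize (N_start 0) (Rabs_pos (N (c true + c false) 0)); lra).
  assert (HC : 0 <= C).
  { unfold C. assert (0 <= N0 / L) by (apply Rmult_le_pos; [|apply Rlt_le, Rinv_0_lt_compat]; auto).
    generalize (Rabs_pos (c true)) (Rabs_pos (c false)). lra. }
  assert (HD : 0 <= D) by (unfold D; lra).
  assert (0 <= 8 * K2 * C * D / L).
  { repeat apply Rmult_le_pos; auto; try lra. now apply Rlt_le, Rinv_0_lt_compat. }
  unfold E. repeat split; auto; lra.
Qed.

Lemma pic_step n : forall b x t, Rabs (pic (S n) b x t - pic n b x t) <= C * exp (L * Rabs t) * (/ 2) ^ n.
Proof.
  destruct picard_constants as (HL & H0 & HC & _).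
  induction n as [|n IH]; intros b x t.
  - change (pic 1 b) with (charop (sgn b) (f b) (fun x t => N (c true + c false) t)).
    simpl. rewrite Rmult_1_r. apply Rle_trans with (1 := Rabs_triang _ _). rewrite Rabs_Ropp.
    assert (B := charop_bound (sgn b) L N0 Bd (f b) (fun x t => N (c true + c false) t) x t HL H0
      (cont2_comp N (fun _ _ => c true + c false) (fun _ t => t) HN (cont2_const _) cont2_snd) (f_bound b)
      ltac:(intros y s; apply Rle_trans with (1 := N_start s);
        generalize (exp_mult_ge1 L s (Rlt_le _ _ HL)) H0; nra)).
    assert (X := exp_mult_ge1 L t (Rlt_le _ _ HL)).
    unfold C. generalize (Rabs_pos (c true)) (Rabs_pos (c false)). intros.
    assert (Rabs (c b) <= Rabs (c true) + Rabs (c false)) by (destruct b; lra). nra.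
  - replace (C * exp (L * Rabs t) * (/ 2) ^ S n) with (2 * K * C * (/ 2) ^ n / L * exp (L * Rabs t))
      by (unfold L at 1; simpl; field; lra).
    apply (charop_diff_bound (sgn b) L (2 * K * C * (/ 2) ^ n) (f b) _ _ x t HL); [|exact (src_pic_cont (S n)) | exact (src_pic_cont n) |].
    + generalize (half_pow_pos n). intros. repeat apply Rmult_le_pos; lra.
    + intros y s. replace (2 * K * C * (/ 2) ^ n * exp (L * Rabs s)) with (2 * K * (C * exp (L * Rabs s) * (/ 2) ^ n)) by ring.
      apply src_diff; apply IH.
Qed.

Lemma picd_bound n : forall b x t, Rabs (picd n b x t) <= D * exp (L * Rabs t).
Proof.
  destruct picard_constants as (HL & _ & _ & HD & _).
  induction n as [|n IH]; intros b x t.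
  - simpl. rewrite Rabs_R0. apply Rmult_le_pos; auto. apply Rlt_le, exp_pos.
  - assert (B := charop_bound (sgn b) L (2 * K * D) Bd (df b) _ x t HL ltac:(repeat apply Rmult_le_pos; lra)
      (cont2_dsrc _ _ _ _ (pic_cont n true) (pic_cont n false) (picd_cont n true) (picd_cont n false)) (df_bound b)).
    apply Rle_trans with (Bd + 2 * K * D / L * exp (L * Rabs t)).
    + apply B. intros y s. unfold dsrc. rewrite Rabs_mult.
      replace (2 * K * D * exp (L * Rabs s)) with (K * (D * exp (L * Rabs s) + D * exp (L * Rabs s))) by ring.
      apply Rmult_le_compat; auto using Rabs_pos.
      apply Rle_trans with (1 := Rabs_triang _ _). now apply Rplus_le_compat.
    + replace (2 * K * D / L) with (D / 2) by (unfold L; field; lra).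
      generalize (exp_mult_ge1 L t (Rlt_le _ _ HL)). unfold D. nra.
Qed.

Lemma exp_double l t : exp (l * Rabs t) * exp (l * Rabs t) = exp (2 * l * Rabs t).
Proof. rewrite <- exp_plus. f_equal. ring. Qed.

(** The variation of [dN] and the size of [picd] each grow like exp (L |t|); their product forces
    the doubled weight. *)
Lemma picd_step n : forall b x t, Rabs (picd (S n) b x t - picd n b x t) <= E * exp (2 * L * Rabs t) * (/ 2) ^ n.
Proof.
  destruct picard_constants as (HL & _ & HC & HD & HB & HE).
  assert (HL2 : 0 < 2 * L) by lra.
  induction n as [|n IH]; intros b x t.
  - rewrite Rminus_0_r, Rmult_1_r.
    assert (B := charop_bound (sgn b) (2 * L) 0 Bd (df b) _ x t HL2 (Rle_refl 0)
      (cont2_dsrc _ _ _ _ (pic_cont 0 true) (pic_cont 0 false) (picd_cont 0 true) (picd_cont 0 false)) (df_bound b)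
      ltac:(intros y s; unfold dsrc; simpl; rewrite Rplus_0_r, Rmult_0_r, Rabs_R0, Rmult_0_l; apply Rle_refl)).
    apply Rle_trans with (1 := B). unfold Rdiv. rewrite !Rmult_0_l, Rplus_0_r.
    generalize (exp_mult_ge1 (2 * L) t (Rlt_le _ _ HL2)). nra.
  - assert (Y := half_pow_pos n).
    apply Rle_trans with ((2 * K * E + 4 * K2 * C * D) * (/ 2) ^ n / (2 * L) * exp (2 * L * Rabs t)).
    + apply (charop_diff_bound (sgn b) (2 * L) ((2 * K * E + 4 * K2 * C * D) * (/ 2) ^ n) (df b) _ _ x t HL2); [|exact (dsrc_pic_cont (S n)) | exact (dsrc_pic_cont n) |].
      * apply Rmult_le_pos; [|lra]. apply Rplus_le_le_0_compat; repeat apply Rmult_le_pos; lra.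
      * intros y s. rewrite <- exp_double.
        replace (_ * _ * (exp (L * Rabs s) * _)) with (2 * K * (E * (exp (L * Rabs s) * exp (L * Rabs s)) * (/ 2) ^ n)
          + 4 * K2 * (C * exp (L * Rabs s) * (/ 2) ^ n) * (D * exp (L * Rabs s))) by ring.
        apply dsrc_diff; try apply pic_step; try apply (picd_bound (S n)); rewrite exp_double; apply IH.
    + simpl. assert (X := exp_pos (2 * L * Rabs t)).
      replace (_ / _ * _) with ((E / 4 + 2 * K2 * C * D / L) * (exp (2 * L * Rabs t) * (/ 2) ^ n)).
      2:{ unfold L at 1 3. field. lra. }
      replace (E * exp (2 * L * Rabs t) * (/ 2 * (/ 2) ^ n)) with ((E / 2) * (exp (2 * L * Rabs t) * (/ 2) ^ n)) by field.
      apply Rmult_le_compat_r. apply Rlt_le, Rmult_lt_0_compat; auto.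
      assert (8 * K2 * C * D / L <= E) by (unfold E; lra).
      replace (8 * K2 * C * D / L) with (4 * (2 * K2 * C * D / L)) in H by (field; lra). lra.
Qed.

Lemma limit_unique (u : nat -> R) (a b m : R) : is_lim_seq u a ->
  (forall n, Rabs (u (S n) - b) <= m * (/ 2) ^ n) -> a = b.
Proof.
  intros Ha Hb. apply is_lim_seq_incr_1 in Ha.
  assert (H2 : is_lim_seq (fun n => u (S n)) b).
  { apply is_lim_seq_Reals. intros eps He. destruct (half_pow_small m eps He) as [n0 Hn0].
    exists n0. intros n Hn. unfold Rdist. apply Rle_lt_trans with (1 := Hb n). apply Hn0. lia. }
  apply is_lim_seq_unique in Ha. apply is_lim_seq_unique in H2. rewrite Ha in H2. now injection H2.
Qed.

Lemma picard : exists A P : bool -> R -> R -> R,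
  (forall b, cont2 (A b)) /\ (forall b, cont2 (P b)) /\
  (forall b x t, A b x t = charop (sgn b) (f b) (src (A true) (A false)) x t) /\
  (forall b x t, P b x t = charop (sgn b) (df b) (dsrc (A true) (A false) (P true) (P false)) x t) /\
  (forall b x t, is_derive (fun x => A b x t) x (P b x t)) /\
  (forall b x t, is_lim_seq (fun n => pic n b x t) (A b x t)).
Proof.
  destruct picard_constants as (HL & _ & HC & HD & HB & HE).
  assert (LL : forall (h : nat -> bool -> R -> R -> R) a l,
     (forall n b x t, Rabs (h (S n) b x t - h n b x t) <= a * exp (l * Rabs t) * (/ 2) ^ n) ->
     exists H : bool -> R -> R -> R, forall b x t, is_lim_seq (fun n => h n b x t) (H b x t) /\
       forall n, Rabs (H b x t - h n b x t) <= 2 * a * exp (l * Rabs t) * (/ 2) ^ n).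
  { intros h a l Hh. exists (fun b x t => real (Lim_seq (fun n => h n b x t))). intros b x t.
    destruct (geom_cauchy_lim (fun n => h n b x t) (a * exp (l * Rabs t)) (fun n => Hh n b x t)) as [v [Hv1 Hv2]].
    rewrite (is_lim_seq_unique _ _ Hv1). simpl. split; auto.
    intros n. replace (2 * a * exp (l * Rabs t)) with (2 * (a * exp (l * Rabs t))) by ring. auto. }
  destruct (LL pic C L pic_step) as [A LA]. destruct (LL picd E (2 * L) picd_step) as [P LP]. clear LL.
  assert (CA : forall b, cont2 (A b)).
  { intros b. apply (cont2_limit (fun n => pic n b) (A b) (2 * C) L); [lra | intros; apply pic_cont | intros; apply LA]. }
  assert (CP : forall b, cont2 (P b)).
  { intros b. apply (cont2_limit (fun n => picd n b) (P b) (2 * E) (2 * L)); [lra | intros; apply picd_cont | intros; apply LP]. }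
  assert (EA : forall n b x t, Rabs (pic n b x t - A b x t) <= 2 * C * exp (L * Rabs t) * (/ 2) ^ n)
    by (intros; rewrite Rabs_minus_sym; apply LA).
  assert (EP : forall n b x t, Rabs (picd n b x t - P b x t) <= 2 * E * exp (2 * L * Rabs t) * (/ 2) ^ n)
    by (intros; rewrite Rabs_minus_sym; apply LP).
  exists A, P. repeat match goal with |- _ /\ _ => split end; auto.
  - intros b x t. apply (limit_unique (fun n => pic n b x t) _ _ (4 * K * C / L * exp (L * Rabs t))). apply LA.
    intros n. assert (Y := half_pow_pos n).
    replace (4 * K * C / L * exp (L * Rabs t) * (/ 2) ^ n) with (4 * K * C * (/ 2) ^ n / L * exp (L * Rabs t)) by (field; lra).
    apply (charop_diff_bound (sgn b) L (4 * K * C * (/ 2) ^ n) (f b) _ _ x t HL); [repeat apply Rmult_le_pos; lra | exact (src_pic_cont n) | now apply cont2_src |].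
    intros y s. replace (4 * K * C * (/ 2) ^ n * exp (L * Rabs s)) with (2 * K * (2 * C * exp (L * Rabs s) * (/ 2) ^ n)) by ring.
    apply src_diff; apply EA.
  - assert (PB : forall n b x t, Rabs (picd n b x t) <= D * exp (L * Rabs t)) by (intros; apply picd_bound).
    set (m := 4 * K * E + 8 * K2 * C * D).
    assert (Hm : 0 <= m) by (unfold m; apply Rplus_le_le_0_compat; repeat apply Rmult_le_pos; lra).
    intros b x t. apply (limit_unique (fun n => picd n b x t) _ _ (m / (2 * L) * exp (2 * L * Rabs t))). apply LP.
    intros n. assert (Y := half_pow_pos n).
    replace (m / (2 * L) * exp (2 * L * Rabs t) * (/ 2) ^ n) with (m * (/ 2) ^ n / (2 * L) * exp (2 * L * Rabs t)) by (field; lra).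
    rewrite Rabs_minus_sym.
    apply (charop_diff_bound (sgn b) (2 * L) (m * (/ 2) ^ n) (df b) _ _ x t ltac:(lra)); [apply Rmult_le_pos; lra | now apply cont2_dsrc | exact (dsrc_pic_cont n) |].
    intros y s. rewrite Rabs_minus_sym, <- exp_double.
    replace (m * (/ 2) ^ n * _) with (2 * K * (2 * E * (exp (L * Rabs s) * exp (L * Rabs s)) * (/ 2) ^ n)
       + 4 * K2 * (2 * C * exp (L * Rabs s) * (/ 2) ^ n) * (D * exp (L * Rabs s))) by (unfold m; ring).
    rewrite exp_double. apply dsrc_diff; auto.
  (* At fixed t the weight is a constant, so the derivatives converge uniformly in x and the limit
     may be differentiated termwise. *)
  - intros b x t. apply is_derive_Reals.
    assert (Bx : Boule x (mkposreal 1 Rlt_0_1) x) by (unfold Boule; rewrite Rminus_diag, Rabs_R0; simpl; lra).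
    apply (derivable_pt_lim_CVU (fun n x => pic n b x t) (fun n x => picd n b x t) (fun x => A b x t) (fun x => P b x t) x x (mkposreal 1 Rlt_0_1) Bx).
    + intros y n _. exact (proj1 (is_derive_Reals _ _ _) (pic_derive n b y t)).
    + intros y _. exact (proj1 (is_lim_seq_Reals _ _) (proj1 (LA b y t))).
    + intros eps He. destruct (half_pow_small (2 * E * exp (2 * L * Rabs t)) eps He) as [n0 Hn0].
      exists n0. intros n y Hn _. apply Rle_lt_trans with (1 := proj2 (LP b y t) n). apply Hn0; lia.
    + intros y _. apply continuity_pt_filterlim. change (continuous (fun x => P b x t) y).
      apply (continuous_ext_fun (fun y => P b (0 + 1 * y) (t + 0 * y)) (fun x => P b x t)). intros u; f_equal; ring.
      now apply cont2_line.
  - intros b x t. apply LA.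
Qed.

End Picard.

(** * The truncated nonlinearity *)

Lemma Rpower_pos (x y : R) : 0 < Rpower x y.
Proof. apply exp_pos. Qed.

Lemma is_derive_Rpower (x a : R) : 0 < x -> is_derive (fun x => Rpower x a) x (a * Rpower x (a - 1)).
Proof. intros Hx. apply is_derive_Reals, derivable_pt_lim_power; auto. Qed.

Lemma Rpower_split (x a : R) : 0 < x -> Rpower x a = x * Rpower x (a - 1).
Proof.
  intros Hx. rewrite <- (Rpower_1 x) at 2 by auto. rewrite <- Rpower_plus. f_equal. ring.
Qed.

Lemma Rpower_lip (g M q a b : R) :
  0 < g -> 0 <= q -> g <= a <= M -> g <= b <= M ->
  Rabs (Rpower a q - Rpower b q) <= q * Rpower M q / g * Rabs (a - b).
Proof.
  intros Hg Hq Ha Hb.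
  assert (Hc : forall c, Rmin b a <= c <= Rmax b a -> g <= c <= M).
  { intros c. unfold Rmin, Rmax. destruct (Rle_dec b a); lra. }
  destruct (MVT_gen (fun x => Rpower x q) b a (fun x => q * Rpower x (q - 1))) as [c [H E]].
  - intros x Hx. apply is_derive_Rpower. specialize (Hc x ltac:(lra)). lra.
  - intros x Hx. apply derivable_continuous_pt. eexists. apply is_derive_Reals, is_derive_Rpower.
    specialize (Hc x Hx). lra.
  - rewrite E, Rabs_mult. apply Rmult_le_compat_r; [apply Rabs_pos|].
    specialize (Hc c H). assert (X := Rpower_pos c (q - 1)).
    rewrite Rabs_pos_eq by (apply Rmult_le_pos; lra).
    unfold Rdiv. rewrite Rmult_assoc. apply Rmult_le_compat_l; auto.
    apply Rmult_le_reg_l with g; auto.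
    replace (g * (Rpower M q * / g)) with (Rpower M q) by (field; lra).
    apply Rle_trans with (c * Rpower c (q - 1)). apply Rmult_le_compat_r; lra.
    rewrite <- Rpower_split by lra. apply Rle_Rpower_l; lra.
Qed.

Lemma lip_continuous (f : R -> R) (k x : R) :
  (forall y, Rabs (f y - f x) <= k * Rabs (y - x)) -> continuous f x.
Proof.
  intros H. apply continuity_pt_filterlim, continuity_pt_locally. intros eps.
  assert (E0 := cond_pos eps). assert (K0 := Rabs_pos k).
  exists (mkposreal (eps / (Rabs k + 1)) ltac:(apply Rdiv_lt_0_compat; lra)).
  intros y Hy. simpl in Hy. change (Rabs (y - x) < eps / (Rabs k + 1)) in Hy.
  apply Rle_lt_trans with (1 := H y). assert (K1 := RRle_abs k). assert (Z := Rabs_pos (y - x)).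
  assert (E : (Rabs k + 1) * (eps / (Rabs k + 1)) = eps) by (field; lra). nra.
Qed.

Section Truncation.

Variables (p mu g M : R).
Hypothesis Hp : 1 < p.
Hypothesis Hmu : 0 < mu.
Hypothesis Hg : 0 < g.
Hypothesis HM : g <= M.
Hypothesis Hgam : mu <= Rpower 2 (- p) * Rpower g (p - 1).

Definition clamp (u : R) : R := Rmax g (Rmin u M).

(* [u ^ p] on [g, M], continued affinely on both sides. *)
Definition tpow (u : R) : R := Rpower g p + RInt (fun v => p * Rpower (clamp v) (p - 1)) g u.

(** The absolute value keeps the damping factor away from its pole at time -1, so that the iteration
    runs on the whole plane; at times s >= 0 it changes nothing. *)
Definition tnl (u s : R) : R := Rpower 2 (- p) * tpow u - mu / 2 * (u / (1 + Rabs s)).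
Definition dtnl (u s : R) : R :=
  Rpower 2 (- p) * (p * Rpower (clamp u) (p - 1)) - mu / 2 / (1 + Rabs s).

Definition tnlK : R := Rpower 2 (- p) * (p * Rpower M (p - 1)).
Definition tnlK2 : R := Rpower 2 (- p) * (p * ((p - 1) * Rpower M (p - 1) / g)).

Lemma clamp_range u : g <= clamp u <= M.
Proof.
  unfold clamp. split. apply Rmax_l. apply Rmax_lub; auto. apply Rmin_r.
Qed.

Lemma clamp_id u : g <= u <= M -> clamp u = u.
Proof. intros H. unfold clamp. rewrite Rmin_left by lra. rewrite Rmax_right; lra. Qed.

Lemma clamp_lip u v : Rabs (clamp u - clamp v) <= Rabs (u - v).
Proof.
  unfold clamp, Rmax, Rmin, Rabs.
  repeat destruct Rle_dec; repeat destruct Rcase_abs; lra.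
Qed.

Lemma dpow_lip u v : Rabs (Rpower (clamp u) (p - 1) - Rpower (clamp v) (p - 1))
  <= (p - 1) * Rpower M (p - 1) / g * Rabs (u - v).
Proof.
  apply Rle_trans with ((p - 1) * Rpower M (p - 1) / g * Rabs (clamp u - clamp v)).
  - apply Rpower_lip; auto using clamp_range. lra.
  - apply Rmult_le_compat_l; [|apply clamp_lip].
    repeat apply Rmult_le_pos; try lra. apply Rlt_le, Rpower_pos. apply Rlt_le, Rinv_0_lt_compat; auto.
Qed.

Lemma dpow_cont u : continuous (fun v => p * Rpower (clamp v) (p - 1)) u.
Proof.
  apply (lip_continuous _ (p * ((p - 1) * Rpower M (p - 1) / g))). intros y.
  rewrite <- Rmult_minus_distr_l, Rabs_mult, Rmult_assoc, (Rabs_pos_eq p) by lra.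
  apply Rmult_le_compat_l; [lra|]. apply dpow_lip.
Qed.

Lemma tpow_derive u : is_derive tpow u (p * Rpower (clamp u) (p - 1)).
Proof.
  unfold tpow. rewrite <- (Rplus_0_l (p * _)).
  apply (is_derive_plus (fun _ => Rpower g p) (fun u => RInt (fun v => p * Rpower (clamp v) (p - 1)) g u)).
  apply is_derive_cst. apply (is_derive_prim (fun v => p * Rpower (clamp v) (p - 1))). apply dpow_cont.
Qed.

Lemma tpow_eq u : g <= u <= M -> tpow u = Rpower u p.
Proof.
  intros Hu. unfold tpow.
  assert (H : is_RInt (fun v => p * Rpower (clamp v) (p - 1)) g u (minus (Rpower u p) (Rpower g p))).
  { apply (is_RInt_ext (fun v => p * Rpower v (p - 1))).
    - intros v Hv. rewrite Rmin_left, Rmax_right in Hv by lra. rewrite clamp_id; auto. lra.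
    - apply (is_RInt_derive (fun v => Rpower v p)).
      + intros v Hv. rewrite Rmin_left, Rmax_right in Hv by lra. apply is_derive_Rpower. lra.
      + intros v Hv. rewrite Rmin_left, Rmax_right in Hv by lra.
        apply (ex_derive_continuous (fun v => p * Rpower v (p - 1))).
        eexists. apply (is_derive_scal (fun v => Rpower v (p - 1))). apply is_derive_Rpower. lra. }
  rewrite (is_RInt_unique _ _ _ _ H). unfold minus, plus, opp; simpl. ring.
Qed.

Lemma tpow_le u : g <= u -> tpow u <= Rpower u p.
Proof.
  intros Hu.
  destruct (MVT_gen (fun u => Rpower u p - tpow u) g u (fun u => p * Rpower u (p - 1) - p * Rpower (clamp u) (p - 1))) as [c [H E]].
  - intros x Hx. rewrite Rmin_left, Rmax_right in Hx by lra.
    apply (is_derive_minus (fun u => Rpower u p) tpow). apply is_derive_Rpower; lra. apply tpow_derive.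
  - intros x Hx. rewrite Rmin_left, Rmax_right in Hx by lra.
    apply derivable_continuous_pt. eexists. apply is_derive_Reals.
    apply (is_derive_minus (fun u => Rpower u p) tpow). apply is_derive_Rpower; lra. apply tpow_derive.
  - rewrite Rmin_left, Rmax_right in H by lra.
    rewrite (tpow_eq g) in E by lra. rewrite Rminus_diag, Rminus_0_r in E.
    assert (Rpower (clamp c) (p - 1) <= Rpower c (p - 1)).
    { apply Rle_Rpower_l. lra. split. generalize (clamp_range c); lra.
      unfold clamp. apply Rmax_lub; [lra|apply Rmin_l]. }
    assert (0 <= (p * Rpower c (p - 1) - p * Rpower (clamp c) (p - 1)) * (u - g)).
    { apply Rmult_le_pos; [nra|lra]. }
    lra.
Qed.

Lemma inv1_bounds s : 0 < / (1 + Rabs s) <= 1.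
Proof.
  assert (H := Rabs_pos s). split. apply Rinv_0_lt_compat; lra.
  apply Rle_trans with (/ 1); [|rewrite Rinv_1; lra]. apply Rinv_le_contravar; lra.
Qed.

Lemma inv1_cont s : continuous (fun s => / (1 + Rabs s)) s.
Proof.
  apply (continuous_comp (fun s => 1 + Rabs s) Rinv).
  - apply (continuous_plus (fun _ => 1) Rabs). apply continuous_const. apply continuous_Rabs.
  - apply continuous_Rinv. generalize (Rabs_pos s). lra.
Qed.

Lemma tnl_derive u s : is_derive (fun u => tnl u s) u (dtnl u s).
Proof.
  unfold tnl, dtnl.
  apply (is_derive_minus (fun u => Rpower 2 (- p) * tpow u) (fun u => mu / 2 * (u / (1 + Rabs s)))).
  - apply (is_derive_scal tpow). apply tpow_derive.
  - auto_derive; auto. field. generalize (Rabs_pos s). lra.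
Qed.

(** By [Hgam] the damping consumes at most half of [Rpower 2 (- p) * Rpower (clamp u) (p - 1)], and
    p > 1 leaves the other half. This positivity is behind all the monotonicity and comparison
    arguments. *)
Lemma dtnl_lower u s : Rpower 2 (- p) * Rpower (clamp u) (p - 1) / 2 <= dtnl u s.
Proof.
  unfold dtnl. assert (H := inv1_bounds s). unfold Rdiv.
  assert (X := Rpower_pos 2 (- p)).
  assert (Rpower g (p - 1) <= Rpower (clamp u) (p - 1)).
  { apply Rle_Rpower_l. lra. generalize (clamp_range u). lra. }
  assert (mu <= Rpower 2 (- p) * Rpower (clamp u) (p - 1)) by nra.
  nra.
Qed.

Lemma dtnl_pos u s : 0 <= dtnl u s.
Proof.
  apply Rle_trans with (2 := dtnl_lower u s).
  generalize (Rpower_pos 2 (- p)) (Rpower_pos (clamp u) (p - 1)). intros. unfold Rdiv.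
  apply Rmult_le_pos; [apply Rmult_le_pos|]; lra.
Qed.

Lemma dtnl_upper u s : dtnl u s <= Rpower 2 (- p) * (p * Rpower (clamp u) (p - 1)).
Proof.
  unfold dtnl. assert (H := inv1_bounds s). unfold Rdiv. nra.
Qed.

Lemma dtnl_bound u s : Rabs (dtnl u s) <= tnlK.
Proof.
  rewrite Rabs_pos_eq by apply dtnl_pos. apply Rle_trans with (1 := dtnl_upper u s).
  unfold tnlK. apply Rmult_le_compat_l. apply Rlt_le, Rpower_pos.
  apply Rmult_le_compat_l; [lra|]. apply Rle_Rpower_l. lra. generalize (clamp_range u). lra.
Qed.

Lemma dtnl_lip u v s : Rabs (dtnl u s - dtnl v s) <= tnlK2 * Rabs (u - v).
Proof.
  unfold dtnl, tnlK2.
  replace (_ - _ - _) with (Rpower 2 (- p) * (p * (Rpower (clamp u) (p - 1) - Rpower (clamp v) (p - 1)))) by ring.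
  rewrite !Rabs_mult, (Rabs_pos_eq p), (Rabs_pos_eq (Rpower 2 (- p))) by (try apply Rlt_le, Rpower_pos; lra).
  rewrite !Rmult_assoc. apply Rmult_le_compat_l. apply Rlt_le, Rpower_pos.
  apply Rmult_le_compat_l; [lra|]. apply dpow_lip.
Qed.

Lemma tnlK_pos : 0 < tnlK.
Proof. unfold tnlK. repeat apply Rmult_lt_0_compat; try apply Rpower_pos. lra. Qed.

Lemma tnlK2_pos : 0 <= tnlK2.
Proof.
  unfold tnlK2. repeat apply Rmult_le_pos; try (apply Rlt_le, Rpower_pos); try lra.
  apply Rlt_le, Rinv_0_lt_compat; auto.
Qed.

Lemma cont2_tnl : cont2 tnl.
Proof.
  intros z. unfold tnl.
  apply (continuous_minus (fun z : R * R => Rpower 2 (- p) * tpow (fst z)) (fun z : R * R => mu / 2 * (fst z / (1 + Rabs (snd z))))).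
  - apply (continuous_mult (fun _ : R * R => Rpower 2 (- p)) (fun z : R * R => tpow (fst z))). apply continuous_const.
    apply (continuous_comp (fun z : R * R => fst z) tpow). apply continuous_fst.
    apply (ex_derive_continuous tpow). eexists; apply tpow_derive.
  - apply (continuous_mult (fun _ : R * R => mu / 2) (fun z : R * R => fst z / (1 + Rabs (snd z)))). apply continuous_const.
    apply (continuous_mult (fun z : R * R => fst z) (fun z : R * R => / (1 + Rabs (snd z)))). apply continuous_fst.
    apply (continuous_comp (fun z : R * R => snd z) (fun s => / (1 + Rabs s))). apply continuous_snd. apply inv1_cont.
Qed.

Lemma cont2_dtnl : cont2 dtnl.
Proof.
  intros z. unfold dtnl.
  apply (continuous_minus (fun z : R * R => Rpower 2 (- p) * (p * Rpower (clamp (fst z)) (p - 1))) (fun z : R * R => mu / 2 / (1 + Rabs (snd z)))).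
  - apply (continuous_mult (fun _ : R * R => Rpower 2 (- p)) (fun z : R * R => p * Rpower (clamp (fst z)) (p - 1))). apply continuous_const.
    apply (continuous_comp (fun z : R * R => fst z) (fun v => p * Rpower (clamp v) (p - 1))). apply continuous_fst.
    apply dpow_cont.
  - apply (continuous_mult (fun _ : R * R => mu / 2) (fun z : R * R => / (1 + Rabs (snd z)))). apply continuous_const.
    apply (continuous_comp (fun z : R * R => snd z) (fun s => / (1 + Rabs s))). apply continuous_snd. apply inv1_cont.
Qed.

Lemma tnl_eq u s : g <= u <= M -> 0 <= s -> tnl u s = nonlin p mu u s.
Proof.
  intros Hu Hs. unfold tnl, nonlin, abs_pow. rewrite tpow_eq by auto.
  destruct (Req_EM_T u 0); [lra|]. rewrite !Rabs_pos_eq by lra. field. lra.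
Qed.

Lemma tnl_mono u v s : u <= v -> tnl u s <= tnl v s.
Proof.
  intros Huv.
  destruct (MVT_gen (fun u => tnl u s) u v (fun u => dtnl u s)) as [c [_ E]].
  - intros; apply tnl_derive.
  - intros x _. apply derivable_continuous_pt. eexists. apply is_derive_Reals, tnl_derive.
  - generalize (dtnl_pos c s). intros. nra.
Qed.

Lemma tnl_time u s s' : 0 <= u -> 0 <= s <= s' -> tnl u s <= tnl u s'.
Proof.
  intros Hu Hs. unfold tnl. rewrite !Rabs_pos_eq by lra.
  assert (/ (1 + s') <= / (1 + s)) by (apply Rinv_le_contravar; lra).
  assert (u * / (1 + s') <= u * / (1 + s)) by (apply Rmult_le_compat_l; auto).
  unfold Rdiv. nra.
Qed.

Lemma tnl_upper u s : g <= u -> tnl u s <= Rpower 2 (- p) * Rpower u p.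
Proof.
  intros Hu. unfold tnl. generalize (tpow_le u Hu) (inv1_bounds s) (Rpower_pos 2 (- p)). intros.
  assert (0 <= u * / (1 + Rabs s)) by (apply Rmult_le_pos; lra). unfold Rdiv in *. nra.
Qed.

Lemma tnl_lower u s : g <= u <= M -> Rpower 2 (- p) * Rpower u p / 2 <= tnl u s.
Proof.
  intros Hu. unfold tnl. rewrite tpow_eq by auto. rewrite (Rpower_split u p) by lra.
  generalize (inv1_bounds s) (Rpower_pos 2 (- p)). intros.
  assert (Rpower g (p - 1) <= Rpower u (p - 1)) by (apply Rle_Rpower_l; lra).
  assert (mu <= Rpower 2 (- p) * Rpower u (p - 1)) by nra.
  assert (u * / (1 + Rabs s) <= u) by nra.
  assert (mu * u <= Rpower 2 (- p) * Rpower u (p - 1) * u) by nra.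
  unfold Rdiv. nra.
Qed.

End Truncation.

(** * Monotone iterates *)

(* [slope] is the monotonicity aperture: solutions increase along every
   direction [(v, 1)] with [|v| <= slope], which is wider than the light cone. *)
Record data := mkData {
  pwr : R; damp : R; low : bool -> R; slope : R; Bd : R; ini : bool -> R -> R; dini : bool -> R -> R;
  pwr_gt1 : 1 < pwr; damp_pos : 0 < damp; low_pos : forall b, 0 < low b;
  slope_gt1 : 1 < slope; Bd_pos : 0 <= Bd;
  low_large : damp <= Rpower 2 (- pwr) * Rpower (low true + low false) (pwr - 1);
  ini_derive : forall b x, is_derive (ini b) x (dini b x);
  dini_cont : forall b x, continuous (dini b) x;
  ini_bound : forall b x, Rabs (ini b x) <= Bd;
  dini_bound : forall b x, Rabs (dini b x) <= Bd;
  ini_low : forall b x, low b <= ini b x;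
  dini_small : forall b x, (1 + slope) * Rabs (dini b x) <=
    Rpower 2 (- pwr) * Rpower (low true + low false) pwr - damp / 2 * (low true + low false) }.

Lemma RInt_cst (c a b : R) : RInt (fun _ => c) a b = (b - a) * c.
Proof. rewrite RInt_const. reflexivity. Qed.

Lemma charop_mono e ff h k x t :
  0 <= t -> cont2 h -> cont2 k ->
  (forall s, 0 <= s <= t -> h (x + e * (t - s)) s <= k (x + e * (t - s)) s) ->
  charop e ff h x t <= charop e ff k x t.
Proof.
  intros Ht Hh Hk H. unfold charop. apply Rplus_le_compat_l.
  apply RInt_le; auto; try (apply ex_RInt_cont; intros s; now apply cont2_char).
  intros s Hs. apply H. lra.
Qed.

Lemma charop_low e ff h x t c n0 :
  0 <= t -> 0 <= n0 -> cont2 h -> c <= ff (x + e * t) ->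
  (forall s, 0 <= s <= t -> n0 <= h (x + e * (t - s)) s) ->
  c <= charop e ff h x t.
Proof.
  intros Ht Hn Hh Hc H. unfold charop.
  assert (0 <= RInt (fun s => h (x + e * (t - s)) s) 0 t).
  { apply RInt_ge_0; auto. apply ex_RInt_cont; intros s; now apply cont2_char.
    intros s Hs. specialize (H s ltac:(lra)). lra. }
  lra.
Qed.

(** Shifting the endpoint by tau (v, 1) moves the foot by (v + e) tau, which costs at most tau S
    |dff|. In return the characteristic gains an initial stretch of duration tau with source at
    least n0, and n0 was assumed to pay for the loss. The remaining stretches are compared
    pointwise. *)
Lemma charop_cone e ff dff h x t v tau n0 S :
  0 <= t -> 0 <= tau -> cont2 h ->
  (forall x, is_derive ff x (dff x)) ->
  (forall x, S * Rabs (dff x) <= n0) -> Rabs (v + e) <= S ->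
  (forall y s, 0 <= s -> n0 <= h y s) ->
  (forall s, 0 <= s <= t -> h (x + e * (t - s)) s <= h (x + e * (t - s) + v * tau) (s + tau)) ->
  charop e ff h x t <= charop e ff h (x + v * tau) (t + tau).
Proof.
  intros Ht Htau Hh Hff Hd Hv Hn Hm. unfold charop.
  assert (Cc : forall s, continuous (fun s => h (x + v * tau + e * (t + tau - s)) s) s) by (intros s; now apply cont2_char).
  assert (Ec : forall a b, ex_RInt (fun s => h (x + v * tau + e * (t + tau - s)) s) a b) by (intros; apply ex_RInt_cont; auto).
  rewrite <- (RInt_Chasles (fun s => h (x + v * tau + e * (t + tau - s)) s) 0 tau (t + tau)) by auto.
  change plus with Rplus.
  assert (I1 : tau * n0 <= RInt (fun s => h (x + v * tau + e * (t + tau - s)) s) 0 tau).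
  { replace (tau * n0) with (RInt (fun _ => n0) 0 tau).
    apply RInt_le; auto. apply ex_RInt_const. intros s Hs. apply Hn. lra.
    rewrite RInt_cst. Rring. }
  assert (I2 : RInt (fun s => h (x + e * (t - s)) s) 0 t <= RInt (fun s => h (x + v * tau + e * (t + tau - s)) s) tau (t + tau)).
  { assert (E := RInt_comp_lin (fun s => h (x + v * tau + e * (t + tau - s)) s) 1 tau 0 t).
    rewrite !Rmult_0_r, Rmult_1_l, Rplus_0_l in E. rewrite <- E by auto.
    apply RInt_le; auto.
    - apply ex_RInt_cont; intros s; now apply cont2_char.
    - apply ex_RInt_cont. intros s. unfold scal; simpl. unfold mult; simpl.
      apply (continuous_ext_fun (fun s => h ((x + v * tau + e * t) + (- e) * s) (tau + 1 * s))).
      intros y. symmetry. etransitivity; [apply Rmult_1_l|]. f_equal; ring. now apply cont2_line.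
    - intros s Hs. unfold scal; simpl. unfold mult; simpl.
      apply Rle_trans with (1 := Hm s ltac:(lra)). right. symmetry. etransitivity; [apply Rmult_1_l|]. f_equal; ring. }
  destruct (MVT_gen ff (x + e * t) (x + v * tau + e * (t + tau)) dff) as [c [_ E]].
  - intros; auto.
  - intros y _. apply derivable_continuous_pt. eexists. apply is_derive_Reals, Hff.
  - assert (Rabs (dff c * (x + v * tau + e * (t + tau) - (x + e * t))) <= tau * n0).
    { replace (x + v * tau + e * (t + tau) - (x + e * t)) with ((v + e) * tau) by ring.
      rewrite !Rabs_mult, (Rabs_pos_eq tau) by auto. specialize (Hd c).
      assert (X := Rabs_pos (dff c)). assert (Y := Rabs_pos (v + e)).
      apply Rle_trans with (tau * (S * Rabs (dff c))); [|apply Rmult_le_compat_l; auto].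
      replace (Rabs (dff c) * (Rabs (v + e) * tau)) with (tau * (Rabs (v + e) * Rabs (dff c))) by ring.
      apply Rmult_le_compat_l; auto. apply Rmult_le_compat_r; auto. }
    apply Rabs_le_between in H.
    apply Rle_trans with (ff (x + v * tau + e * (t + tau)) + (tau * n0 + RInt (fun s => h (x + e * (t - s)) s) 0 t)).
    + assert (ff (x + e * t) <= ff (x + v * tau + e * (t + tau)) + tau * n0) by lra.
      rewrite <- Rplus_assoc. now apply Rplus_le_compat_r.
    + apply Rplus_le_compat_l. now apply Rplus_le_compat.
Qed.

Lemma lim_le (u v : nat -> R) (a b : R) : (forall n, u n <= v n) -> is_lim_seq u a -> is_lim_seq v b -> a <= b.
Proof. intros H Hu Hv. exact (is_lim_seq_le u v a b H Hu Hv). Qed.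

Lemma sgn_abs b : Rabs (sgn b) = 1.
Proof. destruct b; simpl; [apply Rabs_R1 | rewrite Rabs_left; lra]. Qed.

Section Solution.

Variable d : data.

Definition gam : R := low d true + low d false.
Definition cp : R := Rpower 2 (- pwr d).
Definition nl (M u s : R) : R := tnl (pwr d) (damp d) gam M u s.
Definition dnl (M u s : R) : R := dtnl (pwr d) (damp d) gam M u s.
Definition nl0 : R := cp * Rpower gam (pwr d) - damp d / 2 * gam.

Definition it (M : R) (n : nat) : bool -> R -> R -> R := pic (nl M) (ini d) (low d) n.
(** Defined by a limit, and [dsol] by [Derive], rather than as witnesses of [picard]: both are then
    plain functions of [M], and solutions for different levels can be compared. [sol_picard]
    recovers their properties. *)
Definition sol (M : R) (b : bool) (x t : R) : R := real (Lim_seq (fun n => it M n b x t)).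
Definition dsol (M : R) (b : bool) (x t : R) : R := Derive (fun x => sol M b x t) x.
Definition solU (M x t : R) : R := sol M true x t + sol M false x t.
Definition source (M : R) : R -> R -> R := src (nl M) (sol M true) (sol M false).
Definition dsource (M : R) : R -> R -> R := dsrc (dnl M) (sol M true) (sol M false) (dsol M true) (dsol M false).

Lemma gam_pos : 0 < gam.
Proof. unfold gam. generalize (low_pos d true) (low_pos d false). lra. Qed.

Lemma gam_large : damp d <= Rpower 2 (- pwr d) * Rpower gam (pwr d - 1).
Proof. apply low_large. Qed.

Lemma cp_pos : 0 < cp.
Proof. apply Rpower_pos. Qed.

Lemma nl_gam_0 M : gam <= M -> nl M gam 0 = nl0.
Proof.
  intros HM. unfold nl, tnl, nl0. rewrite tpow_eq; auto using gam_pos. 2: lra.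
  rewrite Rabs_R0. fold cp. field.
Qed.

Lemma nl0_pos : 0 < nl0.
Proof.
  rewrite <- (nl_gam_0 gam) by lra.
  assert (H := tnl_lower (pwr d) (damp d) gam gam (pwr_gt1 d) (damp_pos d) gam_pos gam_large gam 0 ltac:(lra)).
  fold (nl gam gam 0) cp in H. assert (0 < cp * Rpower gam (pwr d)) by (apply Rmult_lt_0_compat; apply Rpower_pos). lra.
Qed.

Section FixedM.

Variable M : R.
Hypothesis HM : gam <= M.

Lemma cont2_nl : cont2 (nl M).
Proof. apply cont2_tnl; auto using gam_pos, pwr_gt1. Qed.

Lemma cont2_dnl : cont2 (dnl M).
Proof. apply cont2_dtnl; auto using gam_pos, pwr_gt1. Qed.

Lemma nl_derive u s : is_derive (fun u => nl M u s) u (dnl M u s).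
Proof. apply tnl_derive; auto using gam_pos, pwr_gt1. Qed.

Lemma dnl_bound u s : Rabs (dnl M u s) <= tnlK (pwr d) M.
Proof. apply dtnl_bound; auto using gam_pos, gam_large, pwr_gt1, damp_pos. Qed.

Lemma nl_upper u s : gam <= u -> nl M u s <= cp * Rpower u (pwr d).
Proof. intros Hu. apply tnl_upper; auto using gam_pos, pwr_gt1, damp_pos. Qed.

Lemma nl_lower u s : gam <= u <= M -> cp * Rpower u (pwr d) / 2 <= nl M u s.
Proof. intros Hu. apply tnl_lower; auto using gam_pos, gam_large, pwr_gt1, damp_pos. Qed.

Lemma nl_time u s s' : 0 <= u -> 0 <= s <= s' -> nl M u s <= nl M u s'.
Proof. apply tnl_time, damp_pos. Qed.

Lemma nl_mono u v s : u <= v -> nl M u s <= nl M v s.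
Proof. apply tnl_mono; auto using pwr_gt1, damp_pos, gam_pos, gam_large. Qed.

Lemma nl_low u s : gam <= u -> 0 <= s -> nl0 <= nl M u s.
Proof.
  intros Hu Hs. rewrite <- (nl_gam_0 M) by auto.
  apply Rle_trans with (nl M gam s). apply nl_time; try lra. generalize gam_pos; lra.
  now apply nl_mono.
Qed.

Lemma sol_picard :
  (forall b, cont2 (sol M b)) /\ (forall b, cont2 (dsol M b)) /\
  (forall b x t, sol M b x t = charop (sgn b) (ini d b) (source M) x t) /\
  (forall b x t, dsol M b x t = charop (sgn b) (dini d b) (dsource M) x t) /\
  (forall b x t, is_derive (fun x => sol M b x t) x (dsol M b x t)) /\
  (forall b x t, is_lim_seq (fun n => it M n b x t) (sol M b x t)).
Proof.
  destruct (picard (nl M) (dnl M) (tnlK (pwr d) M) (tnlK2 (pwr d) gam M) (cp * Rpower gam (pwr d))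
    (ini d) (dini d) (low d) (Bd d)) as (A & P & CA & CP & EA & EP & DA & LA);
   try apply d; auto using cont2_nl, cont2_dnl, nl_derive, dnl_bound.
  - apply tnlK_pos, pwr_gt1.
  - apply tnlK2_pos; auto using gam_pos, pwr_gt1.
  - intros. apply dtnl_lip; auto using gam_pos, pwr_gt1.
  - intros s. assert (L := nl_lower gam s ltac:(lra)). assert (U := nl_upper gam s (Rle_refl _)).
    assert (0 < cp * Rpower gam (pwr d)) by (apply Rmult_lt_0_compat; apply Rpower_pos).
    fold gam. rewrite Rabs_pos_eq; lra.
  - assert (A = sol M).
    { do 3 (apply functional_extensionality; intros ?). unfold sol, it. now rewrite (is_lim_seq_unique _ _ (LA _ _ _)). }
    subst A.
    assert (P = dsol M).
    { do 3 (apply functional_extensionality; intros ?). unfold dsol. symmetry. apply is_derive_unique, DA. }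
    subst P. repeat match goal with |- _ /\ _ => split end; auto.
Qed.

Lemma sol_lim b x t : is_lim_seq (fun n => it M n b x t) (sol M b x t).
Proof. apply (proj2 (proj2 (proj2 (proj2 (proj2 sol_picard))))). Qed.

Lemma it_src_cont n : cont2 (src (nl M) (it M n true) (it M n false)).
Proof. apply (src_pic_cont (nl M) (ini d) (dini d)). apply cont2_nl. apply ini_derive. Qed.

Lemma it_S n b x t : it M (S n) b x t = charop (sgn b) (ini d b) (src (nl M) (it M n true) (it M n false)) x t.
Proof. reflexivity. Qed.

Lemma it_low n : forall b x t, 0 <= t -> low d b <= it M n b x t.
Proof.
  induction n as [|n IH]; intros b x t Ht.
  - apply Rle_refl.
  - rewrite it_S. apply charop_low with 0; auto using it_src_cont, ini_low, Rle_refl.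
    intros s Hs. apply Rle_trans with nl0. apply Rlt_le, nl0_pos. apply nl_low; [|lra].
    apply Rplus_le_compat; apply IH; lra.
Qed.

Lemma it_mono n : forall b x t, 0 <= t -> it M n b x t <= it M (S n) b x t.
Proof.
  induction n as [|n IH]; intros b x t Ht.
  - exact (it_low 1 b x t Ht).
  - rewrite (it_S n), (it_S (S n)).
    apply charop_mono; auto using it_src_cont; intros s Hs; apply nl_mono, Rplus_le_compat; apply IH; lra.
Qed.

(** The foot of a characteristic moves at speed [v + sgn b], at most [1 + slope d] in absolute
    value, which is the factor in [dini_small]. The source increases along the direction for two
    reasons: the previous iterate does, and the damping decays in time. *)
Lemma it_cone n : forall b x t v tau, 0 <= t -> 0 <= tau -> Rabs v <= slope d ->
  it M n b x t <= it M n b (x + v * tau) (t + tau).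
Proof.
  induction n as [|n IH]; intros b x t v tau Ht Htau Hv.
  - apply Rle_refl.
  - rewrite !it_S.
    apply (charop_cone (sgn b) (ini d b) (dini d b) _ x t v tau nl0 (1 + slope d)); auto using it_src_cont.
    + apply ini_derive.
    + exact (dini_small d b).
    + apply Rle_trans with (1 := Rabs_triang _ _). rewrite sgn_abs. lra.
    + intros y s Hs. apply nl_low; auto. apply Rplus_le_compat; now apply it_low.
    + intros s Hs. set (y := x + sgn b * (t - s)). unfold src.
      assert (Hl : forall b', 0 <= it M n b' (y + v * tau) (s + tau)).
      { intros b'. apply Rle_trans with (low d b'). apply Rlt_le, low_pos. apply it_low. lra. }
      assert (Hl1 := Hl true). assert (Hl2 := Hl false).
      apply Rle_trans with (nl M (it M n true (y + v * tau) (s + tau) + it M n false (y + v * tau) (s + tau)) s).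
      * apply nl_mono, Rplus_le_compat; apply IH; auto; lra.
      * apply nl_time; lra.
Qed.

Lemma sol_cone b x t v tau : 0 <= t -> 0 <= tau -> Rabs v <= slope d -> sol M b x t <= sol M b (x + v * tau) (t + tau).
Proof.
  intros. apply (lim_le _ _ _ _ (fun n => it_cone n b x t v tau H H0 H1) (sol_lim _ _ _) (sol_lim _ _ _)).
Qed.

Lemma solU_cone x t y s : 0 <= s <= t -> Rabs (y - x) <= slope d * (t - s) -> solU M y s <= solU M x t.
Proof.
  intros Hs Hy. assert (HS := slope_gt1 d).
  destruct (Req_dec s t) as [->|Hne].
  - rewrite Rminus_diag, Rmult_0_r in Hy.
    assert (y - x = 0). { apply Rabs_eq_0. apply Rle_antisym; auto. apply Rabs_pos. }
    replace y with x by lra. lra.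
  - set (v := (x - y) / (t - s)).
    assert (Hv : Rabs v <= slope d).
    { unfold v, Rdiv. rewrite Rabs_mult, Rabs_inv, (Rabs_pos_eq (t - s)), Rabs_minus_sym by lra.
      apply Rmult_le_reg_r with (t - s); [lra|]. rewrite Rmult_assoc, Rinv_l, Rmult_1_r by lra. lra. }
    assert (A := fun b => sol_cone b y s v (t - s) ltac:(lra) ltac:(lra) Hv).
    replace (y + v * (t - s)) with x in A by (unfold v; field; lra).
    replace (s + (t - s)) with t in A by ring. apply Rplus_le_compat; apply A.
Qed.

Lemma solU_time x t s : 0 <= s <= t -> solU M x s <= solU M x t.
Proof.
  intros Hs. apply solU_cone; auto. rewrite Rminus_diag, Rabs_R0. generalize (slope_gt1 d). nra.
Qed.

Lemma it_le_sol n b x t : 0 <= t -> it M n b x t <= sol M b x t.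
Proof.
  intros Ht. apply (is_lim_seq_incr_compare (fun n => it M n b x t) (sol M b x t) (sol_lim b x t)).
  intros k. now apply it_mono.
Qed.

Lemma sol_low b x t : 0 <= t -> low d b <= sol M b x t.
Proof. intros Ht. exact (it_le_sol 0 b x t Ht). Qed.

Lemma solU_low x t : 0 <= t -> gam <= solU M x t.
Proof. intros Ht. apply Rplus_le_compat; now apply sol_low. Qed.

Lemma solU_0 x : solU M x 0 = ini d true x + ini d false x.
Proof.
  unfold solU. destruct sol_picard as (_ & _ & EA & _). now rewrite !EA, !charop_zero.
Qed.

(** Finite speed of propagation: values in the backward light cone depend only on data and sources
    there, where the truncation is inactive as long as the earlier iterates stay below [M]. The
    generality in N' and f0 covers both another truncation level and the untruncated equation with
    its original data. *)
Lemma it_agree_aux (N' : R -> R -> R) (f0 : bool -> R -> R) x t n :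
  (forall u s, gam <= u <= M -> 0 <= s -> N' u s = nl M u s) ->
  (forall b y, Rabs (y - x) <= t -> f0 b y = ini d b y) ->
  (forall k y s, (k < n)%nat -> 0 <= s -> Rabs (y - x) <= t - s -> it M k true y s + it M k false y s <= M) ->
  forall b y s, 0 <= s -> Rabs (y - x) <= t - s -> pic N' f0 (low d) n b y s = it M n b y s.
Proof.
  intros HN Hf. induction n as [|n IH]; intros Hu b y s Hs Hy.
  - reflexivity.
  - assert (IH' := IH (fun k y s Hk => Hu k y s (Nat.lt_lt_succ_r _ _ Hk))).
    assert (Cone : forall r, 0 <= r <= s -> Rabs (y + sgn b * (s - r) - x) <= t - r).
    { intros r Hr. replace (y + sgn b * (s - r) - x) with ((y - x) + sgn b * (s - r)) by ring.
      apply Rle_trans with (1 := Rabs_triang _ _). rewrite Rabs_mult, sgn_abs, (Rabs_pos_eq (s - r)); lra. }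
    rewrite it_S. simpl. unfold charop. apply (f_equal2 Rplus).
    + apply Hf. replace (y + sgn b * s) with (y + sgn b * (s - 0)) by ring. rewrite <- (Rminus_0_r t). apply Cone. lra.
    + apply RInt_ext. intros r Hr. rewrite Rmin_left, Rmax_right in Hr by lra.
      assert (Hc := Cone r ltac:(lra)). unfold src.
      rewrite !IH' by (auto; lra). apply HN; [|lra].
      split. apply Rplus_le_compat; apply it_low; lra. apply (Hu n); auto. lra.
Qed.

(** A single bound at the apex controls the whole light cone, by monotonicity along directions wider
    than it. *)
Lemma it_agree (N' : R -> R -> R) (f0 : bool -> R -> R) x t n b y s :
  (forall u s, gam <= u <= M -> 0 <= s -> N' u s = nl M u s) ->
  (forall b y, Rabs (y - x) <= t -> f0 b y = ini d b y) ->
  solU M x t <= M -> 0 <= s -> Rabs (y - x) <= t - s -> pic N' f0 (low d) n b y s = it M n b y s.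
Proof.
  intros HN Hf Hu Hs Hy. apply it_agree_aux with x t; auto.
  intros k z r _ Hr Hz. apply Rle_trans with (solU M z r). apply Rplus_le_compat; now apply it_le_sol.
  apply Rle_trans with (2 := Hu). assert (X := Rabs_pos (z - x)). apply solU_cone. lra. generalize (slope_gt1 d). nra.
Qed.

End FixedM.

Lemma nl_agree M M' u s : gam <= u <= M -> M <= M' -> nl M' u s = nl M u s.
Proof.
  intros Hu HM. unfold nl, tnl. rewrite !tpow_eq; auto using gam_pos; lra.
Qed.

Lemma sol_agree M M' b x t y s : gam <= M -> M <= M' -> solU M x t <= M -> 0 <= s -> Rabs (y - x) <= t - s ->
  sol M' b y s = sol M b y s.
Proof.
  intros HM HMM Hu Hs Hy.
  assert (G := fun n => it_agree M HM (nl M') (ini d) x t n b y s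
     (fun u s Hu _ => nl_agree M M' u s Hu HMM) (fun b y _ => eq_refl) Hu Hs Hy).
  apply (f_equal real), Lim_seq_ext. exact G.
Qed.

Lemma nl_M_mono M M' u s : gam <= M -> M <= M' -> gam <= u -> nl M u s <= nl M' u s.
Proof.
  intros HM HMM Hu. assert (Hg := gam_pos). assert (Hp := pwr_gt1 d). unfold nl, tnl. apply Rplus_le_compat_r.
  apply Rmult_le_compat_l. apply Rlt_le, Rpower_pos.
  unfold tpow. apply Rplus_le_compat_l. apply RInt_le; auto.
  - apply ex_RInt_cont. intros v. apply dpow_cont; auto.
  - apply ex_RInt_cont. intros v. apply dpow_cont; auto. lra.
  - intros v Hv. apply Rmult_le_compat_l; [lra|]. apply Rle_Rpower_l; [lra|].
    split. generalize (clamp_range gam M HM v); lra.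
    unfold clamp. apply Rle_max_compat_l. apply Rle_min_compat_l; auto.
Qed.

Lemma it_M_mono M M' n : gam <= M -> M <= M' -> forall b x t, 0 <= t -> it M n b x t <= it M' n b x t.
Proof.
  intros HM HMM. assert (HM' : gam <= M') by lra.
  induction n as [|n IH]; intros b x t Ht.
  - apply Rle_refl.
  - rewrite !it_S. apply charop_mono; auto using it_src_cont. intros s Hs. set (y := x + sgn b * (t - s)). unfold src.
    apply Rle_trans with (nl M' (it M n true y s + it M n false y s) s).
    + apply nl_M_mono; auto. apply Rplus_le_compat; apply it_low; auto; lra.
    + apply nl_mono; auto. apply Rplus_le_compat; apply IH; lra.
Qed.

(** Independence of [M] is the point: it allows a level to be chosen afterwards, above all values of
    the first iterates. *)
Lemma it_uniform_bound n t : 0 <= t -> exists C, gam <= C /\ forall M x s, gam <= M -> 0 <= s <= t ->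
  it M n true x s + it M n false x s <= C.
Proof.
  intros Ht. assert (Hg := gam_pos). induction n as [|n [C [HC IH]]].
  - exists gam. split. lra. intros. apply Rle_refl.
  - set (C' := cp * Rpower C (pwr d)).
    assert (HC' : 0 < C') by (apply Rmult_lt_0_compat; apply Rpower_pos).
    exists (gam + (2 * Bd d + 2 * t * C')). split.
    { assert (0 <= t * C') by (apply Rmult_le_pos; lra). generalize (Bd_pos d). lra. }
    intros M x s HM Hs.
    assert (Q : forall b, it M (S n) b x s <= Bd d + t * C').
    { intros b. rewrite it_S. unfold charop. apply Rplus_le_compat.
      - apply Rle_trans with (1 := RRle_abs _). apply ini_bound.
      - apply Rle_trans with (s * C'); [|apply Rmult_le_compat_r; lra].
        replace (s * C') with (RInt (fun _ => C') 0 s) by (rewrite RInt_cst; Rring).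
        apply RInt_le; try lra. apply ex_RInt_cont. intros r. apply cont2_char. now apply it_src_cont.
        apply ex_RInt_const. intros r Hr. unfold src.
        set (u := it M n true (x + sgn b * (s - r)) r + it M n false (x + sgn b * (s - r)) r).
        assert (u <= C) by (apply IH; auto; lra).
        assert (gam <= u) by (apply Rplus_le_compat; apply it_low; auto; lra).
        apply Rle_trans with (1 := nl_upper M HM u r H0). apply Rmult_le_compat_l. apply Rlt_le, cp_pos.
        apply Rle_Rpower_l. generalize (pwr_gt1 d); lra. lra. }
    generalize (Q true) (Q false). lra.
Qed.

End Solution.

(** * The slope ratios *)

Lemma is_derive_nonneg (h : R -> R) (x l : R) :
  is_derive h x l -> (forall s, 0 < s -> h x <= h (x + s)) -> 0 <= l.
Proof.
  intros Hd Hm. apply is_derive_Reals in Hd.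
  destruct (Rle_dec 0 l) as [H|H]; auto. exfalso.
  destruct (Hd (- l / 2) ltac:(lra)) as [de Hde].
  assert (D0 := cond_pos de).
  specialize (Hde (de / 2) ltac:(lra) ltac:(rewrite Rabs_pos_eq; lra)).
  specialize (Hm (de / 2) ltac:(lra)).
  assert (0 <= (h (x + de / 2) - h x) / (de / 2)).
  { apply Rmult_le_pos. lra. apply Rlt_le, Rinv_0_lt_compat. lra. }
  apply Rabs_lt_between in Hde. lra.
Qed.

Ltac Rfield := match goal with |- @eq _ ?a ?b => change (@eq R a b); field end.

Ltac derive_eq D := refine (eq_rect _ (fun l => is_derive _ _ l) D _ _).

Section Ratios.

Variable d : data.
Variable M : R.
Hypothesis HM : gam d <= M.

Definition lam : R := / slope d.
Definition solN (x t : R) : R := nl d M (solU d M x t) t.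
(* The time derivative of [sol]. *)
Definition tau (b : bool) (x t : R) : R := solN x t + sgn b * dsol d M b x t.
Definition rat (b : bool) (x t : R) : R := dsol d M b x t / tau b x t.
Definition soldN (x t : R) : R := dnl d M (solU d M x t) t.
(* The derivative of the nonlinearity with respect to its explicit time variable. *)
Definition Ft (x t : R) : R := damp d / 2 * solU d M x t / (1 + t) ^ 2.

Lemma lam_range : 0 < lam < 1.
Proof.
  unfold lam. assert (H := slope_gt1 d). split. apply Rinv_0_lt_compat; lra.
  rewrite <- Rinv_1. apply Rinv_lt_contravar; lra.
Qed.

Lemma cont2_source : cont2 (source d M).
Proof. destruct (sol_picard d M HM) as (CA & _). apply cont2_src; auto. now apply cont2_nl. Qed.

Lemma cont2_dsource : cont2 (dsource d M).
Proof. destruct (sol_picard d M HM) as (CA & CP & _). apply cont2_dsrc; auto. now apply cont2_dnl. Qed.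

Lemma source_derive x t : is_derive (fun x => source d M x t) x (dsource d M x t).
Proof.
  destruct (sol_picard d M HM) as (_ & _ & _ & _ & DA & _).
  apply src_derive; auto. now apply nl_derive.
Qed.

Lemma sol_line b x t d1 d2 s :
  is_derive (fun s => sol d M b (x + d1 * s) (t + d2 * s)) s
   (d1 * dsol d M b (x + d1 * s) (t + d2 * s) + d2 * tau b (x + d1 * s) (t + d2 * s)).
Proof.
  destruct (sol_picard d M HM) as (_ & _ & EA & EP & _).
  apply (is_derive_ext (fun s => charop (sgn b) (ini d b) (source d M) (x + d1 * s) (t + d2 * s))).
  { intros r. symmetry. apply EA. }
  derive_eq (is_derive_charop_line (sgn b) (ini d b) (dini d b) (source d M) (dsource d M) x t d1 d2 s
    (ini_derive d b) cont2_source cont2_dsource source_derive).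
  rewrite <- EP. unfold tau. change (source d M) with solN. Rring.
Qed.

Lemma dsol_char b z s :
  is_derive (fun s => dsol d M b (z - sgn b * s) s) s
    (soldN (z - sgn b * s) s * (dsol d M true (z - sgn b * s) s + dsol d M false (z - sgn b * s) s)).
Proof.
  destruct (sol_picard d M HM) as (_ & _ & _ & EP & _).
  apply (is_derive_ext (fun s => charop (sgn b) (dini d b) (dsource d M) (z - sgn b * s) s)).
  - intros r. symmetry. apply EP.
  - apply (is_derive_charop_char (sgn b) (dini d b) _ z s cont2_dsource).
Qed.

Lemma solN_pos x t : 0 <= t -> 0 < solN x t.
Proof.
  intros Ht. apply Rlt_le_trans with (1 := nl0_pos d). apply nl_low; auto. now apply solU_low.
Qed.

Lemma dsol_bound b x t : 0 <= t -> Rabs (dsol d M b x t) <= lam * tau b x t.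
Proof.
  intros Ht. assert (HS := slope_gt1 d).
  assert (G : forall v, Rabs v <= slope d -> 0 <= v * dsol d M b x t + tau b x t).
  { intros v Hv. assert (D := sol_line b x t v 1 0).
    rewrite !Rmult_0_r, !Rplus_0_r, Rmult_1_l in D.
    apply (is_derive_nonneg _ _ _ D). intros s Hs.
    rewrite !Rmult_0_r, !Rplus_0_r, Rplus_0_l, Rmult_1_l. apply sol_cone; auto. lra. }
  assert (G1 := G (slope d) ltac:(rewrite Rabs_pos_eq; lra)).
  assert (G2 := G (- slope d) ltac:(rewrite Rabs_Ropp, Rabs_pos_eq; lra)).
  apply Rmult_le_reg_l with (slope d); [lra|]. unfold lam. rewrite <- Rmult_assoc, Rinv_r, Rmult_1_l by lra.
  apply Rle_trans with (Rabs (slope d * dsol d M b x t)); [rewrite Rabs_mult, (Rabs_pos_eq (slope d)); lra|].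
  apply Rabs_le_between. lra.
Qed.

(** [tau] differs from the source by a space derivative of size at most [lam * tau]. Both time
    derivatives are therefore comparable with the same source, hence with each other. *)
Lemma tau_bounds b x t : 0 <= t -> 0 < tau b x t /\ solN x t / (1 + lam) <= tau b x t <= solN x t / (1 - lam).
Proof.
  intros Ht. assert (HL := lam_range). assert (B := dsol_bound b x t Ht). assert (N := solN_pos x t Ht).
  assert (B' : Rabs (sgn b * dsol d M b x t) <= lam * tau b x t) by (rewrite Rabs_mult, sgn_abs; lra).
  apply Rabs_le_between in B'. assert (ET : tau b x t = solN x t + sgn b * dsol d M b x t) by reflexivity.
  set (P := sgn b * dsol d M b x t) in *. set (n := solN x t) in *.
  assert (n / (1 + lam) * (1 + lam) = n) by (field; lra).
  assert (n / (1 - lam) * (1 - lam) = n) by (field; lra).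
  assert (0 < tau b x t) by nra.
  repeat split; auto.
  - apply Rmult_le_reg_r with (1 + lam); lra.
  - apply Rmult_le_reg_r with (1 - lam); lra.
Qed.

Lemma rat_bound b x t : 0 <= t -> Rabs (rat b x t) <= lam.
Proof.
  intros Ht. destruct (tau_bounds b x t Ht) as [T _].
  unfold rat, Rdiv. rewrite Rabs_mult, Rabs_inv, (Rabs_pos_eq (tau b x t)) by lra.
  apply Rmult_le_reg_r with (1 := T). rewrite Rmult_assoc, Rinv_l, Rmult_1_r by lra. now apply dsol_bound.
Qed.

Lemma sol_line_sum x t d1 d2 s :
  is_derive (fun s => solU d M (x + d1 * s) (t + d2 * s)) s
   (d1 * dsol d M true (x + d1 * s) (t + d2 * s) + d2 * tau true (x + d1 * s) (t + d2 * s)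
    + (d1 * dsol d M false (x + d1 * s) (t + d2 * s) + d2 * tau false (x + d1 * s) (t + d2 * s))).
Proof. exact (is_derive_plus _ _ _ _ _ (sol_line true x t d1 d2 s) (sol_line false x t d1 d2 s)). Qed.

Lemma solU_line x t d1 d2 s : 0 <= t + d2 * s ->
  is_derive (fun s => solU d M (x + d1 * s) (t + d2 * s)) s
   ((d1 * rat true (x + d1 * s) (t + d2 * s) + d2) * tau true (x + d1 * s) (t + d2 * s)
    + (d1 * rat false (x + d1 * s) (t + d2 * s) + d2) * tau false (x + d1 * s) (t + d2 * s)).
Proof.
  intros Hs.
  destruct (tau_bounds true (x + d1 * s) (t + d2 * s) Hs) as [H1 _].
  destruct (tau_bounds false (x + d1 * s) (t + d2 * s) Hs) as [H2 _].
  derive_eq (sol_line_sum x t d1 d2 s). unfold rat. Rfield. lra.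
Qed.

Lemma cont2_solU : cont2 (solU d M).
Proof. destruct (sol_picard d M HM) as (CA & _). now apply cont2_plus. Qed.

Lemma nl_path_derive (u : R -> R) (s u' : R) : 0 < s -> is_derive u s u' ->
  is_derive (fun s => nl d M (u s) s) s (dnl d M (u s) s * u' + damp d / 2 * u s / (1 + s) ^ 2).
Proof.
  intros Hs Hu.
  assert (T := is_derive_comp (tpow (pwr d) (gam d) M) u s _ _ (tpow_derive (pwr d) (gam d) M (pwr_gt1 d) (gam_pos d) HM (u s)) Hu).
  apply (is_derive_ext_loc (fun s => Rpower 2 (- pwr d) * tpow (pwr d) (gam d) M (u s) - damp d / 2 * (u s * / (1 + s)))).
  { exists (mkposreal s Hs). intros y Hy. change (Rabs (y - s) < s) in Hy. apply Rabs_lt_between in Hy.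
    unfold nl, tnl. rewrite Rabs_pos_eq by lra. reflexivity. }
  assert (I : is_derive (fun s => / (1 + s)) s (- / (1 + s) ^ 2)).
  { auto_derive. lra. field. lra. }
  derive_eq (is_derive_minus _ _ _ _ _ (is_derive_scal _ s (Rpower 2 (- pwr d)) _ T)
    (is_derive_scal _ s (damp d / 2) _ (is_derive_mult u (fun s => / (1 + s)) s _ _ Hu I Rmult_comm))).
  unfold minus, plus, opp, scal, dnl, dtnl; simpl. unfold mult; simpl.
  rewrite (Rabs_pos_eq s) by lra. Rfield. lra.
Qed.

(** Both components have the same right-hand side, D_- phi = N = D_+ psi, so D_- (phi + psi) = D_+
    psi + D_- psi = 2 psi_t, and symmetrically for the other direction. *)
Lemma solU_char b z s : is_derive (fun s => solU d M (z - sgn b * s) s) s (2 * tau (negb b) (z - sgn b * s) s).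
Proof.
  assert (D := sol_line_sum z 0 (- sgn b) 1 s).
  replace (z + - sgn b * s) with (z - sgn b * s) in D by ring. rewrite Rplus_0_l, !Rmult_1_l in D.
  apply (is_derive_ext (fun s => solU d M (z + - sgn b * s) (0 + 1 * s))).
  { intros r. f_equal; ring. }
  derive_eq D. unfold tau. destruct b; simpl; Rring.
Qed.

Definition kr (b : bool) (x t : R) : R := soldN x t * tau (negb b) x t / tau b x t.
Definition drat (b : bool) (x t : R) : R :=
  kr b x t * (rat (negb b) x t - rat b x t) - rat b x t * Ft x t / tau b x t.

(** [tau b] is the source plus [sgn b] times the space derivative, and along this characteristic
    each of the two is differentiable: the source by the chain rule, the space derivative by its
    integral equation. The quotient rule then gives [drat]. *)
Lemma rat_char b z s : 0 < s -> is_derive (fun s => rat b (z - sgn b * s) s) s (drat b (z - sgn b * s) s).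
Proof.
  intros Hs. set (y := z - sgn b * s).
  destruct (tau_bounds b y s ltac:(lra)) as [T1 _]. destruct (tau_bounds (negb b) y s ltac:(lra)) as [T2 _].
  assert (DN := nl_path_derive (fun s => solU d M (z - sgn b * s) s) s _ Hs (solU_char b z s)).
  assert (DP := dsol_char b z s).
  assert (DT := is_derive_plus _ _ _ _ _ DN (is_derive_scal _ s (sgn b) _ DP)).
  assert (NZ : plus (nl d M (solU d M (z - sgn b * s) s) s) (sgn b * dsol d M b (z - sgn b * s) s) <> 0)
    by (change (tau b y s <> 0); lra).
  derive_eq (is_derive_div _ _ s _ _ DP DT NZ).
  unfold plus, scal; simpl. unfold mult; simpl. fold y. fold (solN y s). fold (tau b y s). fold (soldN y s).
  replace (damp d / 2 * solU d M y s / ((1 + s) * ((1 + s) * 1))) with (Ft y s) by reflexivity.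
  (* With this identity the derivative of [tau b] becomes [soldN * (tau b + tau (negb b)) + Ft]: the
     linearised equation with the damping drift as its only extra term. *)
  assert (ES : sgn b * (dsol d M true y s + dsol d M false y s) = tau b y s - tau (negb b) y s)
    by (unfold tau; destruct b; simpl; ring).
  assert (EP : dsol d M true y s + dsol d M false y s = dsol d M b y s + dsol d M (negb b) y s) by (destruct b; simpl; ring).
  unfold drat, kr, rat.
  replace (sgn b * (soldN y s * (dsol d M true y s + dsol d M false y s)))
    with (soldN y s * (tau b y s - tau (negb b) y s)) by (rewrite <- ES; ring).
  rewrite EP. Rfield. lra.
Qed.

Lemma Ft_bound x t : 0 <= t -> solU d M x t <= M -> 0 <= Ft x t <= solN x t.
Proof.
  intros Ht Hu. assert (Hl := solU_low d M HM x t Ht). assert (G := gam_pos d). assert (Hm := damp_pos d).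
  assert (L := nl_lower d M (solU d M x t) t (conj Hl Hu)). fold (solN x t) in L.
  rewrite (Rpower_split (solU d M x t) (pwr d)) in L by lra.
  assert (damp d <= cp d * Rpower (solU d M x t) (pwr d - 1)).
  { apply Rle_trans with (1 := gam_large d). apply Rmult_le_compat_l. apply Rlt_le, Rpower_pos.
    apply Rle_Rpower_l. generalize (pwr_gt1 d); lra. lra. }
  assert (I : 0 < / (1 + t) ^ 2 <= 1).
  { split. apply Rinv_0_lt_compat, pow_lt. lra. apply Rle_trans with (/ 1); [|rewrite Rinv_1; lra].
    apply Rinv_le_contravar. lra. simpl. nra. }
  unfold Ft, Rdiv in *. assert (0 <= damp d * / 2 * solU d M x t) by nra. split. nra. nra.
Qed.

(** The drift [Ft] is at most the source, the source at most [(1 + lam) * tau], and the ratio at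
    most [lam]; since lam < 1 the product stays below 2. This 2 is the slope of the correction 2 (s
    - t0) used later. *)
Lemma drift_bound b x t : 0 <= t -> solU d M x t <= M -> Rabs (rat b x t * Ft x t / tau b x t) <= 2.
Proof.
  intros Ht Hu. destruct (tau_bounds b x t Ht) as [T [Ta _]].
  assert (Hr := rat_bound b x t Ht). assert (F := Ft_bound x t Ht Hu). assert (HL := lam_range).
  assert (N := solN_pos x t Ht).
  unfold Rdiv. rewrite !Rabs_mult, Rabs_inv, (Rabs_pos_eq (tau b x t)), (Rabs_pos_eq (Ft x t)) by lra.
  apply Rmult_le_reg_r with (1 := T). rewrite Rmult_assoc, Rinv_l, Rmult_1_r by lra.
  assert (solN x t / (1 + lam) * (1 + lam) = solN x t) by (field; lra).
  assert (solN x t <= 2 * tau b x t) by nra.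
  assert (X := Rabs_pos (rat b x t)). nra.
Qed.

(** Least possible quotient of the two time derivatives, both of which lie between N / (1 + lam) and
    N / (1 - lam). *)
Definition kap : R := (1 - lam) / (1 + lam).

Lemma kap_pos : 0 < kap.
Proof. assert (H := lam_range). unfold kap. apply Rdiv_lt_0_compat; lra. Qed.

Lemma kr_bounds b x t : 0 <= t -> solU d M x t <= M ->
  kap * (cp d / 2 * Rpower (solU d M x t) (pwr d - 1)) <= kr b x t <= (cp d * pwr d * Rpower (solU d M x t) (pwr d - 1)) / kap.
Proof.
  intros Ht Hu. destruct (tau_bounds b x t Ht) as [T1 [T1a T1b]]. destruct (tau_bounds (negb b) x t Ht) as [T2 [T2a T2b]].
  assert (HL := lam_range). assert (Hl := solU_low d M HM x t Ht). assert (K := kap_pos).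
  assert (D1 := dtnl_lower (pwr d) (damp d) (gam d) M (pwr_gt1 d) (damp_pos d) (gam_pos d) HM (gam_large d) (solU d M x t) t).
  assert (D2 := dtnl_upper (pwr d) (damp d) (gam d) M (damp_pos d) (solU d M x t) t).
  rewrite (clamp_id (gam d) M (solU d M x t)) in D1, D2 by lra.
  fold (dnl d M (solU d M x t) t) in D1, D2. fold (soldN x t) (cp d) in D1, D2.
  assert (X := Rpower_pos (solU d M x t) (pwr d - 1)). assert (C := cp_pos d).
  set (y := Rpower (solU d M x t) (pwr d - 1)) in *. set (n := solN x t) in *.
  assert (N : 0 < n) by (now apply solN_pos).
  assert (E1 : n / (1 + lam) = kap * (n / (1 - lam))) by (unfold kap; field; lra).
  assert (E2 : n / (1 - lam) = / kap * (n / (1 + lam))) by (unfold kap; field; lra).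
  assert (Ik : 0 < / kap) by (now apply Rinv_0_lt_compat).
  assert (D0 : 0 <= cp d * y / 2) by nra.
  assert (Q : kap <= tau (negb b) x t / tau b x t <= / kap).
  { split; apply Rmult_le_reg_r with (1 := T1); unfold Rdiv; rewrite Rmult_assoc, Rinv_l, Rmult_1_r by lra.
    - nra. - rewrite E2 in T2b. nra. }
  replace (kr b x t) with (soldN x t * (tau (negb b) x t / tau b x t)) by (unfold kr; field; lra).
  split.
  - replace (kap * (cp d / 2 * y)) with (cp d * y / 2 * kap) by field. apply Rmult_le_compat; lra.
  - unfold Rdiv at 2. replace (cp d * pwr d * y) with (cp d * (pwr d * y)) by ring. apply Rmult_le_compat; lra.
Qed.

End Ratios.

(** * The blow-up time *)

Lemma mono_derive (h dh : R -> R) (a b : R) : a <= b ->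
  (forall s, a <= s <= b -> is_derive h s (dh s)) -> (forall s, a <= s <= b -> 0 <= dh s) -> h a <= h b.
Proof.
  intros Hab Hd Hp.
  destruct (MVT_gen h a b dh) as [c [Hc E]]; rewrite Rmin_left, Rmax_right in * by auto.
  - intros x Hx. apply Hd. lra.
  - intros x Hx. apply derivable_continuous_pt. eexists. apply is_derive_Reals, Hd. lra.
  - specialize (Hp c Hc). nra.
Qed.

(* One halving step: the weight [exp (L s)] with [L = 2 K2] absorbs the coupling. *)
Lemma pos_char (A dA : R -> R) (a b K K2 N : R) :
  a <= b -> 0 <= K -> 0 < K2 -> 0 <= N ->
  (forall s, a <= s <= b -> is_derive A s (dA s)) ->
  (forall s, a <= s <= b -> - (K2 * (N * exp (2 * K2 * (s - a)))) <= dA s + K * A s) ->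
  0 <= A a ->
  - (N / 2 * exp (2 * K2 * (b - a))) <= A b.
Proof.
  intros Hab HK HK2 HN Hd Hi Ha.
  set (c := K2 * N / (K + 2 * K2)).
  assert (D : forall s, a <= s <= b -> is_derive (fun s => exp (K * (s - a)) * A s + c * exp ((K + 2 * K2) * (s - a))) s
     (exp (K * (s - a)) * (dA s + K * A s + K2 * (N * exp (2 * K2 * (s - a)))))).
  { intros s Hs.
    assert (D1 : is_derive (fun s => exp (K * (s - a))) s (K * exp (K * (s - a)))) by (auto_derive; auto; unfold Rminus; ring).
    assert (D2 : is_derive (fun s => c * exp ((K + 2 * K2) * (s - a))) s (c * ((K + 2 * K2) * exp ((K + 2 * K2) * (s - a))))) by (auto_derive; auto; unfold Rminus; ring).
    assert (D3 := is_derive_plus _ _ _ _ _ (is_derive_mult _ _ s _ _ D1 (Hd s Hs) Rmult_comm) D2).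
    derive_eq D3.
    unfold plus, mult; simpl.
    replace ((K + 2 * K2) * (s - a)) with (K * (s - a) + 2 * K2 * (s - a)) by ring. rewrite exp_plus.
    unfold c. field. lra. }
  assert (M := mono_derive _ _ a b Hab D). cbv beta in M.
  assert (M' := M ltac:(intros s Hs; apply Rmult_le_pos; [apply Rlt_le, exp_pos | specialize (Hi s Hs); lra])). clear M.
  rewrite Rminus_diag, !Rmult_0_r, exp_0 in M'.
  replace ((K + 2 * K2) * (b - a)) with (K * (b - a) + 2 * K2 * (b - a)) in M' by ring. rewrite exp_plus in M'.
  assert (X := exp_pos (K * (b - a))). assert (Y := exp_pos (2 * K2 * (b - a))).
  assert (Hc : 0 <= c <= N / 2).
  { unfold c. split. apply Rmult_le_pos. nra. apply Rlt_le, Rinv_0_lt_compat. lra.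
    apply Rmult_le_reg_r with (K + 2 * K2). lra. unfold Rdiv at 1. rewrite Rmult_assoc, Rinv_l by lra. nra. }
  assert (0 <= A b + c * exp (2 * K2 * (b - a))).
  { apply Rmult_le_reg_l with (1 := X). lra. }
  nra.
Qed.

Lemma sgn_path_cone b y s r X S : r <= s -> Rabs (y - X) <= S - s ->
  Rabs (y + sgn b * s - sgn b * r - X) <= S - r.
Proof.
  intros Hr Hy. replace (y + sgn b * s - sgn b * r - X) with ((y - X) + sgn b * (s - r)) by ring.
  apply Rle_trans with (1 := Rabs_triang _ _). rewrite Rabs_mult, sgn_abs, (Rabs_pos_eq (s - r)); lra.
Qed.

(** A minimum principle that needs no attained minimum: a lower bound -n for both components,
    integrated along characteristics, improves to -n / 2 up to a fixed exponential weight. Iteration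
    from the crude bound -N0 leaves 0 in the limit. The last hypothesis expresses that the coupling
    between the components is nonnegative. *)
Lemma pos_cone (A dA : bool -> R -> R -> R) (X S t0 K K2 N0 : R) :
  0 <= K -> 0 < K2 -> 0 <= N0 ->
  (forall b z s, t0 <= s <= S -> Rabs (z - sgn b * s - X) <= S - s ->
     is_derive (fun s => A b (z - sgn b * s) s) s (dA b (z - sgn b * s) s)) ->
  (forall b y s, t0 <= s <= S -> Rabs (y - X) <= S - s -> - N0 <= A b y s) ->
  (forall b y, Rabs (y - X) <= S - t0 -> 0 <= A b y t0) ->
  (forall b y s n, t0 <= s <= S -> Rabs (y - X) <= S - s -> 0 <= n -> (forall b, - n <= A b y s) ->
     - (K2 * n) <= dA b y s + K * A b y s) ->
  forall b y s, t0 <= s <= S -> Rabs (y - X) <= S - s -> 0 <= A b y s.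
Proof.
  intros HK HK2 HN0 DA HN Hb Hi.
  assert (G : forall k b y s, t0 <= s <= S -> Rabs (y - X) <= S - s ->
     - (N0 * (/ 2) ^ k * exp (2 * K2 * (s - t0))) <= A b y s).
  { induction k as [|k IH]; intros b y s Hs Hy.
    - simpl. rewrite Rmult_1_r. specialize (HN b y s Hs Hy).
      assert (1 <= exp (2 * K2 * (s - t0))).
      { generalize (exp_ineq1_le (2 * K2 * (s - t0))). intros. assert (0 <= 2 * K2 * (s - t0)) by (apply Rmult_le_pos; lra). lra. }
      nra.
    - assert (Hn : 0 <= N0 * (/ 2) ^ k) by (apply Rmult_le_pos; auto; apply Rlt_le, half_pow_pos).
      replace (N0 * (/ 2) ^ Datatypes.S k) with (N0 * (/ 2) ^ k / 2) by (simpl; field).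
      assert (Q : forall r, t0 <= r <= s -> Rabs (y + sgn b * s - sgn b * r - X) <= S - r) by (intros; now apply sgn_path_cone).
      replace (A b y s) with (A b (y + sgn b * s - sgn b * s) s) by (f_equal; ring).
      apply (pos_char (fun r => A b (y + sgn b * s - sgn b * r) r) (fun r => dA b (y + sgn b * s - sgn b * r) r) t0 s K K2 (N0 * (/ 2) ^ k)); auto; try lra.
      + intros r Hr. apply DA; auto. lra.
      + intros r Hr. apply Hi; auto. lra. apply Rmult_le_pos; auto. apply Rlt_le, exp_pos.
        intros b'. apply IH; auto. lra.
      + apply Hb. apply Q. lra. }
  intros b y s Hs Hy. apply Rnot_lt_le. intros Hv.
  destruct (half_pow_small (N0 * exp (2 * K2 * (s - t0))) (- A b y s) ltac:(lra)) as [k Hk].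
  specialize (Hk k (le_n _)). specialize (G k b y s Hs Hy). lra.
Qed.

Section BlowUp.

Variable d : data.

(** Finiteness of the exact solution, expressed through truncations: if a level is not exceeded at
    (x, t), it is not exceeded in the backward cone either, and [sol M] is the exact solution there.
    [fin_iff] makes the link with the iterates. *)
Definition fin (x t : R) : Prop := exists M, gam d <= M /\ solU d M x t <= M.

Lemma solU_agree M M' x t : gam d <= M -> M <= M' -> 0 <= t -> solU d M x t <= M -> solU d M' x t = solU d M x t.
Proof.
  intros HM HMM Ht Hu. unfold solU.
  rewrite !(sol_agree d M M' _ x t x t); auto; rewrite !Rminus_diag, Rabs_R0; lra.
Qed.

Lemma fin_strict x t M0 : 0 <= t -> fin x t -> exists M, gam d <= M /\ M0 <= M /\ solU d M x t < M.
Proof.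
  intros Ht [M [HM Hu]]. exists (Rmax M0 (M + 1)).
  assert (m1 := Rmax_l M0 (M + 1)). assert (m2 := Rmax_r M0 (M + 1)).
  rewrite (solU_agree M) by (auto; lra). repeat split; lra.
Qed.

Lemma fin_cone x t y s : 0 <= s <= t -> Rabs (y - x) <= slope d * (t - s) -> fin x t -> fin y s.
Proof.
  intros Hs Hy [M [HM Hu]]. exists M. split; auto.
  apply Rle_trans with (2 := Hu). now apply solU_cone.
Qed.

Lemma fin_0 x : fin x 0.
Proof.
  exists (ini d true x + ini d false x). split.
  - unfold gam. generalize (ini_low d true x) (ini_low d false x). lra.
  - rewrite solU_0. lra. unfold gam. generalize (ini_low d true x) (ini_low d false x). lra.
Qed.

Lemma solU_time_cont M x t : gam d <= M -> continuity_pt (fun s => solU d M x s) t.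
Proof.
  intros HM. apply continuity_pt_filterlim.
  change (continuous (fun s => solU d M x s) t).
  apply (continuous_ext_fun (fun s => solU d M (x + 0 * s) (0 + 1 * s)) (fun s => solU d M x s)).
  intros u; f_equal; ring. apply cont2_line. now apply cont2_solU.
Qed.

Lemma fin_open x t : 0 <= t -> fin x t -> exists e, 0 < e /\ fin x (t + e).
Proof.
  intros Ht Hf. destruct (fin_strict x t 0 Ht Hf) as (M & HM & _ & Hu).
  destruct (proj1 (continuity_pt_locally _ _) (solU_time_cont M x t HM) (mkposreal (M - solU d M x t) ltac:(lra))) as [e He].
  assert (E0 := cond_pos e).
  exists (e / 2). split. lra. exists M. split; auto.
  specialize (He (t + e / 2)).
  assert (B : ball t e (t + e / 2)).
  { unfold ball; simpl. unfold AbsRing_ball, abs, minus, plus, opp; simpl.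
    replace (t + e / 2 + - t) with (e / 2) by ring. rewrite Rabs_pos_eq; lra. }
  specialize (He B). simpl in He. apply Rabs_lt_between in He. lra.
Qed.

Lemma solU_M_mono M M' x t : gam d <= M -> M <= M' -> 0 <= t -> solU d M x t <= solU d M' x t.
Proof.
  intros HM HMM Ht. assert (HM' : gam d <= M') by lra.
  assert (G := fun b => lim_le _ _ _ _ (fun n => it_M_mono d M M' n HM HMM b x t Ht) (sol_lim d M HM b x t) (sol_lim d M' HM' b x t)).
  apply Rplus_le_compat; apply G.
Qed.

Lemma Rpower_lt_neg a b q : 0 < q -> 0 < a < b -> Rpower b (- q) < Rpower a (- q).
Proof.
  intros Hq Hab. rewrite !Rpower_Ropp. apply Rinv_lt_contravar.
  apply Rmult_lt_0_compat; apply Rpower_pos. apply Rlt_Rpower_l; lra.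
Qed.

(** Comparison with the space-independent solution whose damping is frozen at time 0, where it is
    strongest: W' = 2^(1-p) W^p - mu W, W(0) = gam. For this Bernoulli equation Z = W^(1-p) equals a
    - b exp ((p-1) mu s), which vanishes exactly at [T1]. *)
Lemma fin_lt_T1 x t : 0 <= t -> fin x t -> t < T1 (pwr d) (damp d) (low d true) (low d false).
Proof.
  intros Ht [M [HM Hu]].
  assert (Hp' := pwr_gt1 d). assert (Hm := damp_pos d). assert (Hg := gam_pos d).
  set (q := pwr d - 1). assert (Hq : 0 < q) by (unfold q; lra).
  set (a := Rpower 2 (1 - pwr d) / damp d). set (y0 := Rpower (gam d) (- q)). set (b := a - y0).
  set (M1 := M + 1). set (y1 := Rpower M1 (- q)).
  assert (HM1 : gam d < M1) by (unfold M1; lra).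
  assert (Hy1 : 0 < y1 < y0) by (split; [apply Rpower_pos | apply Rpower_lt_neg; lra]).
  assert (Ha : a = 2 * cp d / damp d).
  { unfold a, cp. replace (1 - pwr d) with (1 + - pwr d) by ring. rewrite Rpower_plus, Rpower_1 by lra. reflexivity. }
  assert (Hb : 0 < b).
  { unfold b, y0. rewrite Ha, Rpower_Ropp. assert (G := gam_large d). fold q in G. fold (cp d) in G.
    assert (X := Rpower_pos (gam d) q). assert (C := cp_pos d).
    assert (/ Rpower (gam d) q <= cp d / damp d).
    { apply Rmult_le_reg_r with (Rpower (gam d) q * damp d). nra.
      replace (/ Rpower (gam d) q * (Rpower (gam d) q * damp d)) with (damp d) by (field; lra).
      replace (cp d / damp d * (Rpower (gam d) q * damp d)) with (cp d * Rpower (gam d) q) by (field; lra). exact G. }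
    assert (0 < cp d / damp d) by (apply Rdiv_lt_0_compat; auto).
    replace (2 * cp d / damp d) with (cp d / damp d + cp d / damp d) by (field; lra). lra. }
  set (k := q * damp d). assert (Hk : 0 < k) by (unfold k; nra).
  (* The time at which W reaches M + 1. It precedes [T1], and finiteness at level [M] at a later
     time contradicts u >= W there. *)
  set (s1 := / k * ln ((a - y1) / b)).
  assert (Hr : 1 < (a - y1) / b).
  { apply Rmult_lt_reg_r with b; auto. unfold Rdiv. rewrite Rmult_assoc, Rinv_l by lra. unfold b. lra. }
  assert (Hs1 : 0 < s1).
  { unfold s1. apply Rmult_lt_0_compat. now apply Rinv_0_lt_compat. rewrite <- ln_1. apply ln_increasing; lra. }
  assert (HT1 : s1 < T1 (pwr d) (damp d) (low d true) (low d false)).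
  { unfold T1. fold a. replace (1 - pwr d) with (- q) by (unfold q; ring). fold (gam d). fold y0. fold b. fold q. fold k.
    unfold s1. apply Rmult_lt_compat_l. now apply Rinv_0_lt_compat. apply ln_increasing. lra.
    apply Rmult_lt_compat_r. now apply Rinv_0_lt_compat. lra. }
  destruct (Rlt_le_dec t s1) as [|Hts]; [lra|]. exfalso.
  set (Z := fun s => a - b * exp (k * s)).
  set (W := fun s => Rpower (Z s) (- / q)).
  assert (Es1 : Z s1 = y1).
  { unfold Z, s1. replace (k * (/ k * ln ((a - y1) / b))) with (ln ((a - y1) / b)) by (field; lra).
    rewrite exp_ln by lra. field. lra. }
  assert (E0 : Z 0 = y0) by (unfold Z, b; rewrite Rmult_0_r, exp_0; ring).
  assert (Zr : forall s, 0 <= s <= s1 -> y1 <= Z s <= y0).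
  { intros s Hs. rewrite <- Es1, <- E0. unfold Z.
    assert (Me : forall u v, u <= v -> exp (k * u) <= exp (k * v)).
    { intros u v Huv. destruct (Req_dec u v) as [->|]; [lra|]. apply Rlt_le, exp_increasing. nra. }
    assert (m1 := Me s s1 ltac:(lra)). assert (m2 := Me 0 s ltac:(lra)). nra. }
  assert (PW : forall u, 0 < u -> Rpower (Rpower u (- q)) (- / q) = u).
  { intros u Hu0. rewrite Rpower_mult. replace (- q * - / q) with 1 by (field; lra). now apply Rpower_1. }
  assert (Wr : forall s, 0 <= s <= s1 -> gam d <= W s <= M1).
  { intros s Hs. specialize (Zr s Hs). unfold W.
    assert (D : forall u v, 0 < u <= v -> Rpower v (- / q) <= Rpower u (- / q)).
    { intros u v Huv. destruct (Req_dec u v) as [->|]; [lra|].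
      apply Rlt_le, Rpower_lt_neg; [now apply Rinv_0_lt_compat | lra]. }
    split.
    - rewrite <- (PW (gam d)) by auto. fold y0. apply D. lra.
    - rewrite <- (PW M1) by lra. fold y1. apply D. lra. }
  assert (HM1' : gam d <= M1) by lra.
  assert (DW : forall s, 0 <= s <= s1 -> is_derive W s (2 * nl d M1 (W s) 0)).
  { intros s Hs. assert (Zs := Zr s Hs). assert (Ws := Wr s Hs).
    assert (DZ : is_derive Z s (- (b * (k * exp (k * s))))) by (unfold Z; auto_derive; auto; ring).
    assert (D := is_derive_comp (fun z => Rpower z (- / q)) Z s _ _ (is_derive_Rpower (Z s) (- / q) ltac:(lra)) DZ).
    derive_eq D.
    unfold scal; simpl. unfold mult; simpl.
    unfold nl. rewrite tnl_eq by (auto; lra). unfold nonlin, abs_pow.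
    destruct (Req_EM_T (W s) 0); [lra|]. rewrite Rabs_pos_eq by lra. fold (cp d).
    assert (Q1 : Rpower (Z s) (- / q - 1) = Rpower (W s) (pwr d)).
    { unfold W. rewrite Rpower_mult. f_equal. replace (pwr d) with (q + 1) by (unfold q; ring). field. lra. }
    assert (Q2 : W s = Z s * Rpower (W s) (pwr d)).
    { rewrite <- Q1. unfold W. apply Rpower_split. lra. }
    rewrite Q1. clear Q1. remember (Rpower (W s) (pwr d)) as Xw. rewrite Q2.
    assert (Q3 : b * exp (k * s) = a - Z s) by (unfold Z; ring).
    replace (- (b * (k * exp (k * s)))) with (- (k * (b * exp (k * s)))) by ring. rewrite Q3, Ha.
    unfold k. field. lra. }
  assert (DA : forall i z s, is_derive (fun s => sol d M1 i (z - sgn i * s) s) s (solN d M1 (z - sgn i * s) s)).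
  { intros i z s. assert (D := sol_line d M1 HM1' i z 0 (- sgn i) 1 s).
    replace (z + - sgn i * s) with (z - sgn i * s) in D by ring. rewrite Rplus_0_l, Rmult_1_l in D.
    apply (is_derive_ext (fun s => sol d M1 i (z + - sgn i * s) (0 + 1 * s))). intros r. f_equal; ring.
    derive_eq D. unfold tau. Rring. }
  assert (HK := tnlK_pos (pwr d) M1 Hp').
  assert (W0 : W 0 = gam d) by (unfold W; rewrite E0; apply PW; auto).
  assert (DW2 : forall c s, 0 <= s <= s1 -> is_derive (fun s => c + (W s - gam d) / 2) s (nl d M1 (W s) 0)).
  { intros c s Hs. assert (D := DW s Hs). set (w' := nl d M1 (W s) 0) in *.
    apply (is_derive_ext (fun s => (c - gam d / 2) + / 2 * W s)). intros r. cbv beta. Rfield.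
    derive_eq (is_derive_plus _ _ _ _ _ (is_derive_cst (c - gam d / 2) s) (is_derive_scal W s (/ 2) _ D)).
    unfold plus, scal; simpl. unfold mult; simpl. field. }
  (* Each component dominates its own lower bound plus half of the growth of W; the two inequalities
     add up to u >= W. *)
  assert (C : forall i, 0 <= sol d M1 i x s1 - (low d i + (W s1 - gam d) / 2)).
  { intros i. apply (pos_cone (fun i y s => sol d M1 i y s - (low d i + (W s - gam d) / 2))
      (fun _ y s => solN d M1 y s - nl d M1 (W s) 0) x s1 0 0 (2 * tnlK (pwr d) M1) ((M1 - gam d) / 2)
      (Rle_refl 0) ltac:(lra) ltac:(lra)); try lra.
    - intros j z s Hs _. apply (is_derive_minus (fun s => sol d M1 j (z - sgn j * s) s) (fun s => low d j + (W s - gam d) / 2)); auto.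
    - intros j y s Hs _. generalize (sol_low d M1 HM1' j y s (proj1 Hs)) (Wr s Hs). lra.
    - intros j y _. rewrite W0. generalize (sol_low d M1 HM1' j y 0 (Rle_refl 0)). lra.
    (* Each component may fall short by n, hence u by 2 n: this is the origin of the constant
       [2 * tnlK]. *)
    - intros j y s n Hs _ Hn HA. rewrite Rmult_0_l, Rplus_0_r. assert (HAt := HA true). assert (HAf := HA false).
      assert (W s - 2 * n <= solU d M1 y s) by (unfold solU, gam in *; lra).
      assert (nl d M1 (W s - 2 * n) s <= solN d M1 y s) by (apply nl_mono; auto).
      assert (nl d M1 (W s) 0 <= nl d M1 (W s) s) by (apply nl_time; specialize (Wr s Hs); lra).
      assert (L := N_lip (nl d M1) (dnl d M1) (tnlK (pwr d) M1) (nl_derive d M1 HM1') (dnl_bound d M1 HM1') (W s) (W s - 2 * n) s).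
      replace (W s - (W s - 2 * n)) with (2 * n) in L by ring. rewrite (Rabs_pos_eq (2 * n)) in L by lra.
      apply Rabs_le_between in L. lra.
    - rewrite !Rminus_diag, Rabs_R0. lra. }
  assert (Ct := C true). assert (Cf := C false).
  assert (W s1 = M1) by (unfold W; rewrite Es1; apply PW; lra).
  assert (solU d M1 x s1 <= M).
  { apply Rle_trans with (solU d M1 x t). apply solU_time; auto. lra.
    rewrite (solU_agree M); auto. unfold M1; lra. }
  unfold solU, gam, M1 in *. lra.
Qed.

Definition lifespan (x : R) : R := real (Lub_Rbar (fun t => 0 <= t /\ fin x t)).

Lemma lifespan_lub x : is_lub_Rbar (fun t => 0 <= t /\ fin x t) (lifespan x).
Proof.
  assert (H := Lub_Rbar_correct (fun t => 0 <= t /\ fin x t)).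
  unfold lifespan. destruct (Lub_Rbar _) as [r| |] eqn:E; auto; exfalso; destruct H as [H1 H2].
  - specialize (H2 (T1 (pwr d) (damp d) (low d true) (low d false)) ltac:(intros t [Ht Hf]; apply Rlt_le, fin_lt_T1 with x; auto)). exact H2.
  - exact (H1 0 (conj (Rle_refl 0) (fin_0 x))).
Qed.

Lemma lifespan_ub x t : 0 <= t -> fin x t -> t < lifespan x.
Proof.
  intros Ht Hf. destruct (fin_open x t Ht Hf) as [e [He Hfe]].
  assert (H : Rbar_le (t + e) (lifespan x)) by (apply (proj1 (lifespan_lub x)); split; [lra | auto]). simpl in H. lra.
Qed.

Lemma lifespan_fin x t : 0 <= t < lifespan x -> fin x t.
Proof.
  intros Ht. apply Classical_Prop.NNPP. intros Hn.
  assert (H := proj2 (lifespan_lub x) t). simpl in H.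
  assert (lifespan x <= t); [|lra]. apply H. intros s [Hs Hf]. simpl.
  destruct (Rle_dec s t) as [|Hst]; auto. exfalso. apply Hn. apply (fin_cone x s); auto. lra.
  rewrite Rminus_diag, Rabs_R0. apply Rmult_le_pos. generalize (slope_gt1 d); lra. lra.
Qed.

Lemma lifespan_pos x : 0 < lifespan x.
Proof. apply lifespan_ub. lra. apply fin_0. Qed.

Lemma lifespan_le_T1 x : lifespan x <= T1 (pwr d) (damp d) (low d true) (low d false).
Proof.
  assert (H := proj2 (lifespan_lub x) (T1 (pwr d) (damp d) (low d true) (low d false))). apply H.
  intros t [Ht Hf]. apply Rlt_le, fin_lt_T1 with x; auto.
Qed.

(** Otherwise a point above x, still before its blow-up, would have (y, lifespan y) in its backward
    cone of aperture [slope], making u finite there, whereas finiteness is an open condition in time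
    and fails at the supremum. *)
Lemma lifespan_lip_aux x y : lifespan x - lam d * Rabs (y - x) <= lifespan y.
Proof.
  assert (HL := lam_range d). assert (HS := slope_gt1 d). assert (A := Rabs_pos (y - x)).
  destruct (Rle_dec (lifespan x - lam d * Rabs (y - x)) (lifespan y)) as [|Hn]; auto. exfalso.
  assert (Ty := lifespan_pos y).
  set (s := lifespan y). set (t := s + lam d * Rabs (y - x)).
  assert (Ht : 0 <= t < lifespan x). { unfold t, s. assert (0 <= lam d * Rabs (y - x)) by (apply Rmult_le_pos; lra). lra. }
  assert (F := lifespan_fin x t Ht).
  assert (s < lifespan y); [|unfold s in *; lra].
  apply lifespan_ub. unfold s; lra. apply (fin_cone x t); auto.
  - unfold t, s. assert (0 <= lam d * Rabs (y - x)) by (apply Rmult_le_pos; lra). lra.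
  - unfold t. replace (s + lam d * Rabs (y - x) - s) with (lam d * Rabs (y - x)) by ring.
    unfold lam. rewrite <- Rmult_assoc, Rinv_r by lra. lra.
Qed.

Lemma lifespan_lip x y : Rabs (lifespan y - lifespan x) <= lam d * Rabs (y - x).
Proof.
  assert (H1 := lifespan_lip_aux x y). assert (H2 := lifespan_lip_aux y x). rewrite (Rabs_minus_sym x y) in H2.
  apply Rabs_le_between. lra.
Qed.

(** The variable in which blow-up is linear. The time derivative of u lies between 2 N / (1 + lam)
    and 2 N / (1 - lam), and N between cp u^p / 2 and cp u^p, so u^(1-p) decreases at a rate between
    [zlo] and [zhi]. *)
Definition upow (M x t : R) : R := Rpower (solU d M x t) (1 - pwr d).
Definition zlo : R := (pwr d - 1) * (cp d / (1 + lam d)).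
Definition zhi : R := (pwr d - 1) * (2 * cp d / (1 - lam d)).

Lemma zlo_pos : 0 < zlo.
Proof.
  unfold zlo. generalize (pwr_gt1 d) (cp_pos d) (lam_range d). intros.
  apply Rmult_lt_0_compat. lra. apply Rdiv_lt_0_compat; lra.
Qed.
Lemma zhi_pos : 0 < zhi.
Proof.
  unfold zhi. generalize (pwr_gt1 d) (cp_pos d) (lam_range d). intros.
  apply Rmult_lt_0_compat. lra. apply Rdiv_lt_0_compat; lra.
Qed.

Lemma upow_step M x t t' : gam d <= M -> 0 <= t <= t' -> solU d M x t' <= M ->
  zlo * (t' - t) <= upow M x t - upow M x t' <= zhi * (t' - t).
Proof.
  intros HM Ht Hu. assert (Hp' := pwr_gt1 d). assert (Hg := gam_pos d). assert (C := cp_pos d). assert (HL := lam_range d).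
  assert (HU : forall s, t <= s <= t' -> gam d <= solU d M x s <= M).
  { intros s Hs. split. apply solU_low; auto; lra. apply Rle_trans with (2 := Hu). apply solU_time; auto. lra. }
  set (dz := fun s => (1 - pwr d) * Rpower (solU d M x s) (- pwr d) * (tau d M true x s + tau d M false x s)).
  assert (D : forall s, t <= s <= t' -> is_derive (fun s => upow M x s) s (dz s)).
  { intros s Hs. specialize (HU s Hs).
    assert (D1 := solU_line d M HM x 0 0 1 s ltac:(lra)).
    rewrite !Rmult_0_l, !Rplus_0_l, !Rplus_0_r, !Rmult_1_l in D1.
    assert (D2 : is_derive (fun s => solU d M x s) s (tau d M true x s + tau d M false x s)).
    { apply (is_derive_ext (fun s => solU d M (x + 0 * s) (0 + 1 * s))). intros r; f_equal; ring. exact D1. }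
    assert (D3 := is_derive_comp (fun u => Rpower u (1 - pwr d)) (fun s => solU d M x s) s _ _ (is_derive_Rpower (solU d M x s) (1 - pwr d) ltac:(lra)) D2).
    derive_eq D3. unfold dz, scal; simpl. unfold mult; simpl.
    replace (1 - pwr d - 1) with (- pwr d) by ring. ring. }
  assert (B : forall s, t <= s <= t' -> zlo <= - dz s <= zhi).
  { intros s Hs. specialize (HU s Hs). unfold dz.
    destruct (tau_bounds d M HM true x s ltac:(lra)) as [_ [a1 a2]]. destruct (tau_bounds d M HM false x s ltac:(lra)) as [_ [b1 b2]].
    assert (n1 := nl_lower d M (solU d M x s) s HU). assert (n2 := nl_upper d M HM (solU d M x s) s (proj1 HU)).
    fold (solN d M x s) in n1, n2.
    rewrite Rpower_Ropp. set (y := Rpower (solU d M x s) (pwr d)) in *.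
    assert (Y : 0 < y) by apply Rpower_pos.
    set (n := solN d M x s) in *. set (T := tau d M true x s + tau d M false x s).
    assert (T1 : n * (2 / (1 + lam d)) <= T).
    { unfold T. replace (n * (2 / (1 + lam d))) with (n / (1 + lam d) + n / (1 + lam d)) by (field; lra). lra. }
    assert (T2 : T <= n * (2 / (1 - lam d))).
    { unfold T. replace (n * (2 / (1 - lam d))) with (n / (1 - lam d) + n / (1 - lam d)) by (field; lra). lra. }
    assert (i1 : 0 < 2 / (1 + lam d)) by (apply Rdiv_lt_0_compat; lra).
    assert (i2 : 0 < 2 / (1 - lam d)) by (apply Rdiv_lt_0_compat; lra).
    assert (E : - ((1 - pwr d) * / y * T) = (pwr d - 1) * (T / y)) by (field; lra).
    rewrite E. unfold zlo, zhi. split; apply Rmult_le_compat_l; try lra; apply Rmult_le_reg_r with y; auto;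
      (replace (T / y * y) with T by (field; lra)).
    - apply Rle_trans with (2 := T1). replace (cp d / (1 + lam d) * y) with (cp d * y / 2 * (2 / (1 + lam d))) by (field; lra).
      apply Rmult_le_compat_r; lra.
    - apply Rle_trans with (1 := T2). replace (2 * cp d / (1 - lam d) * y) with (cp d * y * (2 / (1 - lam d))) by (field; lra).
      apply Rmult_le_compat_r; lra. }
  destruct (MVT_gen (fun s => upow M x s) t t' dz) as [c [Hc E]]; rewrite Rmin_left, Rmax_right in * by lra.
  - intros s Hs. apply D. lra.
  - intros s Hs. apply derivable_continuous_pt. eexists. apply is_derive_Reals, D. lra.
  - specialize (B c Hc). nra.
Qed.

Lemma upow_lower M x t : gam d <= M -> 0 <= t -> solU d M x t <= M -> zlo * (lifespan x - t) <= upow M x t.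
Proof.
  intros HM Ht Hu. assert (Z := zlo_pos).
  assert (HtT : t < lifespan x) by (apply lifespan_ub; auto; exists M; auto).
  destruct (Rle_dec (zlo * (lifespan x - t)) (upow M x t)) as [|Hn]; auto. exfalso.
  (* By time t' a decrease at rate [zlo] would have exhausted [upow], although t' still precedes
     blow-up. *)
  set (t' := t + upow M x t / zlo).
  assert (Zp : 0 < upow M x t) by apply Rpower_pos.
  assert (Q : zlo * (upow M x t / zlo) = upow M x t) by (field; lra).
  assert (Qp : 0 < upow M x t / zlo) by (apply Rdiv_lt_0_compat; auto).
  assert (Ht' : 0 <= t' < lifespan x) by (unfold t'; split; [lra|]; apply Rmult_lt_reg_l with zlo; nra).
  destruct (fin_strict x t' M ltac:(lra) (lifespan_fin x t' Ht')) as (M' & HM' & HMM & Hu').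
  destruct (upow_step M' x t t' HM' ltac:(unfold t'; lra) ltac:(lra)) as [S1 _].
  assert (E : upow M' x t = upow M x t) by (unfold upow; now rewrite (solU_agree M)).
  assert (0 < upow M' x t') by apply Rpower_pos.
  unfold t' in S1. replace (t + upow M x t / zlo - t) with (upow M x t / zlo) in S1 by ring. fold t' in S1. lra.
Qed.

Lemma upow_upper M x t : gam d <= M -> 0 <= t -> solU d M x t <= M -> upow M x t <= zhi * (lifespan x - t).
Proof.
  intros HM Ht Hu. assert (Z := zhi_pos). assert (Hp' := pwr_gt1 d). assert (Hg := gam_pos d).
  assert (HtT : t < lifespan x) by (apply lifespan_ub; auto; exists M; auto).
  destruct (Rle_dec (upow M x t) (zhi * (lifespan x - t))) as [|Hn]; auto. exfalso.
  (* What is left at the lifespan after decreasing at the fastest rate [zhi]. If it is positive, u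
     stays below y^(1/(1-p)) before the lifespan and, by continuity of the truncated solution, also
     at the lifespan itself, which is impossible. *)
  set (y := upow M x t - zhi * (lifespan x - t)). assert (Hy : 0 < y) by (unfold y; lra).
  set (M0 := Rpower y (/ (1 - pwr d))).
  assert (EM0 : Rpower M0 (1 - pwr d) = y).
  { unfold M0. rewrite Rpower_mult, Rinv_l, Rpower_1; auto. lra. }
  assert (HM00 : 0 < M0) by apply Rpower_pos.
  assert (B : forall s, t <= s < lifespan x -> exists M', gam d <= M' /\ M0 <= M' /\ solU d M' x s <= M0).
  { intros s Hs. destruct (fin_strict x s (Rmax M M0) ltac:(lra) (lifespan_fin x s ltac:(lra))) as (M' & HM' & HMM & Hu').
    assert (m1 := Rmax_l M M0). assert (m2 := Rmax_r M M0).
    exists M'. repeat split; auto. lra.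
    destruct (upow_step M' x t s HM' ltac:(lra) ltac:(lra)) as [_ S2].
    assert (E : upow M' x t = upow M x t) by (unfold upow; rewrite (solU_agree M); auto; lra).
    assert (zhi * (s - t) <= zhi * (lifespan x - t)) by (apply Rmult_le_compat_l; lra).
    assert (Q : y <= upow M' x s) by (unfold y; lra).
    destruct (Rle_dec (solU d M' x s) M0) as [|Hc]; auto. exfalso.
    assert (Rpower (solU d M' x s) (- (pwr d - 1)) < Rpower M0 (- (pwr d - 1))) by (apply Rpower_lt_neg; lra).
    replace (- (pwr d - 1)) with (1 - pwr d) in H0 by ring. rewrite EM0 in H0. unfold upow in Q. lra. }
  assert (HgM0 : gam d <= M0).
  { destruct (B t ltac:(lra)) as (M' & HM' & _ & Hu'). apply Rle_trans with (2 := Hu'). now apply solU_low. }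
  assert (B' : forall s, t <= s < lifespan x -> solU d M0 x s <= M0).
  { intros s Hs. destruct (B s Hs) as (M' & HM' & HMM & Hu').
    apply Rle_trans with (2 := Hu'). apply solU_M_mono; auto. lra. }
  assert (Fin : fin x (lifespan x)).
  { exists M0. split; auto. destruct (Rle_dec (solU d M0 x (lifespan x)) M0) as [|Hc]; auto. exfalso.
    destruct (proj1 (continuity_pt_locally _ _) (solU_time_cont M0 x (lifespan x) HgM0) (mkposreal (solU d M0 x (lifespan x) - M0) ltac:(lra))) as [e He].
    assert (E0 := cond_pos e).
    set (s := Rmax t (lifespan x - e / 2)). assert (m1 := Rmax_l t (lifespan x - e / 2)). assert (m2 := Rmax_r t (lifespan x - e / 2)).
    assert (Hs : t <= s < lifespan x). { split; auto. unfold s. apply Rmax_lub_lt; lra. }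
    assert (Bl : ball (lifespan x) e s).
    { unfold ball; simpl. unfold AbsRing_ball, abs, minus, plus, opp; simpl.
      apply Rabs_lt_between. fold s in m2. lra. }
    specialize (He s Bl). simpl in He. specialize (B' s Hs). apply Rabs_lt_between in He. lra. }
  assert (lifespan x < lifespan x); [|lra]. apply lifespan_ub; auto. apply Rlt_le, lifespan_pos.
Qed.

End BlowUp.

(** * Decay of the oscillation *)

(** As y >= 0, the rate k may be raised to q1 in the loss -k y and lowered to q0 in the gain k b;
    the integrating factor exp (q1 (s - a)) does the rest. *)
Lemma relax (y dy k b beta : R -> R) (a e q0 q1 : R) :
  a <= e -> 0 <= q0 ->
  (forall s, a <= s <= e -> is_derive y s (dy s)) ->
  (forall s, a <= s <= e -> k s * (b s - y s) <= dy s) ->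
  (forall s, a <= s <= e -> q0 <= k s <= q1) ->
  (forall s, a <= s <= e -> 0 <= y s) ->
  (forall s, a <= s <= e -> 0 <= beta s <= b s) ->
  (forall s, continuous beta s) ->
  exp (- (q1 * (e - a))) * (y a + q0 * RInt beta a e) <= y e.
Proof.
  intros Hae Hq Hd Hi Hk Hy Hb Hc.
  assert (D : forall s, a <= s <= e -> is_derive (fun s => exp (q1 * (s - a)) * y s - q0 * RInt beta a s) s
     (exp (q1 * (s - a)) * (dy s + q1 * y s) - q0 * beta s)).
  { intros s Hs.
    assert (D1 : is_derive (fun s => exp (q1 * (s - a))) s (q1 * exp (q1 * (s - a)))) by (auto_derive; auto; unfold Rminus; ring).
    assert (D3 := is_derive_minus _ _ _ _ _ (is_derive_mult _ _ s _ _ D1 (Hd s Hs) Rmult_comm) (is_derive_scal _ s q0 _ (is_derive_prim beta a s Hc))).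
    derive_eq D3.
    unfold minus, plus, opp, mult, scal; simpl. unfold mult; simpl. ring. }
  assert (M := mono_derive _ _ a e Hae D). cbv beta in M.
  assert (M' := M ltac:(intros s Hs; specialize (Hi s Hs); specialize (Hk s Hs); specialize (Hy s Hs); specialize (Hb s Hs);
     assert (1 <= exp (q1 * (s - a))) by (generalize (exp_ineq1_le (q1 * (s - a))); assert (0 <= q1 * (s - a)) by (apply Rmult_le_pos; lra); lra);
     assert (q0 * beta s <= dy s + q1 * y s) by nra; assert (0 <= q0 * beta s) by (apply Rmult_le_pos; lra); nra)).
  rewrite RInt_point in M'. change zero with 0 in M'.
  rewrite Rminus_diag, !Rmult_0_r, exp_0, Rminus_0_r, Rmult_1_l in M'.
  rewrite exp_Ropp. assert (X := exp_pos (q1 * (e - a))).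
  apply Rmult_le_reg_l with (1 := X). rewrite <- Rmult_assoc, Rinv_r, Rmult_1_l by lra. lra.
Qed.

(** * Mixing of two coupled nonnegative quantities in a truncated cone *)

Section Mixing.

Variables (A dA k : bool -> R -> R -> R) (x0 t0 sg nu q0 q1 : R).
Hypothesis Hsg : 0 < sg.
Hypothesis Hnu : 1 <= nu <= 5 / 4.
Hypothesis Hq0 : 0 < q0.
Hypothesis Hq1 : 0 <= q1.

(** The cone with apex (x0, t0 + sg), cut off at the last quarter of its height. Since nu >= 1,
    characteristics followed backwards remain inside. *)
Let Rg y s := t0 <= s <= t0 + 3 * sg / 4 /\ Rabs (y - x0) <= nu * (t0 + sg - s).

Hypothesis Apos : forall b y s, Rg y s -> 0 <= A b y s.
Hypothesis DA : forall b z s, Rg (z - sgn b * s) s -> is_derive (fun s => A b (z - sgn b * s) s) s (dA b (z - sgn b * s) s).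
Hypothesis IA : forall b y s, Rg y s -> k b y s * (A (negb b) y s - A b y s) <= dA b y s.
Hypothesis Hk : forall b y s, Rg y s -> q0 / sg <= k b y s <= q1 / sg.
Hypothesis CB : forall y, continuous (fun y => A false y t0) y.

Let J := RInt (fun y => A false y t0) (x0 - sg / 8) (x0 + sg / 8).

Lemma Rg_path b y e r : Rg y e -> t0 <= r <= e -> Rg (y + sgn b * e - sgn b * r) r.
Proof.
  intros [H1 H2] Hr. split; [lra|].
  apply Rle_trans with (nu * (t0 + sg - e) + e - r); [|nra]. apply sgn_path_cone; lra.
Qed.

Lemma q0sg_pos : 0 <= q0 / sg.
Proof. apply Rlt_le, Rdiv_lt_0_compat; auto. Qed.

Lemma relax_char b y a e beta : Rg y e -> t0 <= a <= e ->
  (forall r, a <= r <= e -> 0 <= beta r <= A (negb b) (y + sgn b * e - sgn b * r) r) ->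
  (forall r, continuous beta r) ->
  exp (- q1) * (A b (y + sgn b * e - sgn b * a) a + q0 / sg * RInt beta a e) <= A b y e.
Proof.
  intros Hr Ha Hbeta Hc. assert (Q := q0sg_pos).
  assert (HP : forall r, a <= r <= e -> Rg (y + sgn b * e - sgn b * r) r) by (intros; apply Rg_path; auto; lra).
  assert (R := relax (fun r => A b (y + sgn b * e - sgn b * r) r) (fun r => dA b (y + sgn b * e - sgn b * r) r)
    (fun r => k b (y + sgn b * e - sgn b * r) r) (fun r => A (negb b) (y + sgn b * e - sgn b * r) r) beta
    a e (q0 / sg) (q1 / sg) (proj2 Ha) Q (fun r H => DA b _ r (HP r H)) (fun r H => IA b _ r (HP r H))
    (fun r H => Hk b _ r (HP r H)) (fun r H => Apos b _ r (HP r H)) Hbeta Hc).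
  cbv beta in R. replace (y + sgn b * e - sgn b * e) with y in R by ring.
  apply Rle_trans with (2 := R). apply Rmult_le_compat_r.
  - apply Rplus_le_le_0_compat; [apply Apos, HP; lra|]. apply Rmult_le_pos; auto.
    apply RInt_ge_0; [lra | now apply ex_RInt_cont | intros r H; apply Hbeta; lra].
  - destruct Hr as [Hr _]. assert (q1 / sg * (e - a) <= q1).
    { apply Rle_trans with (q1 / sg * sg); [|right; field; lra]. apply Rmult_le_compat_l; [|lra].
      apply Rmult_le_pos; auto. apply Rlt_le, Rinv_0_lt_compat; auto. }
    destruct (Req_dec (q1 / sg * (e - a)) q1) as [->|]; [lra|]. apply Rlt_le, exp_increasing. lra.
Qed.

Lemma B_transport y s : Rg y s -> exp (- q1) * A false (y - (s - t0)) t0 <= A false y s.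
Proof.
  intros Hr. assert (H1 := proj1 Hr).
  assert (R := relax_char false y t0 s (fun _ => 0) Hr ltac:(lra)
    (fun r H => conj (Rle_refl 0) (Apos true _ _ (Rg_path false y s r Hr H))) (fun r => continuous_const 0 r)).
  rewrite RInt_cst, !Rmult_0_r, Rplus_0_r in R. simpl in R.
  now replace (y + -1 * s - -1 * t0) with (y - (s - t0)) in R by ring.
Qed.

Lemma base_pos a b : x0 - nu * sg <= a -> a <= b -> b <= x0 + nu * sg -> 0 <= RInt (fun y => A false y t0) a b.
Proof.
  intros Ha Hab Hb. apply RInt_ge_0; auto. apply ex_RInt_cont; auto.
  intros y Hy. apply Apos. split. lra. apply Rabs_le_between. lra.
Qed.

Lemma window_pos : 0 <= J.
Proof. apply base_pos; nra. Qed.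

(** A backward characteristic of [true] crosses the characteristics of [false] issued from an
    interval of the base, each of which still carries a fraction exp (-q1) of its initial value.
    Integrating along the former amounts to integrating over the feet of the latter; the feet move
    at speed 2, whence the factor 1/2. *)
Lemma A_mixed z tau : Rg z tau -> t0 + 5 * sg / 8 <= tau ->
  exp (- q1) * (q0 / sg * (exp (- q1) * (/ 2 * J))) <= A true z tau.
Proof.
  intros Hr Htau. assert (H1 := proj1 Hr). assert (H2 := proj2 Hr).
  assert (E1 := exp_pos (- q1)). assert (Q := q0sg_pos).
  assert (Ca : forall r, continuous (fun r => A false (-2 * r + (z + tau + t0)) t0) r).
  { intros r. apply (continuous_comp (fun r => -2 * r + (z + tau + t0)) (fun y => A false y t0)); auto.
    apply (continuous_ext_fun (fun r => (z + tau + t0) + (-2) * r)). intros u; ring. apply continuous_affine. }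
  assert (R := relax_char true z t0 tau (fun r => exp (- q1) * A false (-2 * r + (z + tau + t0)) t0) Hr ltac:(lra)).
  assert (R2 := R ltac:(intros r Hr'; assert (X := Rg_path true z tau r Hr Hr'); assert (Y := B_transport _ _ X); simpl in *;
    replace (z + 1 * tau - 1 * r - (r - t0)) with (-2 * r + (z + tau + t0)) in Y by ring; split; auto;
    apply Rmult_le_pos; [lra|]; apply Apos;
    replace (-2 * r + (z + tau + t0)) with (z + 1 * tau - 1 * r + -1 * r - -1 * t0) by ring; apply (Rg_path false); auto; lra)
    (fun r => continuous_mult (fun _ => exp (- q1)) _ r (continuous_const _ _) (Ca r))). clear R.
  assert (I : exp (- q1) * (/ 2 * J) <= RInt (fun r => exp (- q1) * A false (-2 * r + (z + tau + t0)) t0) t0 tau).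
  { assert (CL := RInt_affine (fun y => A false y t0) (-2) (z + tau + t0) t0 tau CB). cbv beta in CL.
    replace (-2 * t0 + (z + tau + t0)) with (z + (tau - t0)) in CL by ring.
    replace (-2 * tau + (z + tau + t0)) with (z - (tau - t0)) in CL by ring.
    rewrite (RInt_swap_R (fun y => A false y t0)) in CL by auto.
    rewrite RInt_scal_R by auto. apply Rmult_le_compat_l; [lra|].
    enough (J <= RInt (fun y => A false y t0) (z - (tau - t0)) (z + (tau - t0))) by lra.
    (* Above t0 + 5 sg / 8 the bound nu <= 5/4 gives |z - x0| <= 15 sg / 32. The feet fill an
       interval of radius at least 5 sg / 8 around z, which then contains the window of radius sg /
       8 around x0. *)
    assert (Hz : Rabs (z - x0) <= sg / 2) by nra.
    apply Rabs_le_between in Hz. apply Rabs_le_between in H2.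
    rewrite <- (RInt_Chasles (fun y => A false y t0) (z - (tau - t0)) (x0 - sg / 8) (z + (tau - t0))) by (apply ex_RInt_cont; auto).
    rewrite <- (RInt_Chasles (fun y => A false y t0) (x0 - sg / 8) (x0 + sg / 8) (z + (tau - t0))) by (apply ex_RInt_cont; auto).
    fold J. change plus with Rplus.
    assert (P1 := base_pos (z - (tau - t0)) (x0 - sg / 8) ltac:(nra) ltac:(lra) ltac:(nra)).
    assert (P2 := base_pos (x0 + sg / 8) (z + (tau - t0)) ltac:(nra) ltac:(lra) ltac:(nra)).
    lra. }
  apply Rle_trans with (2 := R2). apply Rmult_le_compat_l; [lra|].
  assert (0 <= A true (z + sgn true * tau - sgn true * t0) t0) by (apply Apos, Rg_path; auto; lra).
  apply Rmult_le_compat_l with (r := q0 / sg) in I; auto. lra.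
Qed.

Definition mixrate : R := exp (- q1) * (q0 * (exp (- q1) * / 2)) * Rmin 1 (exp (- q1) * (q0 / 8)).

Lemma mixing b x : Rabs (x - x0) <= nu * (sg / 4) -> mixrate * (J / sg) <= A b x (t0 + 3 * sg / 4).
Proof.
  intros Hx. assert (E1 := exp_pos (- q1)). assert (JP := window_pos).
  assert (J1 : 0 <= J / sg) by (apply Rmult_le_pos; auto; apply Rlt_le, Rinv_0_lt_compat; auto).
  set (c := exp (- q1) * (q0 * (exp (- q1) * / 2))).
  assert (Hc : 0 < c) by (unfold c; repeat apply Rmult_lt_0_compat; lra).
  assert (HA : forall z tau, Rg z tau -> t0 + 5 * sg / 8 <= tau -> c * (J / sg) <= A true z tau).
  { intros z tau H1 H2. apply Rle_trans with (2 := A_mixed z tau H1 H2). right. unfold c. field. lra. }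
  assert (Hr : Rg x (t0 + 3 * sg / 4)) by (split; [lra|]; replace (t0 + sg - (t0 + 3 * sg / 4)) with (sg / 4) by field; auto).
  assert (m1 := Rmin_l 1 (exp (- q1) * (q0 / 8))). assert (m2 := Rmin_r 1 (exp (- q1) * (q0 / 8))).
  unfold mixrate. fold c. set (m := Rmin 1 (exp (- q1) * (q0 / 8))) in *.
  assert (cJ : 0 <= c * (J / sg)) by (apply Rmult_le_pos; lra).
  replace (c * m * (J / sg)) with (m * (c * (J / sg))) by ring.
  destruct b.
  - apply Rle_trans with (2 := HA x _ Hr ltac:(lra)).
    rewrite <- (Rmult_1_l (c * (J / sg))) at 2. apply Rmult_le_compat_r; auto.
  (* [false] collects its share from [true] on the last stretch of its characteristic, of duration 3
     sg / 4 - 5 sg / 8 = sg / 8; this yields the factor q0 / 8. *)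
  - set (e := t0 + 3 * sg / 4) in *. set (a := t0 + 5 * sg / 8).
    assert (Ha : t0 <= a <= e) by (unfold a, e; lra).
    assert (R := relax_char false x a e (fun _ => c * (J / sg)) Hr Ha
      (fun r H => conj cJ (HA _ _ (Rg_path false x e r Hr ltac:(lra)) (proj1 H))) (fun r => continuous_const _ r)).
    assert (P := Apos false _ _ (Rg_path false x e a Hr Ha)).
    rewrite RInt_cst in R. replace (q0 / sg * ((e - a) * (c * (J / sg)))) with (q0 / 8 * (c * (J / sg))) in R by (unfold e, a; field; lra).
    apply Rle_trans with (2 := R).
    apply Rle_trans with (exp (- q1) * (q0 / 8) * (c * (J / sg))). apply Rmult_le_compat_r; auto.
    rewrite Rmult_assoc. apply Rmult_le_compat_l; lra.
Qed.

End Mixing.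

(** * Contraction of the range of the ratios from one scale to the next *)

Section Oscillation.

Variable d : data.

Lemma cont2_slice h t y : cont2 h -> continuous (fun y => h y t) y.
Proof.
  intros H. apply (continuous_ext_fun (fun y => h (0 + 1 * y) (t + 0 * y))).
  intros u; f_equal; ring. now apply cont2_line.
Qed.

(** The strict inequality is an open condition: the two solutions agree at all nearby x, so their
    x-derivatives agree too. *)
Lemma ratio_agree M M' b x t : gam d <= M -> M <= M' -> 0 <= t -> solU d M x t < M ->
  rat d M' b x t = rat d M b x t.
Proof.
  intros HM HMM Ht Hu.
  assert (P : dsol d M' b x t = dsol d M b x t).
  { assert (L : locally x (fun y => solU d M y t < M)) by (apply (cont2_slice _ t x (cont2_solU d M HM) (fun v => v < M)), (open_lt M), Hu).
    apply Derive_ext_loc. apply filter_imp with (2 := L).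
    intros y Hy. apply (sol_agree d M M' b y t y t); auto. lra. rewrite !Rminus_diag, Rabs_R0. lra. }
  assert (N : solN d M' x t = solN d M x t).
  { unfold solN. rewrite (solU_agree d M M' x t) by (auto; lra). apply nl_agree; auto. split. now apply solU_low. lra. }
  unfold rat, tau. now rewrite P, N.
Qed.

(** Quantifying over all admissible levels turns this into a statement about the exact solution,
    vacuous where that is infinite; by [ratio_bnd_intro] one level is enough to prove it. *)
Definition ratio_bnd (m n x t : R) : Prop :=
  forall M, gam d <= M -> solU d M x t < M -> forall b, m <= rat d M b x t <= n.

Lemma ratio_bnd_intro m n x t M : gam d <= M -> 0 <= t -> solU d M x t < M ->
  (forall b, m <= rat d M b x t <= n) -> ratio_bnd m n x t.
Proof.
  intros HM Ht Hu H M' HM' Hu' b.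
  assert (m1 := Rmax_l M M'). assert (m2 := Rmax_r M M').
  rewrite <- (ratio_agree M' (Rmax M M') b x t HM' m2 Ht Hu'), (ratio_agree M (Rmax M M') b x t HM m1 Ht Hu). apply H.
Qed.

Lemma unit_mult_bound th r C : Rabs th <= 1 -> Rabs r <= C -> - C <= th * r <= C.
Proof.
  intros Hth Hr. apply Rabs_le_between. rewrite Rabs_mult. generalize (Rabs_pos th) (Rabs_pos r). nra.
Qed.

Lemma rat_shift_char M th c t0 b z s : gam d <= M -> 0 < s ->
  is_derive (fun s => th * rat d M b (z - sgn b * s) s + c + 2 * (s - t0)) s (th * drat d M b (z - sgn b * s) s + 2).
Proof.
  intros HM Hs.
  apply (is_derive_ext (fun s => plus (th * rat d M b (z - sgn b * s) s) (c + 2 * (s - t0)))).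
  { intros r. unfold plus; simpl. Rring. }
  apply (is_derive_plus (fun s => th * rat d M b (z - sgn b * s) s) (fun s => c + 2 * (s - t0))).
  - apply (is_derive_scal (fun s => rat d M b (z - sgn b * s) s)). now apply rat_char.
  - auto_derive; auto. ring.
Qed.

(* [th] is [1] for lower bounds and [-1] for upper bounds; the term [2 (s - t0)]
   dominates the drift caused by the explicit time dependence of the damping. *)
Lemma drat_shift M th c t0 b y s : gam d <= M -> 0 <= s -> solU d M y s <= M -> Rabs th <= 1 ->
  kr d M b y s * ((th * rat d M (negb b) y s + c + 2 * (s - t0)) - (th * rat d M b y s + c + 2 * (s - t0)))
    <= th * drat d M b y s + 2.
Proof.
  intros HM Hs Hu Hth. assert (G := unit_mult_bound th _ _ Hth (drift_bound d M HM b y s Hs Hu)). unfold drat. lra.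
Qed.

(** The coupling pulls each ratio towards the other and so preserves a common bound, whatever its
    strength: K, which grows without limit with [M], is absent from the conclusion. The estimate can
    thus be carried up to the curve, at the cost of the drift alone. *)
Lemma ratio_pos M X S t0 th c : gam d <= M -> 0 < t0 <= S -> solU d M X S <= M -> Rabs th <= 1 ->
  (forall b y, Rabs (y - X) <= S - t0 -> 0 <= th * rat d M b y t0 + c) ->
  forall b y s, t0 <= s <= S -> Rabs (y - X) <= S - s -> 0 <= th * rat d M b y s + c + 2 * (s - t0).
Proof.
  intros HM Ht Hu Hth Hb.
  set (K := cp d * pwr d * Rpower M (pwr d - 1) / kap d).
  assert (Kp := kap_pos d). assert (HL := lam_range d). assert (Hp' := pwr_gt1 d).
  assert (HK : 0 < K).
  { unfold K. apply Rdiv_lt_0_compat; auto. repeat apply Rmult_lt_0_compat; try lra. apply cp_pos. apply Rpower_pos. }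
  assert (Hgood : forall y s, t0 <= s <= S -> Rabs (y - X) <= S - s -> solU d M y s <= M).
  { intros y s Hs Hy. apply Rle_trans with (2 := Hu). apply solU_cone; auto. lra.
    apply Rle_trans with (1 := Hy). generalize (slope_gt1 d). intros. nra. }
  assert (KB : forall b y s, t0 <= s <= S -> Rabs (y - X) <= S - s -> 0 <= kr d M b y s <= K).
  { intros b y s Hs Hy. assert (G := Hgood y s Hs Hy). assert (Gl := solU_low d M HM y s ltac:(lra)).
    destruct (kr_bounds d M HM b y s ltac:(lra) G) as [a1 a2]. split.
    - apply Rle_trans with (2 := a1). generalize (cp_pos d) (Rpower_pos (solU d M y s) (pwr d - 1)). intros.
      apply Rmult_le_pos; [lra|]. apply Rmult_le_pos; lra.
    - apply Rle_trans with (1 := a2). unfold K, Rdiv. apply Rmult_le_compat_r. apply Rlt_le, Rinv_0_lt_compat; auto.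
      apply Rmult_le_compat_l. apply Rmult_le_pos; [apply Rlt_le, cp_pos | lra].
      apply Rle_Rpower_l. lra. generalize (gam_pos d); lra. }
  assert (Ac := Rabs_pos c). assert (Ac' := Rle_abs (- c)). rewrite Rabs_Ropp in Ac'.
  apply (pos_cone (fun b y s => th * rat d M b y s + c + 2 * (s - t0)) (fun b y s => th * drat d M b y s + 2)
    X S t0 K K (lam d + Rabs c) (Rlt_le _ _ HK) HK ltac:(lra)).
  - intros b z s Hs Hy. apply rat_shift_char; auto. lra.
  - intros b y s Hs Hy. generalize (unit_mult_bound th _ _ Hth (rat_bound d M HM b y s ltac:(lra))). lra.
  - intros b y Hy. rewrite Rminus_diag, Rmult_0_r, Rplus_0_r. auto.
  - intros b y s n Hs Hy Hn H.
    assert (Q := KB b y s Hs Hy). assert (G := drat_shift M th c t0 b y s HM ltac:(lra) (Hgood y s Hs Hy) Hth).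
    assert (H1 := H b). assert (H2 := H (negb b)).
    set (u := th * rat d M b y s + c + 2 * (s - t0)) in *. set (v := th * rat d M (negb b) y s + c + 2 * (s - t0)) in *.
    set (w := kr d M b y s) in *. assert (0 <= w * (v + n)) by (apply Rmult_le_pos; lra).
    assert (0 <= (K - w) * (u + n)) by (apply Rmult_le_pos; lra). lra.
Qed.

(** A width strictly between 1 and [slope]. Above 1, it leaves room for the light cones of points
    near x0; below [slope], it keeps the time left in the truncated cone of order sg and u bounded
    there. The cap 5/4 is the geometric requirement of the mixing argument. *)
Definition nu : R := Rmin (5 / 4) ((1 + slope d) / 2).

Lemma nu_range : 1 < nu <= 5 / 4 /\ nu < slope d /\ lam d * nu < 1.
Proof.
  assert (HS := slope_gt1 d). unfold nu. assert (m1 := Rmin_l (5 / 4) ((1 + slope d) / 2)). assert (m2 := Rmin_r (5 / 4) ((1 + slope d) / 2)).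
  assert (1 < Rmin (5 / 4) ((1 + slope d) / 2)) by (apply Rmin_glb_lt; lra).
  repeat split; try lra. unfold lam. apply Rmult_lt_reg_l with (slope d). lra.
  rewrite <- Rmult_assoc, Rinv_r by lra. lra.
Qed.

(** In the truncated cone the time left lies between (1 - lam nu) sg / 4 and 2 sg. The bounds on
    [upow] then give u^(p-1) up to constants over sg, and [kr_bounds] gives the coupling. The
    minimum with 1 only serves to make [mixd] at most 1. *)
Definition rate0 : R := Rmin 1 (kap d * (cp d / 2) * / (zhi d * 2)).
Definition rate1 : R := cp d * pwr d / kap d * (4 / (zlo d * (1 - lam d * nu))).
Definition mixd : R := mixrate rate0 rate1.

Lemma rate0_pos : 0 < rate0.
Proof.
  unfold rate0. apply Rmin_pos. lra. generalize (kap_pos d) (cp_pos d) (zhi_pos d). intros.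
  apply Rmult_lt_0_compat. apply Rmult_lt_0_compat; lra. apply Rinv_0_lt_compat. lra.
Qed.

Lemma rate1_pos : 0 < rate1.
Proof.
  unfold rate1. generalize (kap_pos d) (cp_pos d) (zlo_pos d) (pwr_gt1 d). intros. destruct nu_range as (_ & _ & N).
  apply Rmult_lt_0_compat; apply Rdiv_lt_0_compat; try lra; apply Rmult_lt_0_compat; lra.
Qed.

Lemma mixd_range : 0 < mixd <= 1.
Proof.
  unfold mixd, mixrate. assert (r0 := rate0_pos). assert (r1 := rate1_pos).
  assert (E := exp_pos (- rate1)). assert (E1 : exp (- rate1) <= 1).
  { rewrite <- exp_0. apply Rlt_le, exp_increasing. lra. }
  assert (R1 : rate0 <= 1) by apply Rmin_l.
  assert (0 < Rmin 1 (exp (- rate1) * (rate0 / 8)) <= 1).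
  { split; [|apply Rmin_l]. apply Rmin_pos. lra. apply Rmult_lt_0_compat; lra. }
  assert (0 < exp (- rate1) * (rate0 * (exp (- rate1) * / 2)) <= 1).
  { split. repeat apply Rmult_lt_0_compat; lra.
    assert (0 < rate0 * (exp (- rate1) * / 2) <= 1).
    { split. repeat apply Rmult_lt_0_compat; lra. assert (0 < exp (- rate1) * / 2 <= 1) by lra. nra. }
    nra. }
  split. apply Rmult_lt_0_compat; lra. nra.
Qed.

Lemma osc_step x0 sg m n : 0 < sg < lifespan d x0 ->
  (forall x, Rabs (x - x0) <= nu * sg -> ratio_bnd m n x (lifespan d x0 - sg)) ->
  exists m' n', n' - m' = (1 - mixd / 4) * (n - m) + 3 * sg /\
   forall x, Rabs (x - x0) <= nu * (sg / 4) -> ratio_bnd m' n' x (lifespan d x0 - sg / 4).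
Proof.
  intros Hsg Hb. destruct nu_range as [N1 [N2 N3]]. assert (HS := slope_gt1 d). assert (HL := lam_range d).
  set (T0 := lifespan d x0) in *. set (t0 := T0 - sg) in *.
  (* The cone of aperture [slope] below (x0, tt) has radius nu sg / 4 at time T0 - sg / 4 and
     contains the whole region; nu < slope keeps tt before blow-up. One level [M] therefore serves
     throughout. *)
  set (tt := T0 - sg / 4 + nu / slope d * (sg / 4)).
  assert (Hns : 0 < nu / slope d < 1).
  { split. apply Rdiv_lt_0_compat; lra. apply Rmult_lt_reg_r with (slope d). lra. unfold Rdiv. rewrite Rmult_assoc, Rinv_l; lra. }
  assert (Htt : 0 <= tt < lifespan d x0) by (fold T0; unfold tt; nra).
  destruct (fin_strict d x0 tt 0 (proj1 Htt) (lifespan_fin d x0 tt Htt)) as (M & HM & _ & Hu).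
  set (Rg := fun y s => t0 <= s <= t0 + 3 * sg / 4 /\ Rabs (y - x0) <= nu * (t0 + sg - s)).
  assert (Good : forall y s, Rg y s -> solU d M y s < M).
  { intros y s [Hs Hy]. apply Rle_lt_trans with (2 := Hu). apply solU_cone; auto. unfold tt, t0 in *. nra.
    apply Rle_trans with (1 := Hy). unfold tt, t0 in *.
    replace (slope d * (T0 - sg / 4 + nu / slope d * (sg / 4) - s)) with (slope d * (T0 - sg / 4 - s) + nu * (sg / 4)) by (field; lra).
    nra. }
  assert (Rpos : forall y s, Rg y s -> 0 <= s) by (intros y s [Hs _]; unfold t0 in *; lra).
  assert (KB : forall b y s, Rg y s -> rate0 / sg <= kr d M b y s <= rate1 / sg).
  { intros b y s Hr. assert (G := Good y s Hr). assert (Hs0 := Rpos y s Hr). destruct Hr as [Hs Hy].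
    destruct (kr_bounds d M HM b y s Hs0 ltac:(lra)) as [a1 a2].
    assert (Zl := upow_lower d M y s HM Hs0 ltac:(lra)). assert (Zu := upow_upper d M y s HM Hs0 ltac:(lra)).
    assert (TL := lifespan_lip d x0 y). fold T0 in TL. apply Rabs_le_between in TL.
    assert (zl := zlo_pos d). assert (zh := zhi_pos d).
    set (X := Rpower (solU d M y s) (pwr d - 1)) in *.
    assert (EX : upow d M y s = / X). { unfold upow, X. replace (1 - pwr d) with (- (pwr d - 1)) by ring. apply Rpower_Ropp. }
    assert (HX : 0 < X) by apply Rpower_pos. rewrite EX in Zl, Zu.
    assert (D1 : (1 - lam d * nu) * (sg / 4) <= lifespan d y - s).
    { assert (lam d * Rabs (y - x0) <= lam d * (nu * (t0 + sg - s))) by (apply Rmult_le_compat_l; lra).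
      unfold t0 in *. nra. }
    assert (D2 : lifespan d y - s <= 2 * sg).
    { assert (lam d * Rabs (y - x0) <= lam d * (nu * (t0 + sg - s))) by (apply Rmult_le_compat_l; lra).
      unfold t0 in *. nra. }
    assert (cpp := cp_pos d). assert (kp := kap_pos d). assert (pp := pwr_gt1 d).
    assert (L : / (zhi d * (2 * sg)) <= X).
    { rewrite <- (Rinv_inv X). apply Rinv_le_contravar. now apply Rinv_0_lt_compat.
      apply Rle_trans with (1 := Zu). apply Rmult_le_compat_l; lra. }
    assert (U : X <= / (zlo d * ((1 - lam d * nu) * (sg / 4)))).
    { rewrite <- (Rinv_inv X). apply Rinv_le_contravar.
      apply Rmult_lt_0_compat; [lra|]. apply Rmult_lt_0_compat; lra.
      apply Rle_trans with (2 := Zl). apply Rmult_le_compat_l; lra. }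
    assert (L' : rate0 / sg <= kap d * (cp d / 2 * X)).
    { apply Rle_trans with (kap d * (cp d / 2) * / (zhi d * 2) / sg).
      - apply (Rmult_le_compat_r (/ sg)). apply Rlt_le, Rinv_0_lt_compat; lra. apply Rmin_r.
      - replace (kap d * (cp d / 2) * / (zhi d * 2) / sg) with (kap d * (cp d / 2 * / (zhi d * (2 * sg)))) by (field; lra).
        apply Rmult_le_compat_l; [lra|]. apply Rmult_le_compat_l; lra. }
    assert (U' : cp d * pwr d * X / kap d <= rate1 / sg).
    { apply Rle_trans with (cp d * pwr d * / (zlo d * ((1 - lam d * nu) * (sg / 4))) / kap d).
      - apply Rmult_le_compat_r. apply Rlt_le, Rinv_0_lt_compat; auto. apply Rmult_le_compat_l; auto.
        apply Rmult_le_pos; lra.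
      - right. unfold rate1. field. repeat split; lra. }
    lra. }
  set (Rr := RInt (fun y => rat d M false y t0) (x0 - sg / 8) (x0 + sg / 8)).
  assert (Ht0 : 0 < t0) by (unfold t0; lra).
  assert (Cr : forall y, continuous (fun y => rat d M false y t0) y).
  { intros y. destruct (sol_picard d M HM) as (_ & CP & _).
    destruct (tau_bounds d M HM false y t0 ltac:(lra)) as [T2 _].
    apply (continuous_mult (fun y => dsol d M false y t0) (fun y => / tau d M false y t0)). now apply cont2_slice.
    apply (continuous_comp (fun y => tau d M false y t0) Rinv).
    apply (cont2_slice (fun y t => solN d M y t + -1 * dsol d M false y t)). apply cont2_plus.
    exact (cont2_source d M HM). apply cont2_mult; auto. apply cont2_const.
    apply continuous_Rinv. lra. }
  assert (MIX : forall th c, Rabs th <= 1 ->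
     (forall b y, Rabs (y - x0) <= nu * sg -> 0 <= th * rat d M b y t0 + c) ->
     forall b x, Rabs (x - x0) <= nu * (sg / 4) ->
       mixd * (th * Rr / sg + c / 4) <= th * rat d M b x (T0 - sg / 4) + c + 3 * sg / 2).
  { intros th c Hth Hbase b x Hx.
    assert (POS : forall b y s, Rg y s -> 0 <= th * rat d M b y s + c + 2 * (s - t0)).
    { intros b' y s Hr. assert (G := Good y s Hr). destruct Hr as [Hs Hy].
      apply (ratio_pos M y s t0 th c HM ltac:(lra) ltac:(lra) Hth); try lra.
      - intros b'' w Hw. apply Hbase. replace (w - x0) with ((w - y) + (y - x0)) by ring.
        apply Rle_trans with (1 := Rabs_triang _ _). nra.
      - rewrite !Rminus_diag, Rabs_R0. lra. }
    assert (MX := mixing (fun b y s => th * rat d M b y s + c + 2 * (s - t0)) (fun b y s => th * drat d M b y s + 2)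
      (kr d M) x0 t0 sg nu rate0 rate1 (proj1 Hsg) ltac:(lra) rate0_pos (Rlt_le _ _ rate1_pos) POS
      (fun b z s Hr => rat_shift_char M th c t0 b z s HM ltac:(destruct Hr; lra))
      (fun b y s Hr => drat_shift M th c t0 b y s HM (Rpos y s Hr) (Rlt_le _ _ (Good y s Hr)) Hth) KB).
    cbv beta in MX.
    assert (Cc : forall y, continuous (fun y => th * rat d M false y t0 + c + 2 * (t0 - t0)) y).
    { intros y. apply (continuous_ext_fun (fun y => th * rat d M false y t0 + c)). intros u; ring.
      apply (continuous_plus (fun y => th * rat d M false y t0) (fun _ => c)); [|apply continuous_const].
      apply (continuous_mult (fun _ => th) (fun y => rat d M false y t0)); auto. apply continuous_const. }
    specialize (MX Cc b x Hx).
    assert (EI : RInt (fun y => th * rat d M false y t0 + c + 2 * (t0 - t0)) (x0 - sg / 8) (x0 + sg / 8) = th * Rr + sg / 4 * c).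
    { assert (E1 : is_RInt (fun y => th * rat d M false y t0 + c) (x0 - sg / 8) (x0 + sg / 8) (plus (scal th Rr) (scal (x0 + sg / 8 - (x0 - sg / 8)) c))).
      { apply (is_RInt_plus (fun y => th * rat d M false y t0) (fun _ => c)).
        apply (is_RInt_scal (fun y => rat d M false y t0)). apply (@RInt_correct R_CompleteNormedModule), ex_RInt_cont; auto.
        apply (@is_RInt_const R_NormedModule). }
      rewrite (RInt_ext _ (fun y => th * rat d M false y t0 + c)).
      - rewrite (is_RInt_unique _ _ _ _ E1). unfold plus, scal; simpl. unfold mult; simpl. Rfield.
      - intros y _. Rring. }
    rewrite EI in MX. unfold mixd.
    replace (t0 + 3 * sg / 4) with (T0 - sg / 4) in MX by (unfold t0; field).
    replace ((th * Rr + sg / 4 * c) / sg) with (th * Rr / sg + c / 4) in MX by (field; lra).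
    replace (2 * (T0 - sg / 4 - t0)) with (3 * sg / 2) in MX by (unfold t0; field).
    exact MX. }
  assert (BASE : forall b y, Rabs (y - x0) <= nu * sg -> m <= rat d M b y t0 <= n).
  { intros b y Hy. apply Hb; auto. apply Good. split. lra. replace (t0 + sg - t0) with sg by ring. auto. }
  (* The drift correction is 2 (3 sg / 4) on each side. The window has length sg / 4, so Rr / sg - m
     / 4 and n / 4 - Rr / sg are the masses of the shifted ratios there, and their sum is (n - m) /
     4 whatever Rr is: one of the two bounds always improves. *)
  exists (m - 3 * sg / 2 + mixd * (Rr / sg - m / 4)), (n + 3 * sg / 2 - mixd * (n / 4 - Rr / sg)).
  split. field. lra.
  intros x Hx. apply (ratio_bnd_intro _ _ x (T0 - sg / 4) M HM). lra.
  { apply Good. split. unfold t0; lra. unfold t0. replace (T0 - sg + sg - (T0 - sg / 4)) with (sg / 4) by field. auto. }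
  intros b.
  assert (L := MIX 1 (- m) ltac:(rewrite Rabs_R1; lra) ltac:(intros b' y Hy; generalize (BASE b' y Hy); lra) b x Hx).
  assert (U := MIX (-1) n ltac:(rewrite Rabs_left; lra) ltac:(intros b' y Hy; generalize (BASE b' y Hy); lra) b x Hx).
  replace (mixd * (1 * Rr / sg + - m / 4)) with (mixd * (Rr / sg - m / 4)) in L by (field; lra).
  replace (mixd * (-1 * Rr / sg + n / 4)) with (mixd * (n / 4 - Rr / sg)) in U by (field; lra).
  lra.
Qed.

End Oscillation.

(** * Regularity of the blow-up curve *)

Section Strict.

Variable h : R -> R.

(** Strict differentiability with a slope that may depend on eps, so that no candidate for the
    derivative is needed beforehand: each scale of the oscillation estimate supplies its own
    slope. *)
Definition strict_at (x : R) : Prop := forall eps, 0 < eps -> exists eta l, 0 < eta /\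
  forall a b, Rabs (a - x) < eta -> Rabs (b - x) < eta -> Rabs (h b - h a - l * (b - a)) <= eps * Rabs (b - a).

Lemma derive_near y D l eps eta : is_derive h y D -> 0 < eta ->
  (forall a, Rabs (a - y) < eta -> Rabs (h a - h y - l * (a - y)) <= eps * Rabs (a - y)) -> Rabs (D - l) <= eps.
Proof.
  intros HD Heta H. apply is_derive_Reals in HD.
  destruct (Rle_dec (Rabs (D - l)) eps) as [|Hn]; auto. exfalso.
  destruct (HD (Rabs (D - l) - eps) ltac:(lra)) as [de Hde].
  assert (D0 := cond_pos de). set (k := Rmin de eta / 2).
  assert (m1 := Rmin_l de eta). assert (m2 := Rmin_r de eta). assert (m3 := Rmin_pos _ _ D0 Heta).
  assert (Hk : 0 < k) by (unfold k; lra).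
  assert (Hk1 : k < de /\ k < eta) by (unfold k; lra).
  specialize (Hde k ltac:(lra) ltac:(rewrite Rabs_pos_eq; lra)).
  specialize (H (y + k)). replace (y + k - y) with k in H by ring. rewrite (Rabs_pos_eq k) in H by lra.
  specialize (H ltac:(lra)).
  set (q := (h (y + k) - h y) / k) in *.
  assert (E : h (y + k) - h y - l * k = (q - l) * k) by (unfold q; field; lra).
  rewrite E, Rabs_mult, (Rabs_pos_eq k) in H by lra.
  apply Rmult_le_reg_r in H; auto.
  assert (Rabs (D - l) <= Rabs (q - D) + Rabs (q - l)).
  { replace (D - l) with (- (q - D) + (q - l)) by ring. apply Rle_trans with (1 := Rabs_triang _ _). rewrite Rabs_Ropp. lra. }
  lra.
Qed.

Lemma strict_ex_derive x : strict_at x -> ex_derive h x.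
Proof.
  intros Hs.
  (* Every eps provides one slope within eps of all late difference quotients, so the quotients form
     a Cauchy sequence; its limit is the derivative. *)
  set (q := fun n : nat => (h (x + / (INR n + 1)) - h x) / / (INR n + 1)).
  assert (Q : forall eps, 0 < eps -> exists eta l n0, 0 < eta /\
     (forall a, Rabs (a - x) < eta -> Rabs (h a - h x - l * (a - x)) <= eps * Rabs (a - x)) /\
     forall n, (n0 <= n)%nat -> Rabs (q n - l) <= eps).
  { intros eps He. destruct (Hs eps He) as (eta & l & Heta & H).
    assert (H' : forall a, Rabs (a - x) < eta -> Rabs (h a - h x - l * (a - x)) <= eps * Rabs (a - x)).
    { intros a Ha. apply H; auto. rewrite Rminus_diag, Rabs_R0; auto. }
    destruct (nfloor_ex (/ eta)) as [n0 Hn0]. { apply Rlt_le, Rinv_0_lt_compat; auto. }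
    exists eta, l, n0. repeat split; auto. intros n Hn.
    assert (P : 0 < INR n + 1) by (generalize (pos_INR n); lra).
    assert (Ip : 0 < / (INR n + 1)) by (now apply Rinv_0_lt_compat).
    assert (L : / (INR n + 1) < eta).
    { rewrite <- (Rinv_inv eta). apply Rinv_lt_contravar. apply Rmult_lt_0_compat; auto. now apply Rinv_0_lt_compat.
      apply Rlt_le_trans with (1 := proj2 Hn0). apply Rplus_le_compat_r, le_INR; auto. }
    specialize (H' (x + / (INR n + 1))). replace (x + / (INR n + 1) - x) with (/ (INR n + 1)) in H' by ring.
    rewrite (Rabs_pos_eq (/ (INR n + 1))) in H' by lra. specialize (H' L).
    assert (EQ : h (x + / (INR n + 1)) - h x - l * / (INR n + 1) = (q n - l) * / (INR n + 1)) by (unfold q; field; lra).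
    rewrite EQ, Rabs_mult, (Rabs_pos_eq (/ (INR n + 1))) in H' by lra.
    apply Rmult_le_reg_r with (1 := Ip). exact H'. }
  assert (C : ex_finite_lim_seq q).
  { apply ex_lim_seq_cauchy_corr. intros eps. assert (E0 := cond_pos eps).
    destruct (Q (eps / 3) ltac:(lra)) as (eta & l & n0 & _ & _ & H). exists n0. intros n m Hn Hm.
    replace (q n - q m) with ((q n - l) + - (q m - l)) by ring.
    apply Rle_lt_trans with (1 := Rabs_triang _ _). rewrite Rabs_Ropp. generalize (H n Hn) (H m Hm). lra. }
  destruct C as [D HD]. exists D. apply is_derive_Reals. intros eps He.
  destruct (Q (eps / 3) ltac:(lra)) as (eta & l & n0 & Heta & H1 & H2).
  assert (DL : Rabs (D - l) <= eps / 3).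
  { assert (L1 : is_lim_seq (fun n => Rabs (q (n + n0)%nat - l)) (Rabs (D - l))).
    { apply (is_lim_seq_abs (fun n => q (n + n0)%nat - l) (D - l)). apply is_lim_seq_minus'.
      apply is_lim_seq_incr_n; auto. apply is_lim_seq_const. }
    refine (is_lim_seq_le _ (fun _ => eps / 3) (Rabs (D - l)) (eps / 3) _ L1 (is_lim_seq_const _)).
    intros n. apply H2. lia. }
  exists (mkposreal eta Heta). intros k Hk Hk'. simpl in Hk'.
  specialize (H1 (x + k)). replace (x + k - x) with k in H1 by ring. specialize (H1 Hk').
  replace ((h (x + k) - h x) / k - D) with ((h (x + k) - h x - l * k) / k - (D - l)) by (field; auto).
  assert (P := Rabs_pos_lt k Hk).
  assert (Rabs ((h (x + k) - h x - l * k) / k) <= eps / 3).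
  { unfold Rdiv at 1. rewrite Rabs_mult, Rabs_inv. apply Rmult_le_reg_r with (1 := P).
    rewrite Rmult_assoc, Rinv_l, Rmult_1_r by lra. exact H1. }
  unfold Rminus at 1. apply Rle_lt_trans with (1 := Rabs_triang _ _). rewrite Rabs_Ropp. lra.
Qed.

(** Strictness at x also controls difference quotients based at neighbouring points, so the
    derivatives there all lie within eps / 3 of the same slope. *)
Lemma strict_C1 (P : R -> Prop) (x : R) : (forall y, P y -> strict_at y) -> locally x P ->
  ex_derive h x /\ continuous (Derive h) x.
Proof.
  intros HP HL. assert (Px := locally_singleton _ _ HL). assert (Dx := strict_ex_derive x (HP x Px)).
  split; auto. apply continuity_pt_filterlim, continuity_pt_locally. intros eps. assert (E0 := cond_pos eps).
  destruct (HP x Px (eps / 3) ltac:(lra)) as (eta & l & Heta & H).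
  assert (L2 : locally x (fun y => Rabs (y - x) < eta)) by (exists (mkposreal eta Heta); intros y Hy; exact Hy).
  apply filter_imp with (2 := filter_and _ _ HL L2). intros y [Hy Hye].
  assert (N : forall z, Rabs (z - x) < eta -> P z -> Rabs (Derive h z - l) <= eps / 3).
  { intros z Hz Hz'. assert (Dz := Derive_correct h z (strict_ex_derive z (HP z Hz'))).
    apply (derive_near z _ l (eps / 3) (eta - Rabs (z - x)) Dz). lra.
    intros a Ha. apply H; auto. replace (a - x) with ((a - z) + (z - x)) by ring.
    apply Rle_lt_trans with (1 := Rabs_triang _ _). lra. }
  assert (N1 := N y Hye Hy). assert (N2 := N x ltac:(rewrite Rminus_diag, Rabs_R0; auto) Px).
  replace (Derive h y - Derive h x) with ((Derive h y - l) + - (Derive h x - l)) by ring.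
  apply Rle_lt_trans with (1 := Rabs_triang _ _). rewrite Rabs_Ropp. lra.
Qed.

End Strict.

(** * Limit of the ratios at the curve and slope of the curve *)

Section Regularity.

Variable d : data.

Lemma osc_iter ss n : 0 < ss -> forall x0 s, ss < lifespan d x0 -> 0 < s <= ss * (/ 4) ^ n ->
  exists a b, b - a <= (2 + 24 * ss / mixd d) * (1 - mixd d / 8) ^ n /\
    forall x, Rabs (x - x0) <= nu d * s -> ratio_bnd d a b x (lifespan d x0 - s).
Proof.
  intros Hss. assert (Hm := mixd_range d). assert (HL := lam_range d).
  (* The recursion contracts by 1 - mixd / 4 with forcing 3 (4 s). Settling for the rate q = 1 -
     mixd / 8 leaves a margin C (mixd / 8) q^n, which absorbs the forcing because (1/4)^n <= q^n.
     The summand 2 covers the initial range of width 2 lam. *)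
  set (C := 2 + 24 * ss / mixd d). set (q := 1 - mixd d / 8).
  assert (Hq : 7 / 8 <= q <= 1) by (unfold q; lra).
  assert (HC : C * (mixd d / 8) >= 3 * ss). { unfold C. replace ((2 + 24 * ss / mixd d) * (mixd d / 8)) with (mixd d / 4 + 3 * ss) by (field; lra). lra. }
  assert (C2 : 2 <= C). { unfold C. assert (0 <= 24 * ss / mixd d). { apply Rmult_le_pos. lra. apply Rlt_le, Rinv_0_lt_compat; lra. } lra. }
  assert (P4 : forall k, 0 < (/ 4) ^ k <= 1 /\ (/ 4) ^ k <= q ^ k).
  { intros k. split. split. apply pow_lt; lra. rewrite <- (pow1 k). apply pow_incr; lra. apply pow_incr; lra. }
  induction n as [|n IH]; intros x0 s Hx0 Hs.
  - exists (- lam d), (lam d). split. simpl. lra. intros x Hx M HM Hu b.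
    simpl in Hs. apply Rabs_le_between, rat_bound; auto. lra.
  - destruct (P4 n) as [p1 p2]. simpl in Hs.
    destruct (IH x0 (4 * s) Hx0 ltac:(lra)) as (a & b & Hab & Hb).
    destruct (osc_step d x0 (4 * s) a b ltac:(nra) Hb) as (a' & b' & E & Hb').
    exists a', b'. split.
    + rewrite E. simpl. fold q. fold q in Hab.
      assert (Qn : 0 < q ^ n) by (apply pow_lt; lra).
      assert (12 * s <= 3 * ss * q ^ n) by nra.
      assert (3 * ss * q ^ n <= C * (mixd d / 8) * q ^ n) by (apply Rmult_le_compat_r; lra).
      assert ((1 - mixd d / 4) * (b - a) <= (1 - mixd d / 4) * (C * q ^ n)) by (apply Rmult_le_compat_l; lra).
      replace (C * (q * q ^ n)) with ((1 - mixd d / 4) * (C * q ^ n) + C * (mixd d / 8) * q ^ n) by (unfold q; field). lra.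
    + replace (4 * s / 4) with s in Hb' by field. exact Hb'.
Qed.

(** One sufficiently small scale s below (x0, lifespan x0) suffices: from there [ratio_pos] carries
    the bounds up to the curve over all nearby x, losing 2 (t - t0) <= 4 s <= eps / 2. The centre
    rho may depend on eps. *)
Lemma ratio_limit x0 eps : 0 < eps -> exists eta rho, 0 < eta /\
  (forall x, Rabs (x - x0) < eta -> eta < lifespan d x) /\
  forall x t, Rabs (x - x0) < eta -> 0 <= t < lifespan d x -> lifespan d x - t < eta -> ratio_bnd d (rho - eps) (rho + eps) x t.
Proof.
  intros He. assert (HT := lifespan_pos d x0). assert (HL := lam_range d). destruct (nu_range d) as [N1 _].
  assert (Hm := mixd_range d).
  set (ss := lifespan d x0 / 2).
  assert (HC : 0 < 2 + 24 * ss / mixd d).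
  { assert (0 <= 24 * ss / mixd d). { apply Rmult_le_pos. unfold ss; lra. apply Rlt_le, Rinv_0_lt_compat; lra. } lra. }
  destruct (pow_lt_1_zero (1 - mixd d / 8) ltac:(rewrite Rabs_pos_eq; lra) (eps / 2 / (2 + 24 * ss / mixd d)) ltac:(apply Rdiv_lt_0_compat; lra)) as [n Hn].
  specialize (Hn n (le_n _)). rewrite Rabs_pos_eq in Hn by (apply pow_le; lra).
  assert (P4 : 0 < (/ 4) ^ n <= 1). { split. apply pow_lt; lra. rewrite <- (pow1 n). apply pow_incr; lra. }
  set (s := Rmin (ss * (/ 4) ^ n) (eps / 8)).
  assert (Hs1 : s <= ss * (/ 4) ^ n) by apply Rmin_l. assert (Hs2 : s <= eps / 8) by apply Rmin_r.
  assert (Hs0 : 0 < s) by (unfold s; apply Rmin_pos; [apply Rmult_lt_0_compat; unfold ss; lra | lra]).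
  assert (Hss : s <= ss) by (unfold ss in *; nra).
  destruct (osc_iter ss n ltac:(unfold ss; lra) x0 s ltac:(unfold ss; lra) ltac:(lra)) as (a & b & Hab & Hb).
  assert (Hab' : b - a <= eps / 2).
  { apply Rle_trans with (1 := Hab). apply Rlt_le. apply Rmult_lt_compat_l with (r := 2 + 24 * ss / mixd d) in Hn; auto.
    apply Rlt_le_trans with (1 := Hn). right. field. split; lra. }
  (* The light cone below (x, t) reaches time t0 at distance at most (s + eta) + eta from x0, and
     eta is chosen so that this equals nu s. *)
  set (eta := (nu d - 1) * s / 2).
  assert (Heta : 0 < eta <= s / 8) by (unfold eta; nra).
  exists eta, ((a + b) / 2). split. lra.
  assert (TL : forall x, Rabs (x - x0) < eta -> Rabs (lifespan d x - lifespan d x0) <= eta).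
  { intros x Hx. apply Rle_trans with (1 := lifespan_lip d x0 x). generalize (Rabs_pos (x - x0)). nra. }
  split.
  - intros x Hx. specialize (TL x Hx). apply Rabs_le_between in TL. unfold ss in Hss. lra.
  - intros x t Hx Ht HtT. specialize (TL x Hx). apply Rabs_le_between in TL.
    destruct (fin_strict d x t 0 (proj1 Ht) (lifespan_fin d x t Ht)) as (M & HM & _ & Hu).
    set (t0 := lifespan d x0 - s) in *.
    assert (Ht0 : 0 < t0 <= t) by (unfold t0, ss in *; lra).
    assert (Base : forall i y, Rabs (y - x) <= t - t0 -> a <= rat d M i y t0 <= b).
    { intros i y Hy. apply Hb; auto.
      - replace (y - x0) with ((y - x) + (x - x0)) by ring. apply Rle_trans with (1 := Rabs_triang _ _).
        unfold t0 in *. unfold eta in *. lra.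
      - apply Rle_lt_trans with (2 := Hu). apply solU_cone; auto. lra. apply Rle_trans with (1 := Hy).
        generalize (slope_gt1 d). intros. nra. }
    assert (Cx : Rabs (x - x) <= t - t) by (rewrite !Rminus_diag, Rabs_R0; lra).
    assert (t - t0 <= 2 * s) by (unfold t0 in *; lra).
    apply (ratio_bnd_intro d _ _ x t M HM (proj1 Ht) Hu). intros i.
    assert (L := ratio_pos d M x t t0 1 (- a) HM Ht0 ltac:(lra) ltac:(rewrite Rabs_R1; lra) ltac:(intros j y Hy; generalize (Base j y Hy); lra) i x t ltac:(lra) Cx).
    assert (U := ratio_pos d M x t t0 (-1) b HM Ht0 ltac:(lra) ltac:(rewrite Rabs_left; lra) ltac:(intros j y Hy; generalize (Base j y Hy); lra) i x t ltac:(lra) Cx).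
    lra.
Qed.

(** [upow_lower] bounds u at depth [de] below the curve uniformly in x, so a single level works
    along a whole segment. *)
Lemma uniform_good de : 0 < de -> exists M, gam d <= M /\ forall x t, 0 <= t -> de <= lifespan d x - t -> solU d M x t < M.
Proof.
  intros Hde. assert (Hp' := pwr_gt1 d). assert (Z := zlo_pos d). assert (Hg := gam_pos d).
  set (y := zlo d * de). assert (Hy : 0 < y) by (unfold y; nra).
  set (M0 := Rpower y (/ (1 - pwr d))).
  assert (EM0 : Rpower M0 (1 - pwr d) = y) by (unfold M0; rewrite Rpower_mult, Rinv_l, Rpower_1; auto; lra).
  assert (HM00 : 0 < M0) by apply Rpower_pos.
  assert (G : forall x t, 0 <= t -> de <= lifespan d x - t -> exists M', gam d <= M' /\ Rmax (gam d) M0 + 1 <= M' /\ solU d M' x t <= M0).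
  { intros x t Ht Hd. destruct (fin_strict d x t (Rmax (gam d) M0 + 1) Ht (lifespan_fin d x t ltac:(lra))) as (M' & HM' & HMM & Hu).
    exists M'. repeat split; auto. destruct (Rle_dec (solU d M' x t) M0) as [|Hc]; auto. exfalso.
    assert (Q := upow_lower d M' x t HM' Ht ltac:(lra)).
    assert (R := Rpower_lt_neg M0 (solU d M' x t) (pwr d - 1) ltac:(lra) ltac:(lra)).
    replace (- (pwr d - 1)) with (1 - pwr d) in R by ring. rewrite EM0 in R. unfold upow in Q.
    assert (y <= zlo d * (lifespan d x - t)) by (unfold y; apply Rmult_le_compat_l; lra). lra. }
  assert (m1 := Rmax_l (gam d) M0). assert (m2 := Rmax_r (gam d) M0).
  exists (Rmax (gam d) M0 + 1). split. lra. intros x t Ht Hd.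
  destruct (G x t Ht Hd) as (M' & HM' & HMM & Hu).
  apply Rle_lt_trans with (solU d M' x t). apply solU_M_mono; auto; lra. lra.
Qed.

(** Follow the line of slope v, rightwards or leftwards according to th, starting [de] below the
    curve at ys. The sign condition makes u increase along it. If the curve had gained [De > 0] over
    the line, [upow] would be at least zlo De at the end but at most zhi de at the start, although
    it decreases. *)
Lemma segment x0 eta v th ys L :
  (th = 1 \/ th = -1) -> 0 <= L -> 0 < eta ->
  (forall x, Rabs (x - x0) < eta -> eta < lifespan d x) ->
  (forall x t M, Rabs (x - x0) < eta -> 0 <= t < lifespan d x -> lifespan d x - t < eta -> gam d <= M -> solU d M x t < M ->
      forall b, 0 <= th * (rat d M b x t + v)) ->
  (forall k, 0 <= k <= L -> Rabs (ys + th * k - x0) < eta /\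
      0 <= lifespan d (ys + th * k) - v * (th * k) - lifespan d ys < eta / 2) ->
  lifespan d (ys + th * L) - v * (th * L) <= lifespan d ys.
Proof.
  intros Hth HL Heta Hpos Hr Hk.
  set (De := lifespan d (ys + th * L) - v * (th * L) - lifespan d ys).
  destruct (Rle_dec De 0) as [|Hn]; [unfold De in *; lra|]. exfalso.
  assert (zl := zlo_pos d). assert (zh := zhi_pos d). assert (Hp' := pwr_gt1 d). assert (Hg := gam_pos d).
  (* The second bound makes zhi de < zlo De; the first keeps the line within time eta of the curve,
     where the sign condition is known. *)
  set (de := Rmin (eta / 4) (zlo d * De / (2 * zhi d))).
  assert (d1 : de <= eta / 4) by apply Rmin_l. assert (d2 : de <= zlo d * De / (2 * zhi d)) by apply Rmin_r.
  assert (d0 : 0 < de). { unfold de. apply Rmin_pos. lra. apply Rdiv_lt_0_compat; nra. }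
  assert (d3 : zhi d * de < zlo d * De).
  { apply Rmult_le_compat_l with (r := zhi d) in d2; [|lra].
    replace (zhi d * (zlo d * De / (2 * zhi d))) with (zlo d * De / 2) in d2 by (field; lra).
    assert (0 < zlo d * De) by (apply Rmult_lt_0_compat; lra). lra. }
  destruct (uniform_good de d0) as (M & HM & Hgood).
  set (tk := fun k => lifespan d ys - de + (th * v) * k).
  assert (Hseg : forall k, 0 <= k <= L -> 0 <= tk k < lifespan d (ys + th * k) /\ de <= lifespan d (ys + th * k) - tk k < eta).
  { intros k Hk'. destruct (Hk k Hk') as [H1 H2]. assert (H3 := Hpos _ H1). unfold tk. lra. }
  assert (Mono : solU d M (ys + th * 0) (tk 0) <= solU d M (ys + th * L) (tk L)).
  { apply (mono_derive (fun k => solU d M (ys + th * k) (lifespan d ys - de + (th * v) * k))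
      (fun s => (th * rat d M true (ys + th * s) (lifespan d ys - de + (th * v) * s) + th * v) * tau d M true (ys + th * s) (lifespan d ys - de + (th * v) * s)
    + (th * rat d M false (ys + th * s) (lifespan d ys - de + (th * v) * s) + th * v) * tau d M false (ys + th * s) (lifespan d ys - de + (th * v) * s)) 0 L HL).
    - intros s Hs. apply solU_line; auto. apply (Hseg s Hs).
    - intros s Hs. destruct (Hseg s Hs) as [h1 h2]. destruct (Hk s Hs) as [h3 _].
      assert (Q : forall b, 0 <= (th * rat d M b (ys + th * s) (tk s) + th * v) * tau d M b (ys + th * s) (tk s)).
      { intros b. assert (q := Hr (ys + th * s) (tk s) M h3 h1 (proj2 h2) HM (Hgood _ _ (proj1 h1) (proj1 h2)) b).
        destruct (tau_bounds d M HM b (ys + th * s) (tk s) (proj1 h1)) as [t1 _]. apply Rmult_le_pos; lra. }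
      exact (Rplus_le_le_0_compat _ _ (Q true) (Q false)). }
  destruct (Hseg 0 ltac:(lra)) as [a1 a2]. destruct (Hseg L ltac:(lra)) as [b1 b2].
  assert (Zu := upow_upper d M (ys + th * 0) (tk 0) HM (proj1 a1) (Rlt_le _ _ (Hgood _ _ (proj1 a1) (proj1 a2)))).
  assert (Zl := upow_lower d M (ys + th * L) (tk L) HM (proj1 b1) (Rlt_le _ _ (Hgood _ _ (proj1 b1) (proj1 b2)))).
  assert (Zm : upow d M (ys + th * L) (tk L) <= upow d M (ys + th * 0) (tk 0)).
  { unfold upow. replace (1 - pwr d) with (- (pwr d - 1)) by ring.
    assert (G := solU_low d M HM (ys + th * 0) (tk 0) (proj1 a1)).
    destruct (Req_dec (solU d M (ys + th * 0) (tk 0)) (solU d M (ys + th * L) (tk L))) as [->|]; [lra|].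
    apply Rlt_le, Rpower_lt_neg; lra. }
  assert (E0 : lifespan d (ys + th * 0) - tk 0 = de) by (unfold tk; rewrite !Rmult_0_r, !Rplus_0_r; ring).
  assert (EL : De <= lifespan d (ys + th * L) - tk L) by (unfold De, tk; lra).
  rewrite E0 in Zu. apply Rmult_le_compat_l with (r := zlo d) in EL; lra.
Qed.

Lemma lifespan_continuity x : continuity_pt (lifespan d) x.
Proof.
  apply continuity_pt_filterlim. change (continuous (lifespan d) x).
  apply (lip_continuous (lifespan d) (lam d)). intros y. apply lifespan_lip.
Qed.

(** [segment] wants the curve to stay above the line through its starting point; a minimum point ys
    of [lifespan - v y] on [a, b] ensures this. From ys go left to a with v = - rho - eps, and right
    to b with v = - rho + eps; minimality compares ys with the opposite end, giving the two
    one-sided bounds. *)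
Lemma lifespan_strict x0 : strict_at (lifespan d) x0.
Proof.
  intros eps He. assert (HL := lam_range d).
  destruct (ratio_limit x0 eps He) as (eta & rho & Heta & Hpos & Hb).
  (* Every slope v in use satisfies |v| <= B - 2 and the curve is 1-Lipschitz, so within eta' of x0
     the curve departs from such lines by less than eta / 2, as [segment] requires. *)
  set (B := 2 + Rabs rho + eps). assert (HB : 2 + eps <= B) by (unfold B; generalize (Rabs_pos rho); lra).
  set (eta' := eta / (8 * B)).
  assert (Heta' : 0 < eta') by (unfold eta'; apply Rdiv_lt_0_compat; lra).
  assert (EB : B * (8 * eta') = eta) by (unfold eta'; field; lra).
  assert (Hee : eta' < eta) by nra.
  exists eta', (- rho). split; auto.
  assert (VB : forall v, Rabs (v + rho) <= eps -> Rabs v <= B - 2).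
  { intros v Hv. replace v with ((v + rho) + - rho) by ring. apply Rle_trans with (1 := Rabs_triang _ _). rewrite Rabs_Ropp. unfold B. lra. }
  assert (NB : forall v y1 y2, Rabs (v + rho) <= eps -> Rabs (y1 - x0) < eta' -> Rabs (y2 - x0) < eta' ->
     Rabs ((lifespan d y2 - v * y2) - (lifespan d y1 - v * y1)) < eta / 2).
  { intros v y1 y2 Hv H1 H2. assert (V := VB v Hv). assert (T := lifespan_lip d y1 y2).
    replace (_ - _) with ((lifespan d y2 - lifespan d y1) + - (v * (y2 - y1))) by ring.
    apply Rle_lt_trans with (1 := Rabs_triang _ _). rewrite Rabs_Ropp, Rabs_mult.
    assert (Y : Rabs (y2 - y1) < 2 * eta').
    { replace (y2 - y1) with ((y2 - x0) + - (y1 - x0)) by ring. apply Rle_lt_trans with (1 := Rabs_triang _ _). rewrite Rabs_Ropp. lra. }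
    assert (Y0 := Rabs_pos (y2 - y1)). assert (V0 := Rabs_pos v).
    assert (Rabs v * Rabs (y2 - y1) <= (B - 2) * Rabs (y2 - y1)) by (apply Rmult_le_compat_r; auto). nra. }
  assert (Main : forall a b, a <= b -> Rabs (a - x0) < eta' -> Rabs (b - x0) < eta' ->
     (- rho - eps) * (b - a) <= lifespan d b - lifespan d a <= (- rho + eps) * (b - a)).
  { intros a b Hab Ha Hb'.
    assert (In : forall y, a <= y <= b -> Rabs (y - x0) < eta').
    { intros y Hy. apply Rabs_lt_between in Ha. apply Rabs_lt_between in Hb'. apply Rabs_lt_between. lra. }
    assert (Min : forall v, exists ys, (forall c, a <= c <= b -> lifespan d ys - v * ys <= lifespan d c - v * c) /\ a <= ys <= b).
    { intros v. apply (continuity_ab_min (fun y => lifespan d y - v * y)); auto.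
      intros c _. apply continuity_pt_minus. apply lifespan_continuity. apply continuity_pt_mult.
      apply continuity_pt_const. intros ? ?; reflexivity. apply continuity_pt_id. }
    split.
    - destruct (Min (- rho - eps)) as (ys & Hm & Hys). set (v := - rho - eps) in *.
      assert (Hv : Rabs (v + rho) <= eps) by (unfold v; replace (- rho - eps + rho) with (- eps) by ring; rewrite Rabs_Ropp, Rabs_pos_eq; lra).
      assert (S := segment x0 eta v (-1) ys (ys - a) (or_intror eq_refl) ltac:(lra) Heta Hpos).
      assert (S' : lifespan d (ys + -1 * (ys - a)) - v * (-1 * (ys - a)) <= lifespan d ys).
      { apply S; clear S.
        - intros x t M Hx Ht HtT HM Hu i. generalize (Hb x t Hx Ht HtT M HM Hu i). unfold v. lra.
        - intros k Hk. assert (Hy : a <= ys + -1 * k <= b) by lra. split. apply Rlt_trans with (2 := Hee). now apply In.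
          specialize (Hm _ Hy). assert (N := NB v ys (ys + -1 * k) Hv (In _ Hys) (In _ Hy)).
          apply Rabs_lt_between in N. lra. }
      replace (ys + -1 * (ys - a)) with a in S' by ring. specialize (Hm b ltac:(lra)). lra.
    - destruct (Min (- rho + eps)) as (ys & Hm & Hys). set (v := - rho + eps) in *.
      assert (Hv : Rabs (v + rho) <= eps) by (unfold v; replace (- rho + eps + rho) with eps by ring; rewrite Rabs_pos_eq; lra).
      assert (S := segment x0 eta v 1 ys (b - ys) (or_introl eq_refl) ltac:(lra) Heta Hpos).
      assert (S' : lifespan d (ys + 1 * (b - ys)) - v * (1 * (b - ys)) <= lifespan d ys).
      { apply S; clear S.
        - intros x t M Hx Ht HtT HM Hu i. generalize (Hb x t Hx Ht HtT M HM Hu i). unfold v. lra.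
        - intros k Hk. assert (Hy : a <= ys + 1 * k <= b) by lra. split. apply Rlt_trans with (2 := Hee). now apply In.
          specialize (Hm _ Hy). assert (N := NB v ys (ys + 1 * k) Hv (In _ Hys) (In _ Hy)).
          apply Rabs_lt_between in N. lra. }
      replace (ys + 1 * (b - ys)) with b in S' by ring. specialize (Hm a ltac:(lra)). lra. }
  intros a b Ha Hb'. destruct (Rle_dec a b) as [Hab|Hab].
  - rewrite (Rabs_pos_eq (b - a)) by lra. apply Rabs_le_between. generalize (Main a b Hab Ha Hb'). lra.
  - rewrite (Rabs_left (b - a)) by lra. apply Rabs_le_between. generalize (Main b a ltac:(lra) Hb' Ha). lra.
Qed.

Lemma lifespan_C1 x : ex_derive (lifespan d) x /\ continuous (Derive (lifespan d)) x.
Proof.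
  apply (strict_C1 (lifespan d) (fun _ => True)). intros; apply lifespan_strict. now apply filter_forall.
Qed.

End Regularity.

(** * Reduction to global data *)

(** The limits at all points of the closed ball, boundary included, give local bounds; a supremum
    argument along [-L, L] makes them global. *)
Lemma bounded_ball (u : R -> R) (L : R) : 0 < L ->
  (forall y, Rabs y <= L -> exists l : R, filterlim u (within (fun x => Rabs x < L) (locally y)) (locally l)) ->
  exists B, 0 <= B /\ forall x, Rabs x < L -> Rabs (u x) <= B.
Proof.
  intros HL H.
  assert (Loc : forall y, Rabs y <= L -> exists de B, 0 < de /\ forall x, Rabs (x - y) < de -> Rabs x < L -> Rabs (u x) <= B).
  { intros y Hy. destruct (H y Hy) as [l Hl].
    specialize (Hl (fun v => Rabs (v - l) < 1) ltac:(exists (mkposreal 1 Rlt_0_1); intros v Hv; exact Hv)).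
    destruct Hl as [de Hde]. exists de, (Rabs l + 1). split. apply cond_pos.
    intros x Hx HxL. specialize (Hde x Hx HxL).
    replace (u x) with ((u x - l) + l) by ring. apply Rle_trans with (1 := Rabs_triang _ _). lra. }
  set (S := fun b => - L <= b <= L /\ exists B, forall x, Rabs x < L -> x <= b -> Rabs (u x) <= B).
  assert (S0 : S (- L)).
  { split. lra. exists 0. intros x Hx Hxb. apply Rabs_lt_between in Hx. lra. }
  destruct (completeness S) as [s [Hub Hlub]].
  { exists L. intros b [Hb _]. lra. }
  { exists (- L). exact S0. }
  assert (Hs1 : - L <= s) by (apply Hub; auto).
  assert (Hs2 : s <= L) by (apply Hlub; intros b [Hb _]; lra).
  destruct (Loc s ltac:(apply Rabs_le_between; lra)) as (de & B1 & Hde & HB1).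
  assert (Ex : exists b, S b /\ s - de < b).
  { apply Classical_Prop.NNPP. intros Hn. assert (s <= s - de); [|lra]. apply Hlub. intros b Hb.
    destruct (Rle_dec b (s - de)); auto. exfalso. apply Hn. exists b. split; auto. lra. }
  destruct Ex as (b & [Hb [B2 HB2]] & Hbs).
  set (e := Rmin L (s + de / 2)).
  assert (e1 : e <= L) by apply Rmin_l. assert (e2 : e <= s + de / 2) by apply Rmin_r.
  assert (Se : forall x, Rabs x < L -> x <= e -> Rabs (u x) <= Rmax B1 B2).
  { intros x Hx Hxe. destruct (Rle_dec x b) as [Hxb|Hxb].
    - apply Rle_trans with (2 := Rmax_r _ _). auto.
    - apply Rle_trans with (2 := Rmax_l _ _). apply HB1; auto. apply Rabs_lt_between. lra. }
  assert (HeL : e = L).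
  { unfold e, Rmin in *. destruct (Rle_dec L (s + de / 2)); auto. exfalso.
    assert (s + de / 2 <= s); [|lra]. apply Hub. split. lra. exists (Rmax B1 B2). exact Se. }
  exists (Rmax 0 (Rmax B1 B2)). split. apply Rmax_l. intros x Hx. apply Rle_trans with (2 := Rmax_r _ _).
  apply Se; auto. rewrite HeL. apply Rabs_lt_between in Hx. lra.
Qed.

(** * A contraction of the line onto the ball where the data are controlled *)

Section Cutoff.

Variables (L1 L2 : R).
Hypothesis HL1 : 0 < L1.
Hypothesis HL12 : L1 < L2.

Definition cutoff (v : R) : R := Rmax 0 (Rmin 1 ((L2 - Rabs v) / (L2 - L1))).
(** Data composed with this map are defined on the whole line and unchanged on |x| <= L1. The chain
    rule only multiplies their derivative by [cutoff], between 0 and 1, so the lower bounds and the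
    smallness of the derivative survive. *)
Definition squash (x : R) : R := RInt cutoff 0 x.

Lemma cutoff_range v : 0 <= cutoff v <= 1.
Proof.
  unfold cutoff. split. apply Rmax_l. apply Rmax_lub. lra. apply Rmin_l.
Qed.

Lemma cutoff_cont v : continuous cutoff v.
Proof.
  apply (lip_continuous cutoff (/ (L2 - L1))). intros y.
  assert (I : 0 < / (L2 - L1)) by (apply Rinv_0_lt_compat; lra).
  assert (A : forall a b, Rabs (Rmax 0 (Rmin 1 a) - Rmax 0 (Rmin 1 b)) <= Rabs (a - b)).
  { intros a b. unfold Rmax, Rmin, Rabs. repeat destruct Rle_dec; repeat destruct Rcase_abs; lra. }
  unfold cutoff. apply Rle_trans with (1 := A _ _).
  replace ((L2 - Rabs y) / (L2 - L1) - (L2 - Rabs v) / (L2 - L1)) with (/ (L2 - L1) * (Rabs v - Rabs y)) by (field; lra).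
  rewrite Rabs_mult, (Rabs_pos_eq (/ (L2 - L1))) by lra. apply Rmult_le_compat_l. lra.
  rewrite (Rabs_minus_sym y v). apply Rabs_triang_inv2.
Qed.

Lemma cutoff_1 v : Rabs v <= L1 -> cutoff v = 1.
Proof.
  intros Hv. unfold cutoff. assert (1 <= (L2 - Rabs v) / (L2 - L1)).
  { apply Rmult_le_reg_r with (L2 - L1). lra. unfold Rdiv. rewrite Rmult_assoc, Rinv_l; lra. }
  rewrite Rmin_left, Rmax_right; lra.
Qed.

Lemma cutoff_0 v : L2 <= Rabs v -> cutoff v = 0.
Proof.
  intros Hv. unfold cutoff. apply Rmax_left. apply Rle_trans with (1 := Rmin_r _ _).
  apply Rmult_le_reg_r with (L2 - L1). lra. unfold Rdiv. rewrite Rmult_assoc, Rinv_l; lra.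
Qed.

Lemma squash_derive x : is_derive squash x (cutoff x).
Proof. apply (is_derive_prim cutoff 0 x). apply cutoff_cont. Qed.

Lemma squash_id x : Rabs x <= L1 -> squash x = x.
Proof.
  intros Hx. unfold squash. rewrite (RInt_ext cutoff (fun _ => 1)).
  - rewrite RInt_cst. ring.
  - intros v Hv. apply cutoff_1. apply Rabs_le_between in Hx. apply Rabs_le_between.
    unfold Rmin, Rmax in Hv. destruct (Rle_dec 0 x); lra.
Qed.

Lemma squash_range x : Rabs (squash x) <= L2.
Proof.
  assert (S : forall b, Rabs b <= L2 -> Rabs (RInt cutoff 0 b) <= L2).
  { intros b Hb. apply Rle_trans with (Rabs (b - 0) * 1).
    - apply abs_RInt_le_gen. apply cutoff_cont. intros s _. generalize (cutoff_range s). intros. rewrite Rabs_pos_eq; lra.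
    - rewrite Rminus_0_r. lra. }
  destruct (Rle_dec (Rabs x) L2) as [Hx|Hx]; [now apply S|].
  assert (Z : forall b, Rabs b = L2 -> (forall v, Rmin b x < v < Rmax b x -> L2 <= Rabs v) -> Rabs (squash x) <= L2).
  { intros b Hb Hv. unfold squash. rewrite <- (RInt_Chasles cutoff 0 b x) by (apply ex_RInt_cont, cutoff_cont).
    assert (E : RInt cutoff b x = 0).
    { rewrite (RInt_ext cutoff (fun _ => 0)). rewrite RInt_cst. Rring. intros v Hv'. apply cutoff_0; auto. }
    rewrite E. change plus with Rplus. rewrite Rplus_0_r. apply S. lra. }
  destruct (Rle_dec 0 x) as [H0|H0].
  - rewrite Rabs_pos_eq in Hx by auto. apply (Z L2). rewrite Rabs_pos_eq; lra.
    intros v Hv. rewrite Rmin_left in Hv by lra. rewrite Rabs_pos_eq; lra.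
  - rewrite Rabs_left in Hx by lra. apply (Z (- L2)). rewrite Rabs_Ropp, Rabs_pos_eq; lra.
    intros v Hv. rewrite Rmax_left in Hv by lra. rewrite Rabs_left; lra.
Qed.

End Cutoff.

Lemma iterates_pic p mu (F : bool -> R -> R) (c : bool -> R) n : forall x t,
  phi_n p mu (F true) (F false) (c true) (c false) n x t = pic (nonlin p mu) F c n true x t /\
  psi_n p mu (F true) (F false) (c true) (c false) n x t = pic (nonlin p mu) F c n false x t.
Proof.
  unfold phi_n, psi_n. induction n as [|n IH]; intros x t.
  - split; reflexivity.
  - simpl. destruct (iterates p mu _ _ _ _ n) as [ph ps]. cbn [fst snd] in IH |- *. unfold charop, src.
    split; (apply (f_equal2 Rplus); [f_equal; simpl; ring|]; apply RInt_ext; intros s _).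
    + replace (x + _ * (t - s)) with (x + t - s) by (simpl; ring). destruct (IH (x + t - s) s) as [-> ->]. reflexivity.
    + replace (x + _ * (t - s)) with (x - t + s) by (simpl; ring). destruct (IH (x - t + s) s) as [-> ->]. reflexivity.
Qed.

(** * The original iterates and the truncated solutions *)

Section Link.

Variables (d : data) (F : bool -> R -> R) (L1 : R).
Hypothesis HF : forall b y, Rabs y <= L1 -> F b y = ini d b y.

Let ph n b x t := pic (nonlin (pwr d) (damp d)) F (low d) n b x t.

Lemma data_near x t b y : Rabs x + t <= L1 -> Rabs (y - x) <= t -> F b y = ini d b y.
Proof.
  intros Hx Hy. apply HF. replace y with ((y - x) + x) by ring. apply Rle_trans with (1 := Rabs_triang _ _). lra.
Qed.

Lemma nl_nonlin M u s : gam d <= u <= M -> 0 <= s -> nonlin (pwr d) (damp d) u s = nl d M u s.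
Proof. intros Hu Hs. symmetry. apply tnl_eq; auto using gam_pos. Qed.

Lemma self_cone (x t : R) : Rabs (x - x) <= t - t.
Proof. rewrite !Rminus_diag, Rabs_R0. lra. Qed.

Lemma iterates_le_sol M n b x t : gam d <= M -> Rabs x + t <= L1 -> 0 <= t -> solU d M x t <= M ->
  ph n b x t <= sol d M b x t.
Proof.
  intros HM Hx Ht Hu. unfold ph.
  rewrite (it_agree d M HM (nonlin (pwr d) (damp d)) F x t n b x t (nl_nonlin M)
    (fun b y Hy => data_near x t b y Hx Hy) Hu Ht (self_cone x t)).
  now apply it_le_sol.
Qed.

(** Finiteness of the exact solution is not assumed here. The first n iterates are bounded uniformly
    in the level, so at level [Rmax M C] the truncation does not touch them and they are the
    original ones; going down to [M] only decreases them. *)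
Lemma it_le_iterates M n b x t : gam d <= M -> Rabs x + t <= L1 -> 0 <= t -> it d M n b x t <= ph n b x t.
Proof.
  intros HM Hx Ht.
  assert (Bk : exists C, forall k M' y s, (k < n)%nat -> gam d <= M' -> 0 <= s <= t -> it d M' k true y s + it d M' k false y s <= C).
  { clear ph. induction n as [|m [C HC]].
    - exists 0. intros. lia.
    - destruct (it_uniform_bound d m t Ht) as (C' & _ & HC').
      exists (Rmax C C'). intros k M' y s Hk HM' Hs. destruct (Nat.eq_dec k m) as [->|Hne].
      + apply Rle_trans with (2 := Rmax_r _ _). now apply HC'.
      + apply Rle_trans with (2 := Rmax_l _ _). apply HC; auto. lia. }
  destruct Bk as [C HC].
  assert (m1 := Rmax_l M C). assert (m2 := Rmax_r M C). assert (HM' : gam d <= Rmax M C) by lra.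
  unfold ph. rewrite (it_agree_aux d (Rmax M C) HM' (nonlin (pwr d) (damp d)) F x t n (nl_nonlin (Rmax M C))
    (fun b y Hy => data_near x t b y Hx Hy)) by
    (auto using self_cone; intros k y s Hk Hs Hy; apply Rle_trans with (2 := m2); apply HC; auto; generalize (Rabs_pos (y - x)); lra).
  now apply it_M_mono.
Qed.

Lemma Sup_seq_ub (u : nat -> R) n : Rbar_le (u n) (Sup_seq (fun n => u n)).
Proof.
  apply Rbar_not_lt_le. intros Hl.
  apply (Rbar_lt_not_le _ _ Hl), (Sup_seq_minor_le (fun n => u n) (u n) n), Rle_refl.
Qed.

Lemma Sup_seq_least (u : nat -> R) (l : R) : (forall n, u n <= l) -> Rbar_le (Sup_seq (fun n => u n)) l.
Proof.
  intros Hu. apply Rbar_not_lt_le. intros Hl. apply Sup_seq_minor_lt in Hl. destruct Hl as [n Hn].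
  simpl in Hn. specialize (Hu n). lra.
Qed.

Lemma fin_iff x t : Rabs x + t <= L1 -> 0 <= t ->
  (fin d x t <-> Rbar_lt (Rbar_plus (phi_sup (pwr d) (damp d) (F true) (F false) (low d true) (low d false) x t)
    (psi_sup (pwr d) (damp d) (F true) (F false) (low d true) (low d false) x t)) p_infty).
Proof.
  intros Hx Ht. unfold phi_sup, psi_sup.
  assert (E := fun n => iterates_pic (pwr d) (damp d) F (low d) n x t).
  rewrite (Sup_seq_ext _ (fun n => ph n true x t)) by (intros n; now rewrite (proj1 (E n))).
  rewrite (Sup_seq_ext (fun n => Finite (psi_n _ _ _ _ _ _ n x t)) (fun n => ph n false x t)) by (intros n; now rewrite (proj2 (E n))).
  split.
  - intros [M [HM Hu]].
    assert (A := fun b => Sup_seq_least (fun n => ph n b x t) (sol d M b x t) (fun n => iterates_le_sol M n b x t HM Hx Ht Hu)).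
    assert (At := A true). assert (Af := A false).
    destruct (Sup_seq (fun n => ph n true x t)); try contradiction;
    destruct (Sup_seq (fun n => ph n false x t)); try contradiction; simpl; auto.
  - intros Hl.
    assert (A := Sup_seq_ub (fun n => ph n true x t)). assert (B := Sup_seq_ub (fun n => ph n false x t)).
    assert (A0 := A 0%nat). assert (B0 := B 0%nat).
    destruct (Sup_seq (fun n => ph n true x t)) as [a| |]; try contradiction;
    destruct (Sup_seq (fun n => ph n false x t)) as [b| |]; try contradiction.
    simpl in A, B, A0, B0. unfold ph in A0, B0. simpl in A0, B0.
    (* The finite suprema themselves provide the level M = a + b. *)
    assert (HM : gam d <= a + b) by (unfold gam; lra).
    assert (Lim := fun i c (Hc : forall n, ph n i x t <= c) => lim_le (fun n => it d (a + b) n i x t) (fun _ => c) _ _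
      (fun n => Rle_trans _ _ _ (it_le_iterates (a + b) n i x t HM Hx Ht) (Hc n)) (sol_lim d (a + b) HM i x t) (is_lim_seq_const c)).
    exists (a + b). split; auto. apply Rplus_le_compat; now apply Lim.
Qed.

(** Since the lifespan is at most [T1 < Tstar], the cap t < Tstar is inactive, and all cones
    involved stay in the ball where F and the extended data agree. *)
Lemma blowup_lifespan Tstar x : Rabs x + Tstar <= L1 -> T1 (pwr d) (damp d) (low d true) (low d false) < Tstar ->
  blowup_time (pwr d) (damp d) (F true) (F false) (low d true) (low d false) Tstar x = Finite (lifespan d x).
Proof.
  intros Hx HT1. unfold blowup_time. apply is_lub_Rbar_unique. assert (TP := lifespan_pos d x). assert (TL := lifespan_le_T1 d x).
  split.
  - intros t [Ht Hl]. apply fin_iff in Hl; try lra. simpl. apply Rlt_le, lifespan_ub; auto. lra.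
  - intros b Hb.
    assert (In : forall t, 0 < t < lifespan d x -> Rbar_le t b).
    { intros t Ht. apply Hb. split. lra. apply fin_iff; try lra. apply lifespan_fin. lra. }
    destruct b as [b| |]; simpl; auto.
    + destruct (Rle_dec (lifespan d x) b) as [|Hn]; auto. exfalso.
      assert (m1 := Rmax_l 0 b). assert (m2 := Rmax_r 0 b).
      assert (m3 : Rmax 0 b < lifespan d x) by (apply Rmax_lub_lt; lra).
      specialize (In ((Rmax 0 b + lifespan d x) / 2) ltac:(lra)). simpl in In. lra.
    + exact (In (lifespan d x / 2) ltac:(lra)).
Qed.

End Link.

(** [real] sends an infinite supremum to 0, so boundedness of the derivatives is needed before
    [max_deriv] really dominates them. *)
Lemma max_deriv_bound L f g : 0 < L ->
  (exists B, forall x, Rabs x < L -> Rabs (Derive f x) <= B) ->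
  (exists B, forall x, Rabs x < L -> Rabs (Derive g x) <= B) ->
  forall x, Rabs x < L -> Rabs (Derive f x) + Rabs (Derive g x) <= max_deriv L f g.
Proof.
  intros HL [B1 H1] [B2 H2] x Hx. unfold max_deriv.
  assert (H := Lub_Rbar_correct (fun y => exists x, Rabs x < L /\ y = Rabs (Derive f x) + Rabs (Derive g x))).
  destruct H as [Hub Hl].
  assert (U := Hub _ (ex_intro _ x (conj Hx eq_refl))).
  assert (V := Hl (Finite (B1 + B2)) ltac:(intros y [z [Hz ->]]; simpl; specialize (H1 z Hz); specialize (H2 z Hz); lra)).
  destruct (Lub_Rbar _) as [l| |]; simpl in *; try contradiction; auto.
Qed.

(** The cutoff takes place between the domain of dependence R' + Tstar and the radius Rstar + Tstar;
    this gap is why R' stays strictly below Rstar. *)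
Lemma local_data p mu Rstar Tstar gamma1 gamma2 f g R'
  (Hp : 1 < p) (Hmu : 0 < mu) (HT : 0 < Tstar) (Hg1 : 0 < gamma1) (Hg2 : 0 < gamma2)
  (Hgam : gamma1 + gamma2 > Rmax 1 (Rpower (mu * p * Rpower 2 p) (/ (p - 1))))
  (A1 : T1 p mu gamma1 gamma2 < Tstar)
  (A2 : forall x, Rabs x < Rstar + Tstar -> gamma1 <= f x /\ gamma2 <= g x)
  (A3f : Ck_closed_ball 1 (Rstar + Tstar) f)
  (A3g : Ck_closed_ball 1 (Rstar + Tstar) g)
  (A4 : exists eps0, 0 < eps0 /\
      (2 + eps0) * max_deriv (Rstar + Tstar) f g <=
      Rpower 2 (- p) * Rpower (gamma1 + gamma2) p - mu / 2 * (gamma1 + gamma2)) :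
  0 <= R' < Rstar ->
  exists d : data, forall x, Rabs x <= R' -> blowup_time p mu f g gamma1 gamma2 Tstar x = Finite (lifespan d x).
Proof.
  intros HR'. set (L := Rstar + Tstar) in *. assert (HL : 0 < L) by (unfold L; lra).
  set (L1 := R' + Tstar). set (L2 := (L1 + L) / 2).
  assert (HL1 : 0 < L1) by (unfold L1; lra). assert (HL12 : L1 < L2) by (unfold L2, L1, L; lra).
  assert (HL2 : L2 < L) by (unfold L2, L1, L; lra).
  destruct A4 as [eps0 [He0 HA4]].
  set (F := fun b : bool => if b then f else g).
  assert (HF : forall b, Ck_closed_ball 1 L (F b)) by (intros []; auto). clear A3f A3g.
  assert (DF : forall b x, Rabs x < L -> is_derive (F b) x (Derive (F b) x)).
  { intros b x Hx. apply Derive_correct. exact (proj1 (proj1 (HF b) 1%nat (le_n _) x Hx)). }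
  assert (BF : forall j, (j <= 1)%nat -> exists B, 0 <= B /\ forall b x, Rabs x < L -> Rabs (Derive_n (F b) j x) <= B).
  { intros j Hj. destruct (bounded_ball _ L HL (proj2 (HF true) j Hj)) as (B & B0 & HB).
    destruct (bounded_ball _ L HL (proj2 (HF false) j Hj)) as (B' & B0' & HB').
    exists (B + B'). split. lra. intros [] x Hx; [specialize (HB x Hx) | specialize (HB' x Hx)]; lra. }
  destruct (BF 0%nat ltac:(lia)) as (B0 & b0 & HB0). destruct (BF 1%nat ltac:(lia)) as (B1 & b1 & HB1). simpl in HB0, HB1.
  assert (HMD := max_deriv_bound L f g HL (ex_intro _ B1 (HB1 true)) (ex_intro _ B1 (HB1 false))).
  set (th := squash L1 L2). set (ch := cutoff L1 L2).
  assert (Rth : forall x, Rabs (th x) < L) by (intros x; apply Rle_lt_trans with (2 := HL2); apply squash_range; auto).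
  assert (Rch : forall x, 0 <= ch x <= 1) by (intros x; apply cutoff_range).
  assert (Dth : forall x, is_derive th x (ch x)) by (intros x; apply squash_derive; auto).
  assert (Cth : forall x, continuous th x) by (intros x; apply (ex_derive_continuous th); eexists; apply Dth).
  set (gm := gamma1 + gamma2) in *.
  assert (mR1 := Rmax_l 1 (Rpower (mu * p * Rpower 2 p) (/ (p - 1)))).
  assert (mR2 := Rmax_r 1 (Rpower (mu * p * Rpower 2 p) (/ (p - 1)))).
  (* The assumed lower bound on gm gives gm^(p-1) >= mu p 2^p, and p > 1. *)
  assert (HG : mu <= Rpower 2 (- p) * Rpower gm (p - 1)).
  { assert (X := Rpower_pos 2 p). assert (Y : 0 < mu * p * Rpower 2 p) by (apply Rmult_lt_0_compat; auto; nra).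
    assert (Q : mu * p * Rpower 2 p <= Rpower gm (p - 1)).
    { apply Rle_trans with (Rpower (Rpower (mu * p * Rpower 2 p) (/ (p - 1))) (p - 1)).
      - rewrite Rpower_mult, Rinv_l, Rpower_1 by lra. apply Rle_refl.
      - apply Rle_Rpower_l. lra. split. apply Rpower_pos. lra. }
    rewrite Rpower_Ropp. apply Rmult_le_reg_l with (1 := X). rewrite <- Rmult_assoc, Rinv_r, Rmult_1_l by lra.
    apply Rle_trans with (2 := Q). assert (0 < mu * Rpower 2 p) by (apply Rmult_lt_0_compat; auto). nra. }
  assert (DB : forall v c B, Rabs v <= B -> 0 <= c <= 1 -> Rabs (v * c) <= B).
  { intros v c B Hv Hc. rewrite Rabs_mult, (Rabs_pos_eq c) by lra. generalize (Rabs_pos v). nra. }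
  (* The aperture is 1 + eps0, so that [1 + slope] is the factor 2 + eps0 of [A4]. *)
  unshelve eexists (mkData p mu (fun b => if b then gamma1 else gamma2) (1 + eps0) (B0 + B1)
    (fun b x => F b (th x)) (fun b x => Derive (F b) (th x) * ch x) Hp Hmu _ _ _ HG _ _ _ _ _ _).
  - intros []; auto.
  - lra.
  - lra.
  - intros b x. cbv beta. rewrite Rmult_comm. apply (is_derive_comp (F b) th); auto.
  - intros b x. apply (continuous_mult (fun x => Derive (F b) (th x)) ch).
    apply (continuous_comp th (Derive (F b))); auto. exact (proj2 (proj1 (HF b) 1%nat (le_n _) (th x) (Rth x))).
    apply cutoff_cont; auto.
  - intros b x. specialize (HB0 b (th x) (Rth x)). cbv beta. lra.
  - intros b x. apply DB; auto. apply Rle_trans with B1; [exact (HB1 b _ (Rth x)) | lra].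
  - intros b x. destruct (A2 (th x) (Rth x)). destruct b; auto.
  - intros b x. apply Rle_trans with (2 := HA4). replace (1 + (1 + eps0)) with (2 + eps0) by ring.
    apply Rmult_le_compat_l. lra. apply DB; auto. specialize (HMD (th x) (Rth x)).
    generalize (Rabs_pos (Derive f (th x))) (Rabs_pos (Derive g (th x))). destruct b; simpl; lra.
  - intros x Hx.
    match goal with |- _ = Finite (lifespan ?dd x) => apply (blowup_lifespan dd F L1) end; simpl; auto.
    + intros b y Hy. unfold th. now rewrite squash_id.
    + unfold L1. lra.
Qed.

Theorem theorem3p5
  (p mu Rstar Tstar gamma1 gamma2 : R) (f g : R -> R)
  (Hp : 1 < p) (Hmu : 0 < mu) (Hpmu : p < 1 + 2 / mu)
  (HR : 0 < Rstar) (HT : 0 < Tstar)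
  (Hg1 : 0 < gamma1) (Hg2 : 0 < gamma2)
  (Hgam : gamma1 + gamma2 > Rmax 1 (Rpower (mu * p * Rpower 2 p) (/ (p - 1))))
  (A1 : T1 p mu gamma1 gamma2 < Tstar)
  (A2 : forall x, Rabs x < Rstar + Tstar -> gamma1 <= f x /\ gamma2 <= g x)
  (A3f : Ck_closed_ball 4 (Rstar + Tstar) f)
  (A3g : Ck_closed_ball 4 (Rstar + Tstar) g)
  (A4 : exists eps0, 0 < eps0 /\
      (2 + eps0) * max_deriv (Rstar + Tstar) f g <=
      Rpower 2 (- p) * Rpower (gamma1 + gamma2) p - mu / 2 * (gamma1 + gamma2))
  (A5 : exists eps1, eps1 <> -1 /\
      Rpower 2 (- p) * (2 * p - 1) * (1 + eps1 / (2 * (1 + eps1))) * (1 - / (2 * p))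
        - Rpower 2 (- p + 1) * p - mu > 0 /\
      (2 + eps1) * max_deriv (Rstar + Tstar) f g <=
      Rpower 2 (- p) * Rpower (gamma1 + gamma2) p - mu / 2 * (gamma1 + gamma2)) :
  exists Tr : R -> R,
    (forall x, Rabs x < Rstar ->
       blowup_time p mu f g gamma1 gamma2 Tstar x = Finite (Tr x)) /\
    C1_on_ball Rstar Tr.
Proof.
  assert (CK : forall ff, Ck_closed_ball 4 (Rstar + Tstar) ff -> Ck_closed_ball 1 (Rstar + Tstar) ff).
  { intros ff [H1 H2]. split; intros j Hj; [apply H1 | apply H2]; lia. }
  assert (LD := fun R' => local_data p mu Rstar Tstar gamma1 gamma2 f g R' Hp Hmu HT Hg1 Hg2 Hgam A1 A2 (CK f A3f) (CK g A3g) A4).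
  exists (fun x => real (blowup_time p mu f g gamma1 gamma2 Tstar x)). split.
  - intros x Hx. destruct (LD (Rabs x) (conj (Rabs_pos x) Hx)) as [d Hd]. rewrite Hd; auto. apply Rle_refl.
  - intros x Hx. assert (X := Rabs_pos x).
    (* The radius halfway between |x| and Rstar makes the blow-up time coincide with one [lifespan]
       on a neighbourhood of x, which is all that a local property requires. *)
    destruct (LD ((Rabs x + Rstar) / 2) ltac:(lra)) as [d Hd].
    assert (Near : forall y, Rabs y < (Rabs x + Rstar) / 2 ->
      locally y (fun z => lifespan d z = real (blowup_time p mu f g gamma1 gamma2 Tstar z))).
    { intros y Hy. exists (mkposreal _ (proj2 (Rlt_0_minus _ _) Hy)). intros z Hz. change (Rabs (z - y) < (Rabs x + Rstar) / 2 - Rabs y) in Hz.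
      rewrite Hd; auto. replace z with ((z - y) + y) by ring. apply Rle_trans with (1 := Rabs_triang _ _). lra. }
    destruct (lifespan_C1 d x) as [D1 D2]. split.
    + apply (ex_derive_ext_loc (lifespan d)); auto. apply Near. lra.
    + apply (continuous_ext_loc _ (Derive (lifespan d))); auto.
      exists (mkposreal ((Rstar - Rabs x) / 2) ltac:(lra)). intros y Hy. change (Rabs (y - x) < (Rstar - Rabs x) / 2) in Hy.
      apply Derive_ext_loc, Near. replace y with ((y - x) + x) by ring. apply Rle_lt_trans with (1 := Rabs_triang _ _). lra.
Qed.
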